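(* Let $n<11$, let $2\leq k\leq \lfloor n/2\rfloor$, and let $G\leq \mathcal{S}_n$ have the $k$-universal transversal property. Then $G$ is $k$-homogeneous, with the following exceptions: (1) $n=5$, $G\cong C_5$ or $D(2*5)$, and $k=2$; (2) $n=6$, $G\cong \mathrm{PSL}(2,5)$, and $k=3$; (3) $n=7$, $G\cong C_7$ or $G\cong D(2*7)$, and $k=2$; or $G\cong \mathrm{AGL}(1,7)$ and $k=3$; (4) $n=8$, $G\cong \mathrm{PGL}(2,7)$, and $k=4$; (5) $n=9$, $G\cong 3^2:4$ or $G\cong 3^2:D(2*4)$, and $k=2$; (6) $n=10$, $G\cong \mathcal{A}_5$ or $G\cong \mathcal{S}_5$, and $k=2$; or $G\cong \mathrm{PSL}(2,9)$ or $G\cong\mathcal{S}_6$, and $k=3$.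
   Context: $\mathcal{S}_n$ and $\mathcal{A}_n$ are the symmetric and alternating groups on $[n]=\{1,\ldots,n\}$. A $k$-partition is a partition of $[n]$ into $k$ nonempty blocks; a section (transversal) for a partition is a set containing exactly one point from each block. $G\leq\mathcal{S}_n$ has the $k$-universal transversal property if for every $k$-subset $I\subseteq[n]$ and every $k$-partition $P$ of $[n]$ there is $g\in G$ such that $Ig$ is a section for $P$. $G$ is $k$-homogeneous if it is transitive on the $k$-subsets of $[n]$. $D(2*m)$ is the dihedral group of order $2m$. Groups are identified up to permutation isomorphism in their usual primitive actions of the stated degree: $C_n$ and $D(2*n)$ act on $n$ points; $\mathrm{AGL}(1,7)$ acts on $\mathrm{GF}(7)$; $\mathrm{PSL}(2,q)$ and $\mathrm{PGL}(2,q)$ act on the $q+1$ points of the projective line; $3^2:4$ and $3^2:D(2*4)$ act on the 9 points of the affine plane over $\mathrm{GF}(3)$, with point stabilisers cyclic of order 4 and dihedral of order 8 in $\mathrm{GL}(2,3)$; $\mathcal{A}_5$ and $\mathcal{S}_5$ act on the ten 2-subsets of a 5-set; and $\mathcal{S}_6\cong \mathrm{P}\Sigma\mathrm{L}(2,9)$ acts on the 10 points of the projective line over $\mathrm{GF}(9)$. *)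

(* Defs.v *)
From mathcomp Require Import all_boot all_order all_fingroup all_algebra.
From mathcomp Require Import all_solvable all_field.

Set Implicit Arguments.
Unset Strict Implicit.
Unset Printing Implicit Defensive.

Import GRing.Theory.
Local Open Scope ring_scope.

Definition universal_transversal (T : finType) (k : nat)
    (G : {set {perm T}}) : Prop :=
  forall (I : {set T}) (P : {set {set T}}),
    #|I| = k -> partition P [set: T] -> #|P| = k ->
  exists2 g : {perm T}, g \in G & is_transversal (g @: I) P [set: T].

Definition homogeneous (T : finType) (k : nat) (G : {set {perm T}}) : bool :=
  [transitive G, on [set A : {set T} | #|A| == k] | 'P^*].

Definition perm_isomorphic (T U : finType)
    (G : {set {perm T}}) (H : {set {perm U}}) : Prop :=
  exists (f : T -> U) (phi : {morphism G >-> {perm U}}),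
    [/\ bijective f, isom G H phi &
        forall (g : {perm T}) (x : T), g \in G -> f (g x) = phi g (f x)].

(* With 'I_n the set {0, ..., n-1}: ordS is x |-> x + 1 mod n and rev_ord is
   x |-> n - 1 - x, a reflection of the n-gon. *)
Definition rotation (n : nat) : 'S_n := perm (@ordS_inj n).
Definition reflection (n : nat) : 'S_n := perm (@rev_ord_inj n).

Definition cyclic_group (n : nat) : {group 'S_n} := <[rotation n]>%G.
Definition dihedral_group (n : nat) : {group 'S_n} :=
  <<[set rotation n; reflection n]>>%G.

Definition AGL1 (F : finFieldType) : {set {perm F}} :=
  [set p : {perm F} | [exists a : F, exists b : F,
     (a != 0) && [forall x, p x == a * x + b]]].

(* The semidirect product F^2 : H. *)
Definition affine_group2 (F : finFieldType) (H : {set {'GL_2[F]}}) :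
    {set {perm 'rV[F]_2}} :=
  [set p : {perm 'rV[F]_2} | [exists A in H, exists b : 'rV[F]_2,
     [forall v, p v == v *m GLval A + b]]].

(* p is the permutation that f induces on the subsets satisfying P. *)
Definition induced_by (T : finType) (P : pred {set T})
    (f : T -> T) (p : {perm {A : {set T} | P A}}) : bool :=
  [forall A, val (p A) == f @: val A].

Definition is_line (F : finFieldType) (L : {set 'rV[F]_2}) : bool :=
  [exists v : 'rV[F]_2, (v != 0) && (L == [set c *: v | c : F])].

Definition proj_line (F : finFieldType) : finType :=
  {L : {set 'rV[F]_2} | is_line L}.

Definition PGL2 (F : finFieldType) : {set {perm proj_line F}} :=
  [set p : {perm proj_line F} | [exists A : 'M[F]_2,
     (A \in unitmx) && induced_by (fun v => v *m A) p]].

Definition PSL2 (F : finFieldType) : {set {perm proj_line F}} :=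
  [set p : {perm proj_line F} | [exists A : 'M[F]_2,
     (\det A == 1) && induced_by (fun v => v *m A) p]].

Definition field_automorphism (F : finFieldType) (s : {perm F}) : bool :=
  (s 1 == 1) && [forall x, forall y,
     (s (x + y) == s x + s y) && (s (x * y) == s x * s y)].

(* PSL(2,F) extended by the field automorphisms, which act coordinatewise. *)
Definition PSigmaL2 (F : finFieldType) : {set {perm proj_line F}} :=
  [set p : {perm proj_line F} | [exists A : 'M[F]_2, exists s : {perm F},
     [&& \det A == 1, field_automorphism s &
         induced_by (fun v => map_mx s v *m A) p]]].

Definition two_subsets (n : nat) : finType :=
  {A : {set 'I_n} | #|A| == 2%N}.

Definition on_two_subsets (n : nat) (H : {set 'S_n}) :
    {set {perm two_subsets n}} :=
  [set p : {perm two_subsets n} | [exists s in H, induced_by (s : {perm _}) p]].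

Lemma X2D1_monic_irreducible :
  monic_irreducible_poly ('X^2 + 1 : {poly 'F_3}).
Proof.
have sz : size ('X^2 + 1 : {poly 'F_3}) = 3%N by rewrite -polyC1 size_XnaddC.
split; last by rewrite -polyC1 monicXnaddC.
apply: cubic_irreducible; first by rewrite sz.
by move=> x; rewrite /root !hornerE; case: x => [] [|[|[|]]].
Qed.

Definition GF9 : finFieldType :=
  {poly %/ ('X^2 + 1 : {poly 'F_3}) with X2D1_monic_irreducible}.

(* All subgroups H of GL(2,3) that are cyclic of order 4 (resp. dihedral of
   order 8) are conjugate, so each of 3^2:4 and 3^2:D(2*4) is determined up to
   permutation isomorphism by the isomorphism type of H. *)
Definition exceptional (n k : nat) (G : {group 'S_n}) : Prop :=
  [\/ [/\ n = 5%N, k = 2%N &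
          perm_isomorphic G (cyclic_group 5) \/
          perm_isomorphic G (dihedral_group 5)],
      [/\ n = 6%N, k = 3%N & perm_isomorphic G (PSL2 'F_5)] |
      [/\ n = 7%N, k = 2%N &
          perm_isomorphic G (cyclic_group 7) \/
          perm_isomorphic G (dihedral_group 7)] \/
      [/\ n = 7%N, k = 3%N & perm_isomorphic G (AGL1 'F_7)]] \/
  [\/ [/\ n = 8%N, k = 4%N & perm_isomorphic G (PGL2 'F_7)],
      [/\ n = 9%N, k = 2%N &
          exists2 H : {group {'GL_2['F_3]}},
            cyclic H /\ #|H| = 4%N \/ H \isog 'D_8 &
            perm_isomorphic G (affine_group2 H)] |
      [/\ n = 10%N, k = 2%N &
          perm_isomorphic G (on_two_subsets ('Alt_('I_5))%g) \/
          perm_isomorphic G (on_two_subsets ('Sym_('I_5))%g)] \/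
      [/\ n = 10%N, k = 3%N &
          perm_isomorphic G (PSL2 GF9) \/
          perm_isomorphic G (PSigmaL2 GF9)]].

(* Main.v *)
(* G is k-homogeneous unless some family X of k-sets is G-invariant and neither
   empty nor everything.  The universal transversal property says that X and its
   complement each contain a rainbow set for every colouring of the points with k
   colours, and that they contain subsets of every k-set one size down; so X is a
   solution of a finite constraint problem.  It becomes small because G contains
   a known subgroup T: G is transitive, even 2-homogeneous by Ramsey arguments
   when k > 2, hence by Cauchy and Sylow theorems it contains cycles of prime
   length or a regular group of order 9, and X is a union of T-orbits.  When G is
   t-homogeneous, moreover, X is a t-design.
   A search over the unions of T-orbits leaves, up to relabelling, one family for
   each exceptional pair (n, k).  Since it is minimal, G is transitive on X, and
   generators of G can be read off: for each prescribed pair A, B in X some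
   automorphism of X in G maps A to B.  As G lies between the group generated by
   these and the automorphism group of X, it is one of the listed groups.
   Conversely each listed group has at least two orbits on k-sets, and each of its
   orbits contains a rainbow set for every colouring. *)

Require Import Defs.
From mathcomp Require Import all_boot all_order all_fingroup all_algebra.
From mathcomp Require Import all_solvable all_field.
From mathcomp Require Import zify ring.

Set Implicit Arguments.
Unset Strict Implicit.
Unset Printing Implicit Defensive.

(** * Subsets as bit lists, permutations as lists of images *)

(** Searches and checks run on bit lists and image lists, so that [vm_compute] can evaluate them,
    while the group remains an unknown of which only a few listed elements are at hand. Each checker
    is proved sound in one direction only: survivors, relabelings, words and fuel are certificates,
    and a wrong one merely makes a check fail. The choice of T is dictated by divisibility: the
    order of a t-homogeneous group is a multiple of the binomial coefficient of n over t, and a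
    prime p dividing it with 2 p > n gives a single p-cycle. Elsewhere the number of cycles is split
    into cases (n = 6 and 10 with k = 2), or a fixed-point-free involution is taken (n = 8, k = 2),
    or a regular group of order 9 (n = 9, and n = 10 with k > 2, there inside a point stabiliser).
    In degree 4 the search runs over all families. Clauses on X alone can have solutions that come
    from no group. [refine] tests such a solution on derived families: the sets with a prescribed
    pattern of exchanges that lead into X form an invariant family again, subject to the same
    clauses. *)

Fixpoint subsets (n k : nat) : seq bitseq :=
  match n, k with
  | 0, 0 => [:: [::]]
  | 0, _.+1 => [::]
  | n'.+1, 0 => [seq false :: b | b <- subsets n' 0]
  | n'.+1, k'.+1 => [seq true :: b | b <- subsets n' k'] ++
                    [seq false :: b | b <- subsets n' k]
  end.

Lemma mem_map_cons (x y : bool) (b : bitseq) (s : seq bitseq) :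
  (x :: b \in [seq y :: c | c <- s]) = (x == y) && (b \in s).
Proof.
apply/mapP/andP => [[c cs [-> ->]]|[/eqP -> bs]]; first by rewrite eqxx.
by exists b.
Qed.

Lemma mem_subsets (n k : nat) (b : bitseq) :
  (b \in subsets n k) = (size b == n) && (count id b == k).
Proof.
elim: n k b => [|n IH] [|k] [|[] b] //=; rewrite ?mem_cat ?mem_map_cons ?IH //.
- by apply/mapP => -[].
- by rewrite add1n /= andbF.
- by apply/negbTE; rewrite negb_or; apply/andP; split; apply/mapP => -[].
- by rewrite !eqSS orbF.
Qed.

Lemma uniq_subsets (n k : nat) : uniq (subsets n k).
Proof.
have inj y : injective (cons y : bitseq -> bitseq) by move=> ? ? [].
elim: n k => [|n IH] [|k] //=; first by rewrite (map_inj_uniq (@inj _)).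
rewrite cat_uniq !(map_inj_uniq (@inj _)) !IH /= andbT; apply/hasPn => b.
by case/mapP=> c _ ->; rewrite mem_map_cons.
Qed.

Section Sets.
Variable n : nat.

Definition setb (b : bitseq) : {set 'I_n} := [set i : 'I_n | nth false b i].
Definition bits (A : {set 'I_n}) : bitseq := [seq i \in A | i <- enum 'I_n].

Lemma size_bits (A : {set 'I_n}) : size (bits A) = n.
Proof. by rewrite size_map size_enum_ord. Qed.

Lemma nth_bits (A : {set 'I_n}) (i : 'I_n) : nth false (bits A) i = (i \in A).
Proof. by rewrite (nth_map i) ?size_enum_ord // nth_ord_enum. Qed.

Lemma bitsK : cancel bits setb.
Proof. by move=> A; apply/setP=> i; rewrite inE nth_bits. Qed.

Lemma setbK (b : bitseq) : size b = n -> bits (setb b) = b.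
Proof.
move=> sb; apply: (@eq_from_nth _ false); rewrite size_bits // => i lin.
by rewrite (nth_bits _ (Ordinal lin)) inE.
Qed.

Lemma count_bits (A : {set 'I_n}) : count id (bits A) = #|A|.
Proof.
rewrite count_map cardE -(size_filter _ (enum 'I_n)).
by congr size; rewrite enumT; apply: eq_filter.
Qed.

Lemma card_setb (b : bitseq) : size b = n -> #|setb b| = count id b.
Proof. by move=> sb; rewrite -count_bits setbK. Qed.

Lemma bits_subsets (k : nat) (A : {set 'I_n}) :
  (bits A \in subsets n k) = (#|A| == k).
Proof. by rewrite mem_subsets size_bits eqxx count_bits. Qed.

Lemma card_setb_subsets (k : nat) (b : bitseq) :
  b \in subsets n k -> #|setb b| = k.
Proof. by rewrite mem_subsets => /andP[/eqP sb /eqP <-]; rewrite card_setb. Qed.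

Definition images (g : 'S_n) : seq nat := [seq val (g i) | i <- enum 'I_n].

Lemma size_images (g : 'S_n) : size (images g) = n.
Proof. by rewrite size_map size_enum_ord. Qed.

Lemma nth_images (x : nat) (g : 'S_n) (i : 'I_n) : nth x (images g) i = g i.
Proof. by rewrite (nth_map i) ?size_enum_ord // nth_ord_enum. Qed.

Lemma images_inj : injective images.
Proof.
move=> g h e; apply/permP=> i; apply: val_inj.
by rewrite /= -(nth_images 0 g) -(nth_images 0 h) e.
Qed.

(** The bridge between the unknown group and computation: elements of [G] enter the checks only
    through their image lists. *)
Definition listed (G : {set 'S_n}) (q : seq nat) : bool :=
  [exists g in G, images g == q].

Lemma listedP (G : {set 'S_n}) (q : seq nat) :
  reflect (exists2 g, g \in G & images g = q) (listed G q).
Proof.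
apply: (iffP exists_inP) => -[g gG /eqP e]; exists g => //; exact/eqP.
Qed.

Lemma listed_images (G : {set 'S_n}) (g : 'S_n) : listed G (images g) = (g \in G).
Proof. by apply/listedP/idP => [[h hG /images_inj <-]|gG] //; exists g. Qed.

Definition pull (q : seq nat) (b : bitseq) : bitseq := [seq nth false b j | j <- q].

Lemma pull_images (g : 'S_n) (b : bitseq) :
  setb (pull (images g) b) = g @^-1: setb b.
Proof.
apply/setP=> i; rewrite !inE (nth_map 0) ?size_images //.
by rewrite (nth_images 0 g i).
Qed.

Lemma size_pull (g : 'S_n) (b : bitseq) : size (pull (images g) b) = n.
Proof. by rewrite size_map size_images. Qed.

(* Apply [p] first, as in the product of permutations. *)
Definition lmul (p q : seq nat) : seq nat := [seq nth 0 q i | i <- p].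

Lemma lmul_images (g h : 'S_n) : lmul (images g) (images h) = images (g * h)%g.
Proof.
rewrite /lmul /images -map_comp; apply: eq_map => i /=.
by rewrite (nth_images 0 h) permM.
Qed.

Lemma images1 : images 1%g = iota 0 n.
Proof.
rewrite -val_enum_ord /images; apply: eq_map => i; by rewrite perm1.
Qed.

Definition pow (q : seq nat) (m : nat) : seq nat :=
  iter m (lmul^~ q) (iota 0 (size q)).

Lemma pow_images (g : 'S_n) (m : nat) : pow (images g) m = images (g ^+ m)%g.
Proof.
elim: m => [|m IH]; first by rewrite /pow size_images expg0 images1.
by rewrite expgSr -lmul_images -IH.
Qed.

Section Listed.
Variable G : {group 'S_n}.

Lemma listed1 : listed G (iota 0 n).
Proof. by rewrite -images1 listed_images group1. Qed.

Lemma listed_lmul (p q : seq nat) : listed G p -> listed G q -> listed G (lmul p q).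
Proof.
case/listedP=> g gG <- /listedP[h hG <-].
by rewrite lmul_images listed_images groupM.
Qed.

Lemma listed_pow (q : seq nat) (m : nat) : listed G q -> listed G (pow q m).
Proof. by case/listedP=> g gG <-; rewrite pow_images listed_images groupX. Qed.

End Listed.

(** Preimages are used because [pull] reads them off an image list without inverting it; for a
    group, invariance under images amounts to the same. *)
Definition stable_family (G : {set 'S_n}) (X : {set {set 'I_n}}) : Prop :=
  forall (g : 'S_n) (A : {set 'I_n}), g \in G -> (g @^-1: A \in X) = (A \in X).

Lemma stable_familyC (G : {set 'S_n}) (X : {set {set 'I_n}}) :
  stable_family G X -> stable_family G (~: X).
Proof. by move=> invX g A gG; rewrite !in_setC invX. Qed.

Lemma card_preperm (g : 'S_n) (A : {set 'I_n}) : #|g @^-1: A| = #|A|.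
Proof. by rewrite card_preimset //; apply: perm_inj. Qed.

Lemma stable_family_orbit (G : {group 'S_n}) (A : {set 'I_n}) :
  stable_family G [set g @: A | g : 'S_n in G].
Proof.
move=> g B gG; apply/imsetP/imsetP => -[h hG e].
  exists (h * g)%g; first by rewrite groupM.
  have -> : B = g @: (g @^-1: B).
    by apply/setP=> i; rewrite -[i](permKV g) (mem_imset _ _ perm_inj) inE permKV.
  by rewrite e -imset_comp; apply: eq_imset => i /=; rewrite permM.
exists (h * g^-1)%g; first by rewrite groupM ?groupV.
apply/setP=> i; rewrite inE e.
have -> : (h * g^-1)%g @: A = (g^-1)%g @: (h @: A).
  by rewrite -imset_comp; apply: eq_imset => j /=; rewrite permM.
by rewrite -{2}[i](permK g) (mem_imset _ _ perm_inj).
Qed.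

End Sets.

(** * Search for invariant families of sets *)

(** Tables indexed by bit lists: a value such as the orbit number of a set is computed once and then
    found by a walk of length n. *)
Inductive trie (A : Type) := Empty | Tip of A | Node of trie A & trie A.
Arguments Empty {A}.

Fixpoint get (A : Type) (x0 : A) (t : trie A) (b : bitseq) : A :=
  match t, b with
  | Tip x, [::] => x
  | Node l r, y :: b' => get x0 (if y then l else r) b'
  | _, _ => x0
  end.

Fixpoint tabulate (A : Type) (n k : nat) (f : bitseq -> A) : trie A :=
  match n, k with
  | 0, 0 => Tip (f [::])
  | 0, _.+1 => Empty
  | n'.+1, 0 => Node Empty (tabulate n' 0 (fun b => f (false :: b)))
  | n'.+1, k'.+1 => Node (tabulate n' k' (fun b => f (true :: b)))
                         (tabulate n' k (fun b => f (false :: b)))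
  end.

Lemma get_tabulate (A : Type) (x0 : A) n k f b :
  b \in subsets n k -> get x0 (tabulate n k f) b = f b.
Proof.
elim: n k f b => [|n IH] [|k] f [|[] b]; rewrite !mem_subsets //= ?add1n ?add0n;
  rewrite ?andbF // => /andP[/eqP[sb] cb]; by rewrite IH // mem_subsets sb eqxx.
Qed.

Fixpoint lexlt (b c : bitseq) : bool :=
  match b, c with
  | x :: b', y :: c' => if x (+) y then x else lexlt b' c'
  | _, _ => false
  end.

(** With [true] before [false], this is the least set of the orbit of [b] when [T] lists a group.
    Soundness uses only that it is [b] or its preimage under an element of [T]. *)
Definition canon (T : seq (seq nat)) (b : bitseq) : bitseq :=
  foldr (fun q c => let d := pull q b in if lexlt d c then d else c) b T.

(** [undup] keeps last occurrences, so the orbits are ordered by their last set in [subsets n k].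
    Survivors and families given as lists of values have to be read in this order. *)
Definition reps (n k : nat) (T : seq (seq nat)) : seq bitseq :=
  undup [seq canon T b | b <- subsets n k].

Definition subb (b a : bitseq) : bool := all (fun p => p.1 ==> p.2) (zip b a).

(* [Rainbow c]: the sets on which the colouring c is injective;
   [Within a]: the subsets of a. *)
Inductive selector := Rainbow of seq nat | Within of bitseq.

Definition selects (s : selector) (b : bitseq) : bool :=
  match s with Rainbow c => uniq (mask b c) | Within a => subb b a end.

(** Not-all-equal: the family and its complement must both meet a clause, so both truth values occur
    among its orbits. *)
Definition nae (c v : bitseq) : bool :=
  has (fun p => p.1 && p.2) (zip c v) && has (fun p => p.1 && ~~ p.2) (zip c v).

(* A state (lo, hi, ds) for a t-set r: lo members of the family contain r so far,
   hi would contain it if all undecided orbits belonged to the family, and ds lists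
   how many sets containing r the undecided orbits contribute.  The final number
   does not depend on r, so the intervals [lo, hi] must have a common point. *)
Definition counter : Type := nat * nat * seq nat.

Definition rowstep (b : bool) (r : counter) : counter :=
  let: (lo, hi, ds) := r in
  if ds is d :: ds' then if b then (lo + d, hi, ds') else (lo, hi - d, ds') else r.

Definition feasible (rows : seq counter) : bool :=
  let M := foldr (fun r m => maxn r.1.1 m) 0 rows in
  all (fun r => M <= r.1.2) rows.

(* [levels] lists, for each variable, the clauses whose last variable it is. *)
Fixpoint backtrack (levels : seq (seq bitseq)) (rows : seq counter) (v : bitseq) : seq bitseq :=
  if levels is cl :: levels' then
    let go b :=
      if all (nae^~ (b :: v)) cl then
        let rows' := map (rowstep b) rows in
        if feasible rows' then backtrack levels' rows' (b :: v) else [::]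
      else [::] in
    go true ++ go false
  else [:: v].

Fixpoint okl (levels : seq (seq bitseq)) (w v : bitseq) : bool :=
  match levels, w with
  | cl :: levels', b :: w' => all (nae^~ (b :: v)) cl && okl levels' w' (b :: v)
  | [::], [::] => true
  | _, _ => false
  end.

Fixpoint dot (w : bitseq) (ds : seq nat) : nat :=
  match w, ds with
  | b :: w', d :: ds' => (if b then d else 0) + dot w' ds'
  | _, _ => 0
  end.

(** [lam] is the final number for the t-set: the open orbits accepted in [w] raise [lo] to it, and
    those rejected in [w] lower [hi] to it. *)
Definition okrow (lam : nat) (w : bitseq) (r : counter) : bool :=
  [&& size r.2 == size w, r.1.1 + dot w r.2 == lam &
      lam + dot (map negb w) r.2 == r.1.2].

Lemma okrow_step lam b w r : okrow lam (b :: w) r -> okrow lam w (rowstep b r).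
Proof.
case: r => [[lo hi] [|d ds]]; rewrite /okrow //= eqSS => /and3P[es /eqP e1 /eqP e2].
by case: b e1 e2 => /= e1 e2; rewrite es; apply/andP; split; apply/eqP; lia.
Qed.

Lemma feasibleP lam w rows : all (okrow lam w) rows -> feasible rows.
Proof.
move=> H; rewrite /feasible.
have le_lam : foldr (fun (r : counter) m => maxn r.1.1 m) 0 rows <= lam.
  elim: rows H => //= r rows IH /andP[/and3P[_ /eqP e _] /IH le1].
  by rewrite geq_max le1 -e leq_addr.
by apply: sub_all H => r /and3P[_ _ /eqP <-]; apply: leq_trans le_lam (leq_addr _ _).
Qed.

(** No solution is pruned: clauses are tested when their last variable is set, and [lam] stays in
    all the intervals. [catrev] appears because [v] holds the decided values in reverse. *)
Lemma backtrackP lam levels rows v w :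
  okl levels w v -> all (okrow lam w) rows -> catrev w v \in backtrack levels rows v.
Proof.
elim: levels rows v w => [|cl levels IH] rows v [|b w] //=; first by rewrite inE.
case/andP=> okc okl' okr.
have okr' : all (okrow lam w) (map (rowstep b) rows).
  by rewrite all_map; apply: sub_all okr => r; apply: okrow_step.
have feas := feasibleP okr'; have := IH _ _ _ okl' okr'.
by rewrite mem_cat; case: b okc feas {okl' okr okr'} => -> -> ->; rewrite ?orbT.
Qed.

Definition swap (b : bitseq) (j i : nat) : bitseq :=
  set_nth false (set_nth false b j false) i true.

Definition link_count (n : nat) (f : bitseq -> bool) (m : nat) (b : bitseq) : nat :=
  count (fun i => ~~ nth false b i &&
           (count (fun j => nth false b j && f (swap b j i)) (iota 0 n) == m))
        (iota 0 n).

Section Search.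
Variables (n k : nat) (T : seq (seq nat)) (t : nat) (ms : seq nat) (depth : nat).
Variables (sels : seq selector) (survivors : seq bitseq).

Definition clause_bits (m : nat) (tb : trie nat) (s : selector) : bitseq :=
  let idx := undup [seq get 0 tb b | b <- subsets n k & selects s b] in
  [seq i \in idx | i <- iota 0 m].

Definition design_row (m : nat) (tb : trie nat) (r : bitseq) : counter :=
  let l := [seq get 0 tb b | b <- subsets n k & subb r b] in
  (0, size l, [seq count_mem i l | i <- iota 0 m]).

Definition level (cs : seq bitseq) (i : nat) : seq bitseq :=
  [seq rev (take i.+1 c) | c <- cs & nth false c i && ~~ has id (drop i.+1 c)].

Definition misses (cs : seq bitseq) (y : bitseq) : bool :=
  has (fun c => ~~ has (fun p => p.1 && p.2) (zip c y)) cs.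

(* If the family with values w is invariant, so are the families of the sets A
   with given membership and given number of points x outside A such that
   A - a + x is a member for exactly m elements a of A; none of them may miss a
   clause. *)
Fixpoint refine (rs : seq bitseq) (tb : trie nat) (cs : seq bitseq) (d : nat)
    (w : bitseq) : bool :=
  let f b := nth false w (get 0 tb b) in
  has (fun m =>
    let vals := [seq (f r, link_count n f m r) | r <- rs] in
    has (fun p =>
      let y := map (pred1 p) vals in
      misses cs y || (if d is d'.+1 then refine rs tb cs d' y else false))
    (undup vals)) ms.

(* The first variable is set to true: a family may be replaced by its complement. *)
Definition search : bool :=
  let rs := reps n k T in
  let m := size rs in
  let tb := tabulate n k (fun b => index (canon T b) rs) in
  let cs := map (clause_bits m tb) sels in
  let rows := map (design_row m tb) (reps n t T) in
  all (fun v => let w := rev v in (w \in survivors) || refine rs tb cs depth w)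
    (backtrack (behead [seq level cs i | i <- iota 0 m]) (map (rowstep true) rows)
       [:: true]).

End Search.

Definition set_homogeneous (n t : nat) (G : {set 'S_n}) : Prop :=
  forall A B : {set 'I_n}, #|A| = t -> #|B| = t ->
  exists2 g : 'S_n, g \in G & g @: A = B.

(** Quantified over all stable families, so that one hypothesis serves the family under study, its
    complement and the families derived from it. *)
Definition hits (n k : nat) (G : {set 'S_n}) (s : selector) : Prop :=
  forall X : {set {set 'I_n}}, stable_family G X -> (exists2 A, A \in X & #|A| = k) ->
  exists2 b, b \in subsets n k & selects s b && (setb n b \in X).

Lemma subbP (n : nat) (b a : bitseq) :
  size b = n -> size a = n -> subb b a = (setb n b \subset setb n a).
Proof.
move=> sb sa; have szip : size (zip b a) = n by rewrite size_zip sa sb minnn.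
apply/allP/subsetP => H.
  move=> i; rewrite !inE => bi; have := H (true, nth false a i); apply=> //.
  by rewrite -bi -(nth_zip false false) ?sa //; apply: mem_nth; rewrite szip.
case=> x y /(nthP (false, false))[i]; rewrite szip nth_zip ?sb ?sa // => lin [<- <-].
by apply/implyP => bi; have := H (Ordinal lin); rewrite !inE; apply.
Qed.

Lemma has_zip (p : bool -> bool -> bool) (c w : bitseq) :
  size c = size w ->
  has (fun q => p q.1 q.2) (zip c w) =
  has (fun i => p (nth false c i) (nth false w i)) (iota 0 (size w)).
Proof.
elim: c w => [|x c IH] [|y w] //= [scw]; rewrite IH // (iotaDl 1 0) has_map.
by congr orb; apply: eq_has.
Qed.

Lemma dot_count (a : nat) (w : bitseq) (l : seq nat) :
  dot w [seq count_mem i l | i <- iota a (size w)] =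
  count (fun i => (a <= i) && nth false w (i - a)) l.
Proof.
elim: w a => [|b w IH] a /=.
  by rewrite (eq_count (a2 := pred0)) ?count_pred0 // => i; rewrite nth_nil andbF.
rewrite {}IH; elim: l => [|i l IHl] /=; first by case: b.
rewrite -{}IHl; move: (count (fun _ => _) l) (count_mem _ l) => C D.
case: (ltngtP a i) => [lt|gt|->]; last by rewrite subnn /=; case: b; lia.
  by rewrite -(subnSK lt) /=; case: b; case: nth; lia.
by case: b.
Qed.

Lemma nae_rev_take (c w : bitseq) (i : nat) :
  size c = size w -> ~~ has id (drop i c) -> nae c w ->
  nae (rev (take i c)) (rev (take i w)).
Proof.
move=> scw nod; rewrite /nae -rev_zip ?size_take ?scw // !has_rev.
have stw : size (take i c) = size (take i w) by rewrite !size_take scw.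
have no p : has (fun q : bool * bool => q.1 && p q.2) (zip (drop i c) (drop i w)) = false.
  apply/hasP => -[[x y] /= xy /andP[xT _]]; case/hasP: nod; exists x => //.
  have -> : drop i c = unzip1 (zip (drop i c) (drop i w)).
    by rewrite unzip1_zip // !size_drop scw.
  by apply/mapP; exists (x, y).
have E p : has (fun q : bool * bool => q.1 && p q.2) (zip c w) =
    has (fun q : bool * bool => q.1 && p q.2) (zip (take i c) (take i w)).
  rewrite -{1}(cat_take_drop i c) -{1}(cat_take_drop i w) zip_cat // has_cat.
  by rewrite (no p) orbF.
by rewrite (E id) (E negb).
Qed.

Lemma okl_levels (cs : seq bitseq) (w v : bitseq) :
  all (fun c => (size c == size v + size w) && nae c (catrev v w)) cs ->
  okl [seq level cs i | i <- iota (size v) (size w)] w v.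
Proof.
elim: w v => [|b w IH] v //= H; apply/andP; split; last first.
  by apply: (IH (b :: v)); apply: sub_all H => c; rewrite addnS.
rewrite all_map; apply/allP => c; rewrite mem_filter => /andP[/andP[_ nod]].
move/(allP H) => /andP[/eqP sc nc] /=.
have -> : b :: v = rev (take (size v).+1 (catrev v (b :: w))).
  rewrite catrevE -cat_rcons take_cat size_rcons size_rev ltnn subnn take0 cats0.
  by rewrite rev_rcons revK.
by apply: nae_rev_take => //; rewrite sc catrevE size_cat size_rev.
Qed.

Section Soundness.
Variables (n k : nat) (T : seq (seq nat)) (t : nat) (ms : seq nat) (depth : nat).
Variables (sels : seq selector) (survivors : seq bitseq) (G : {group 'S_n}).
Implicit Types (X Y : {set {set 'I_n}}) (A B : {set 'I_n}).
Hypothesis T_G : all (listed G) T.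

Lemma pull_subsets j q b : listed G q -> b \in subsets n j -> pull q b \in subsets n j.
Proof.
case/listedP=> g _ <- bs; rewrite mem_subsets size_pull eqxx /=.
by rewrite -(card_setb (n := n)) ?size_pull // pull_images card_preperm (card_setb_subsets bs).
Qed.

Lemma canon_subsets j b : b \in subsets n j -> canon T b \in subsets n j.
Proof.
move=> bs; rewrite /canon; elim: T T_G => //= q T' IH /andP[Gq /IH ih].
by case: ifP => // _; apply: pull_subsets.
Qed.

Lemma canon_invariant (X : {set {set 'I_n}}) b :
  stable_family G X -> (setb n (canon T b) \in X) = (setb n b \in X).
Proof.
move=> invX; rewrite /canon; elim: T T_G => //= q T' IH /andP[Gq /IH ih].
by case: ifP => // _; have /listedP[g gG <-] := Gq; rewrite pull_images invX.
Qed.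

Lemma canon_reps j b : b \in subsets n j -> canon T b \in reps n j T.
Proof. by move=> bs; rewrite mem_undup map_f. Qed.

Lemma reps_subsets j : {subset reps n j T <= subsets n j}.
Proof. by move=> b; rewrite mem_undup => /mapP[c cs ->]; apply: canon_subsets. Qed.

Definition values (X : {set {set 'I_n}}) : bitseq :=
  [seq setb n r \in X | r <- reps n k T].

Let rs := reps n k T.
Let m := size rs.
Let tb := tabulate n k (fun b => index (canon T b) rs).
Let cs := map (clause_bits n k m tb) sels.

Lemma tb_lt b : b \in subsets n k -> get 0 tb b < m.
Proof. by move=> bs; rewrite get_tabulate // index_mem canon_reps. Qed.

Lemma nth_values X b : stable_family G X -> b \in subsets n k ->
  nth false (values X) (get 0 tb b) = (setb n b \in X).
Proof.
move=> invX bs; have crs := canon_reps bs.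
rewrite get_tabulate // (nth_map b) ?index_mem // nth_index //.
exact: canon_invariant.
Qed.

Lemma size_values X : size (values X) = m. Proof. by rewrite size_map. Qed.

Definition nontrivial_family (X : {set {set 'I_n}}) : Prop :=
  (exists2 A, A \in X & #|A| = k) /\ (exists2 A, A \in ~: X & #|A| = k).

Hypothesis sels_G : forall s, List.In s sels -> hits k G s.

Lemma clause_hit X s : List.In s sels -> stable_family G X ->
  (exists2 A, A \in X & #|A| = k) ->
  has (fun p => p.1 && p.2) (zip (clause_bits n k m tb s) (values X)).
Proof.
move=> /sels_G hs invX exA; have [b bs /andP[sb bX]] := hs _ invX exA.
rewrite (has_zip andb) ?size_map ?size_iota ?size_values //.
apply/hasP; exists (get 0 tb b); first by rewrite mem_iota add0n tb_lt.
rewrite nth_values // bX andbT (nth_map 0) ?size_iota ?tb_lt // nth_iota ?tb_lt //.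
by rewrite mem_undup; apply/mapP; exists b => //; rewrite mem_filter sb.
Qed.

Lemma cs_all (p : pred bitseq) :
  (forall s, List.In s sels -> p (clause_bits n k m tb s)) -> all p cs.
Proof.
rewrite /cs; elim: sels => //= s l IH H; rewrite H ?IH //; last by left.
by move=> s' s'l; apply: H; right.
Qed.

Lemma clauses_nae X : stable_family G X -> nontrivial_family X ->
  all (fun c => (size c == m) && nae c (values X)) cs.
Proof.
move=> invX [exX exXC]; apply: cs_all => s ss.
rewrite size_map size_iota eqxx /nae clause_hit //=.
have := clause_hit ss (stable_familyC invX) exXC.
rewrite !(has_zip (fun x y => x && y)) ?(has_zip (fun x y => x && ~~ y)) ?size_map ?size_iota //.
rewrite -/m => /hasP[i]; rewrite mem_iota add0n => lim H.
apply/hasP; exists i; first by rewrite mem_iota add0n.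
by move: H; rewrite !(nth_map [::]) // in_setC.
Qed.

Definition links (X : {set {set 'I_n}}) (l : nat) (A : {set 'I_n}) : nat :=
  #|[set x | (x \notin A) && (#|[set a in A | x |: (A :\ a) \in X]| == l)]|.

Lemma links_preim X l (g : 'S_n) (A : {set 'I_n}) : stable_family G X -> g \in G ->
  links X l (g @^-1: A) = links X l A.
Proof.
move=> invX gG; rewrite /links.
pose B x := [set a in A | x |: (A :\ a) \in X].
rewrite -[RHS](card_preperm g); apply: eq_card => x; rewrite !inE.
rewrite -[in RHS](card_preperm g (B (g x))); congr (_ && (_ == l)).
apply: eq_card => a; rewrite !inE; congr (_ && _).
rewrite -(invX g (g x |: (A :\ g a)) gG); congr (_ \in X).
by apply/setP=> y; rewrite !inE !(inj_eq perm_inj).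
Qed.

Lemma link_countE X l b : stable_family G X -> b \in subsets n k ->
  link_count n (fun b => nth false (values X) (get 0 tb b)) l b = links X l (setb n b).
Proof.
move=> invX; rewrite mem_subsets => /andP[/eqP sb /eqP cb].
have countE (p : nat -> bool) (Y : {set 'I_n}) :
    (forall i : 'I_n, p i = (i \in Y)) -> count p (iota 0 n) = #|Y|.
  move=> pY; rewrite -count_bits -val_enum_ord /bits !count_map.
  by apply: eq_count => i /=; rewrite pY.
apply: (countE) => i; rewrite !inE; case bi: (nth false b i) => //=.
congr (_ == _); apply: countE => j; rewrite !inE; case bj: (nth false b j) => //=.
have swapE : setb n (swap b j i) = i |: (setb n b :\ j).
  apply/setP=> y; rewrite !inE /swap nth_set_nth /= -val_eqE /=.
  by case: eqP => //= _; rewrite nth_set_nth /= -val_eqE /=; case: eqP.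
have ij : i \notin setb n b :\ j by rewrite !inE bi andbF.
have jb : j \in setb n b by rewrite inE.
have ssw : size (swap b j i) = n.
  by rewrite /swap !size_set_nth sb (maxn_idPr (ltn_ord j)) (maxn_idPr (ltn_ord i)).
rewrite nth_values ?swapE // mem_subsets ssw eqxx -(card_setb ssw) swapE cardsU1 ij.
by rewrite -cb -(card_setb sb) (cardsD1 j (setb n b)) jb eqxx.
Qed.

(** [G] preserves both membership in [X] and the numbers [links], so each joint level set [Y] is
    stable. It contains a k-set because its value occurs at a representative; hence it must meet
    every clause. The test is one-sided, since the complement of [Y] may contain no k-set. *)
Lemma refine_contra d X : stable_family G X ->
  refine n ms rs tb cs d (values X) -> False.
Proof.
elim: d X => [|d IH] X invX /=; case/hasP => l _ /hasP[[bb v]]; rewrite mem_undup.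
all: move=> pin; set y := map _ _; pose Y := [set A | ((A \in X) == bb) && (links X l A == v)].
all: have invY : stable_family G Y by
  move=> g A gG; rewrite !inE (invX g A gG) links_preim.
all: have yY : y = values Y by
  rewrite /y /values -map_comp; apply/eq_in_map => r /reps_subsets rsub /=;
  rewrite !inE link_countE // nth_values // xpair_eqE [bb == _]eq_sym [v == _]eq_sym.
all: have exY : exists2 A, A \in Y & #|A| = k by
  case/mapP: pin => r /reps_subsets rsub [e1 e2]; exists (setb n r);
  [by rewrite inE e1 e2 link_countE // nth_values // !eqxx
  |exact: card_setb_subsets rsub].
all: have no : misses cs y = false by
  apply/negbTE; rewrite -all_predC; apply: cs_all => s ss /=; rewrite negbK yY;
  exact: clause_hit.
  by rewrite no.
by rewrite no /= yY => /IH; apply.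
Qed.

Hypothesis homG : set_homogeneous t G.

Lemma count_superset X r : r \in subsets n t ->
  count (fun b => subb r b && (setb n b \in X)) (subsets n k) =
  #|[set A in X | (#|A| == k) && (setb n r \subset A)]|.
Proof.
move=> rt; have sr : size r = n by move: rt; rewrite mem_subsets => /andP[/eqP].
rewrite -size_filter -(size_map (setb n)); set l := map _ _.
have ul : uniq l.
  rewrite map_inj_in_uniq ?filter_uniq ?uniq_subsets // => a b.
  rewrite !mem_filter !mem_subsets => /andP[_ /andP[/eqP sa _]] /andP[_ /andP[/eqP sb _]] e.
  by rewrite -(setbK sa) e setbK.
rewrite -(card_uniqP ul); apply: eq_card => A; rewrite !inE.
apply/mapP/and3P => [[b]|[AX cA rA]].
  rewrite mem_filter => /andP[/andP[sub bX] bs] ->.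
  have sb : size b = n by move: bs; rewrite mem_subsets => /andP[/eqP].
  by rewrite bX (card_setb_subsets bs) -(subbP sr sb).
exists (bits A); last by rewrite bitsK.
by rewrite mem_filter bits_subsets cA (subbP sr (size_bits A)) bitsK rA AX.
Qed.

(** An element of [G] carrying one t-set to the other permutes [X] and so matches the members above
    them: [X] is a t-design. *)
Lemma superset_const X r r' : stable_family G X -> r \in subsets n t -> r' \in subsets n t ->
  count (fun b => subb r b && (setb n b \in X)) (subsets n k) =
  count (fun b => subb r' b && (setb n b \in X)) (subsets n k).
Proof.
move=> invX rt rt'; rewrite !count_superset //.
have [g gG <-] := homG (card_setb_subsets rt) (card_setb_subsets rt').
rewrite -(card_imset _ (@imset_inj _ _ g perm_inj)); apply: eq_card => A.
apply/imsetP/idP => [[B]|]; rewrite !inE.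
  case/and3P=> BX cB rB ->; rewrite imsetS // card_imset ?cB; last exact: perm_inj.
  rewrite -(invX g) // -[X in X \in _](_ : B = _) ?BX //.
  by apply/setP=> i; rewrite inE (mem_imset _ _ perm_inj).
case/and3P=> AX cA rA; exists (g @^-1: A); last first.
  by apply/setP=> i; rewrite -[i](permKV g) (mem_imset _ _ perm_inj) inE permKV.
rewrite inE invX // AX card_preperm cA; apply/subsetP => i ir.
by rewrite inE (subsetP rA) // imset_f.
Qed.

Lemma design_ok X : stable_family G X -> exists lam,
  all (okrow lam (values X)) (map (design_row n k m tb) (reps n t T)).
Proof.
move=> invX; case: (posnP (size (reps n t T))) => [/size0nil ->|]; first by exists 0.
move=> lt0; set r0 := nth [::] (reps n t T) 0.
have r0s : r0 \in subsets n t by apply/reps_subsets/mem_nth.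
exists (count (fun b => subb r0 b && (setb n b \in X)) (subsets n k)).
rewrite all_map; apply/allP => r /reps_subsets rt.
rewrite /okrow /=; set l := [seq get 0 tb b | b <- _ & _].
rewrite size_map size_iota size_values eqxx /= add0n.
have lE w : size w = m -> dot w [seq count_mem i l | i <- iota 0 m] = count (nth false w) l.
  by move=> <-; rewrite dot_count; apply: eq_count => i; rewrite subn0.
rewrite (lE _ (size_values X)) (lE (map negb _)); last by rewrite !size_map.
have cX : count (nth false (values X)) l =
    count (fun b => subb r0 b && (setb n b \in X)) (subsets n k).
  rewrite (superset_const invX r0s rt) count_map count_filter.
  by apply: eq_in_count => b bs /=; rewrite nth_values // andbC.
rewrite cX eqxx -cX -(count_predC (nth false (values X)) l) eqn_add2l; apply/eqP.
apply: eq_in_count => i /mapP[b]; rewrite mem_filter => /andP[_ bs] ->.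
by rewrite (nth_map false) ?size_values ?tb_lt.
Qed.

Theorem searchP X : search n k T t ms depth sels survivors ->
  stable_family G X -> nontrivial_family X ->
  exists2 Y, Y = X \/ Y = ~: X & values Y \in survivors.
Proof.
move=> srch invX prX.
have [Y [YX [invY prY]] headY] : exists2 Y, (Y = X \/ Y = ~: X) /\ (stable_family G Y /\
  nontrivial_family Y)
    & exists w, values Y = true :: w.
  have m0 : 0 < m.
    have [[A AX cA] _] := prX; have := canon_reps (b := bits A) (j := k).
    by rewrite bits_subsets cA eqxx /m /rs => /(_ isT); case: (reps _ _ _).
  have : size (values X) = m := size_values X.
  case vX: (values X) m0 => [|[] w] m0; [by move=> e; rewrite -e in m0| |] => _.
    by exists X; [split; [left|split]|exists w].
  exists (~: X); first split; [by right| |].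
    by split; [exact: stable_familyC | case: prX => ? ?; split; rewrite ?setCK].
  exists (map negb w); move: vX; rewrite /values; case: (reps _ _ _) => //= r l [e <-].
  rewrite in_setC e -map_comp; congr cons; apply: eq_map => r' /=; by rewrite in_setC.
exists Y => //; case: headY => w vY.
have [lam okr] := design_ok invY.
have okl' := clauses_nae invY prY.
have sw : m = (size w).+1 by rewrite -(size_values Y) vY.
move: srch; rewrite /search -/rs -/m -/tb -/cs => /allP/(_ (catrev w [:: true])).
have -> : rev (catrev w [:: true]) = values Y.
  by rewrite vY catrevE rev_cat revK.
case/(_ _)/orP => //; last by move/(refine_contra invY).
apply: (@backtrackP lam); last first.
  by rewrite all_map; apply: sub_all okr => r; rewrite vY; apply: okrow_step.
rewrite sw /=; have := @okl_levels cs w [:: true]; apply.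
by apply: sub_all okl' => c; rewrite vY sw.
Qed.

End Soundness.

(* The powers of the product of the m cycles (0 .. p-1), (p .. 2p-1), ... *)
Definition cycle_list (n p m : nat) : seq nat :=
  [seq if i < p * m then i %/ p * p + (i %% p).+1 %% p else i | i <- iota 0 n].
Definition powers (q : seq nat) (p : nat) : seq (seq nat) :=
  [seq pow q i | i <- iota 0 p].
Definition cycles (n p m : nat) : seq (seq nat) := powers (cycle_list n p m) p.
(** With the first nine points written a + 3 b, [cycles n 3 3] shifts a and this list shifts b;
    together they span the regular elementary abelian group [E9]. *)
Definition columns (n : nat) : seq nat :=
  [seq if i < 9 then (i + 3) %% 9 else i | i <- iota 0 n].
Definition C9 (n : nat) : seq (seq nat) := cycles n 9 1.
Definition E9 (n : nat) : seq (seq nat) :=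
  [seq lmul a b | a <- cycles n 3 3, b <- powers (columns n) 3].

(* The selectors are subsystems of all the available constraints, found by
   computer, that suffice for excluding the other families. *)
Lemma search_4_2 : search 4 2 [::] 1 [::] 0
  [:: Rainbow [:: 0; 0; 1; 1]; Rainbow [:: 0; 1; 0; 1]; Rainbow [:: 0; 1; 1; 0]]
  [::].
Proof. by vm_compute. Qed.

Lemma search_5_2 : search 5 2 (cycles 5 5 1) 1 [::] 0
  [:: Rainbow [:: 0; 0; 0; 0; 1]]
  [:: [:: true; false]].
Proof. by vm_compute. Qed.

Lemma search_6_2a : search 6 2 (cycles 6 3 1) 1 [::] 0
  [:: Rainbow [:: 0; 0; 0; 1; 1; 1]]
  [::].
Proof. by vm_compute. Qed.

Lemma search_6_2b : search 6 2 (cycles 6 3 2) 1 [:: 2] 0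
  [:: Rainbow [:: 0; 0; 0; 1; 1; 1]; Rainbow [:: 0; 0; 1; 0; 0; 1]; Rainbow [:: 0; 0; 1; 0; 1; 0];
    Rainbow [:: 0; 0; 1; 1; 0; 0]]
  [::].
Proof. by vm_compute. Qed.

Lemma search_7_2 : search 7 2 (cycles 7 7 1) 1 [::] 0
  [:: Rainbow [:: 0; 0; 0; 0; 0; 0; 1]]
  [:: [:: true; true; false]; [:: true; false; true]; [:: true; false; false]].
Proof. by vm_compute. Qed.

Lemma search_8_2 : search 8 2 (cycles 8 2 4) 1 [:: 2] 0
  [:: Rainbow [:: 0; 0; 0; 0; 1; 1; 1; 1]; Rainbow [:: 0; 0; 1; 1; 0; 0; 1; 1]; Rainbow
    [:: 0; 0; 1; 1; 1; 1; 0; 0]; Rainbow [:: 0; 1; 0; 1; 0; 1; 0; 1]; Rainbow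
    [:: 0; 1; 0; 1; 0; 1; 1; 0]; Rainbow [:: 0; 1; 0; 1; 1; 0; 0; 1]; Rainbow
    [:: 0; 1; 0; 1; 1; 0; 1; 0]; Rainbow [:: 0; 1; 1; 0; 0; 1; 0; 1]; Rainbow
    [:: 0; 1; 1; 0; 0; 1; 1; 0]; Rainbow [:: 0; 1; 1; 0; 1; 0; 0; 1]; Rainbow
    [:: 0; 1; 1; 0; 1; 0; 1; 0]]
  [::].
Proof. by vm_compute. Qed.

Lemma search_9_2C : search 9 2 (C9 9) 1 [:: 2] 1
  [:: Rainbow [:: 0; 0; 1; 0; 0; 1; 0; 0; 1]]
  [::].
Proof. by vm_compute. Qed.

Lemma search_9_2E : search 9 2 (E9 9) 1 [::] 0
  [:: Rainbow [:: 0; 0; 0; 0; 0; 0; 1; 1; 1]; Rainbow [:: 0; 0; 1; 0; 0; 1; 0; 0; 1]; Rainbow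
    [:: 0; 0; 1; 0; 1; 0; 1; 0; 0]; Rainbow [:: 0; 0; 1; 1; 0; 0; 0; 1; 0]]
  [:: [:: true; true; false; false]; [:: true; false; true; false]; [:: true; false; false; true]].
Proof. by vm_compute. Qed.

Lemma search_10_2a : search 10 2 (cycles 10 5 1) 1 [::] 0
  [:: Rainbow [:: 0; 0; 0; 0; 0; 1; 1; 1; 1; 1]]
  [::].
Proof. by vm_compute. Qed.

Lemma search_10_2b : search 10 2 (cycles 10 5 2) 1 [:: 2] 0
  [:: Rainbow [:: 0; 0; 0; 0; 0; 1; 1; 1; 1; 1]; Rainbow [:: 0; 0; 0; 0; 1; 0; 0; 0; 0; 1]; Rainbow
    [:: 0; 0; 0; 0; 1; 0; 0; 0; 1; 0]; Rainbow [:: 0; 0; 0; 0; 1; 0; 0; 1; 0; 0]; Rainbow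
    [:: 0; 0; 0; 0; 1; 0; 1; 0; 0; 0]; Rainbow [:: 0; 0; 0; 0; 1; 1; 0; 0; 0; 0]]
  [:: [:: true; false; true; true; true; true; false; false; true];
    [:: true; false; true; true; true; false; true; false; true];
    [:: true; false; true; true; false; true; true; false; true];
    [:: true; false; true; false; true; true; true; false; true];
    [:: true; false; true; false; false; false; false; false; true];
    [:: true; false; false; true; true; true; true; false; true];
    [:: true; false; false; true; false; false; false; false; true];
    [:: true; false; false; false; true; false; false; false; true];
    [:: true; false; false; false; false; true; false; false; true];
    [:: true; false; false; false; false; false; true; false; true]].
Proof. by vm_compute. Qed.

Lemma search_6_3 : search 6 3 (cycles 6 5 1) 2 [::] 0
  [:: Rainbow [:: 0; 0; 0; 0; 1; 2]]
  [:: [:: true; false; false; true]].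
Proof. by vm_compute. Qed.

Lemma search_7_3 : search 7 3 (cycles 7 7 1) 2 [::] 0
  [:: Rainbow [:: 0; 0; 0; 1; 0; 1; 2]; Rainbow [:: 0; 0; 0; 1; 1; 0; 2]]
  [:: [:: true; true; false; false; true]].
Proof. by vm_compute. Qed.

Lemma search_8_3 : search 8 3 (cycles 8 7 1) 2 [::] 0
  [:: Rainbow [:: 0; 0; 0; 0; 0; 0; 1; 2]]
  [::].
Proof. by vm_compute. Qed.

Lemma search_9_3C : search 9 3 (C9 9) 2 [:: 3] 0
  [:: Rainbow [:: 0; 1; 2; 0; 1; 2; 0; 1; 2]]
  [::].
Proof. by vm_compute. Qed.

Lemma search_9_3E : search 9 3 (E9 9) 2 [:: 2] 0
  [:: Rainbow [:: 0; 0; 0; 0; 0; 0; 1; 1; 2]; Rainbow [:: 0; 0; 1; 0; 0; 1; 0; 0; 2]; Rainbow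
    [:: 0; 0; 1; 0; 1; 0; 2; 0; 0]; Rainbow [:: 0; 0; 1; 1; 0; 0; 0; 2; 0]]
  [::].
Proof. by vm_compute. Qed.

Lemma search_10_3C : search 10 3 (C9 10) 2 [:: 2] 0
  [:: Rainbow [:: 0; 0; 1; 0; 0; 1; 0; 0; 1; 2]]
  [::].
Proof. by vm_compute. Qed.

Lemma search_10_3E : search 10 3 (E9 10) 2 [:: 3] 0
  [:: Rainbow [:: 0; 0; 1; 1; 0; 0; 0; 1; 0; 2]]
  [::
    [:: true; true; false; false; false; false; true; true; false; true; true; true; true; false; false; false];
    [:: true; false; true; true; false; false; true; false; false; false; true; true; false; false; true; true];
    [:: true; false; false; false; true; true; true; false; true; false; true; true; false; true; false; false]].
Proof. by vm_compute. Qed.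

Lemma search_8_4 : search 8 4 (cycles 8 7 1) 2 [:: 3] 0
  [:: Rainbow [:: 0; 0; 0; 1; 0; 1; 2; 3]; Rainbow [:: 0; 0; 0; 1; 1; 0; 2; 3]; Rainbow
    [:: 0; 0; 1; 0; 2; 0; 3; 0]]
  [:: [:: true; false; true; false; true; true; true; false; false; true]].
Proof. by vm_compute. Qed.

(** For k = 4 the triples are treated before the 4-sets: each 4-set has to contain a member of every
    invariant family of triples, which is what these selectors express. *)
Lemma search_9_4_3C : search 9 3 (C9 9) 2 [:: 3] 0
  [:: Within [:: true; true; false; false; true; true; false; false; false]; Within
    [:: true; false; true; false; true; false; true; false; false]]
  [::].
Proof. by vm_compute. Qed.

Lemma search_9_4_3E : search 9 3 (E9 9) 2 [:: 3] 0
  [:: Within [:: true; true; false; false; true; true; false; false; false]; Within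
    [:: true; true; false; false; true; false; true; false; false]; Within
    [:: true; true; false; false; false; true; true; false; false]; Within
    [:: true; true; false; false; false; true; false; false; true]]
  [::].
Proof. by vm_compute. Qed.

(** The selector admits every set, so its clause only says that both sides are nonempty.
    Divisibility does the rest: in a 3-(9,4,lambda) design a pair lies in 7 lambda / 2 members and a
    point in 28 lambda / 3, so 6 divides lambda, and lambda is at most 6. *)
Lemma search_9_4C : search 9 4 (C9 9) 3 [::] 0
  [:: Within [:: true; true; true; true; true; true; true; true; true]]
  [::].
Proof. by vm_compute. Qed.

Lemma search_9_4E : search 9 4 (E9 9) 3 [::] 0
  [:: Within [:: true; true; true; true; true; true; true; true; true]]
  [::].
Proof. by vm_compute. Qed.

Lemma search_10_4_3C : search 10 3 (C9 10) 2 [::] 0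
  [:: Within [:: true; false; false; true; false; false; true; false; false; true]; Within
    [:: true; true; false; false; true; true; false; false; false; false]; Within
    [:: true; false; true; false; true; false; true; false; false; false]; Within
    [:: true; false; true; false; true; false; false; false; false; true]; Within
    [:: true; true; false; true; false; false; false; true; false; false]; Within
    [:: true; true; false; false; true; false; true; false; false; false]; Within
    [:: true; true; false; false; true; false; false; true; false; false]; Within
    [:: true; true; false; false; false; true; false; true; false; false]]
  [::].
Proof. by vm_compute. Qed.

Lemma search_10_4_3E : search 10 3 (E9 10) 2 [::] 0
  [:: Within [:: true; true; true; false; false; false; false; false; false; true]; Within
    [:: true; false; false; true; false; false; true; false; false; true]; Within
    [:: true; false; false; false; true; false; false; false; true; true]; Within
    [:: true; false; false; false; false; true; false; true; false; true]; Within
    [:: true; true; true; true; false; false; false; false; false; false]; Within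
    [:: true; true; true; false; false; false; true; false; false; false]; Within
    [:: true; true; false; true; false; false; true; false; false; false]; Within
    [:: true; true; false; true; false; false; false; false; true; false]; Within
    [:: true; true; false; false; true; false; false; true; false; false]; Within
    [:: true; true; false; false; true; false; false; false; true; false]; Within
    [:: true; true; false; false; false; true; true; false; false; false]; Within
    [:: true; true; false; false; false; true; false; true; false; false]; Within
    [:: true; true; false; false; false; true; false; false; true; false]]
  [::].
Proof. by vm_compute. Qed.

Lemma search_10_4C : search 10 4 (C9 10) 3 [::] 0
  [:: Rainbow [:: 0; 1; 2; 0; 1; 2; 0; 1; 2; 3]]
  [::].
Proof. by vm_compute. Qed.

Lemma search_10_4E : search 10 4 (E9 10) 3 [::] 0
  [:: Rainbow [:: 0; 0; 1; 2; 0; 0; 0; 3; 0; 0]; Rainbow [:: 0; 0; 1; 1; 0; 0; 0; 2; 0; 3]]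
  [::].
Proof. by vm_compute. Qed.

Lemma search_10_5_3C : search 10 3 (C9 10) 2 [:: 2] 0
  [:: Within [:: true; false; true; false; true; false; true; false; false; true]]
  [::].
Proof. by vm_compute. Qed.

(** The survivors are those of [search_10_3E]; they are excluded in [case_10_5] by passing to
    4-sets. *)
Lemma search_10_5_3E : search 10 3 (E9 10) 2 [:: 3] 0
  [:: Within [:: true; true; false; false; true; true; true; false; false; false]]
  [::
    [:: true; true; false; false; false; false; true; true; false; true; true; true; true; false; false; false];
    [:: true; false; true; true; false; false; true; false; false; false; true; true; false; false; true; true];
    [:: true; false; false; false; true; true; true; false; true; false; true; true; false; true; false; false]].
Proof. by vm_compute. Qed.

Lemma search_10_5_4C : search 10 4 (C9 10) 3 [::] 0
  [:: Within [:: true; false; true; false; true; false; true; false; false; true]]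
  [::].
Proof. by vm_compute. Qed.

Lemma search_10_5_4E : search 10 4 (E9 10) 3 [::] 0
  [:: Within [:: true; true; false; false; true; false; true; false; false; true]; Within
    [:: true; true; false; false; false; true; false; false; true; true]]
  [::].
Proof. by vm_compute. Qed.

(** Divisibility again: in a 4-(10,5,lambda) design a triple lies in 7 lambda / 2 members and a pair
    in 28 lambda / 3, so lambda is 0 or 6. *)
Lemma search_10_5C : search 10 5 (C9 10) 4 [::] 0
  [:: Within [:: true; true; true; true; true; true; true; true; true; true]]
  [::].
Proof. by vm_compute. Qed.

Lemma search_10_5E : search 10 5 (E9 10) 4 [::] 0
  [:: Within [:: true; true; true; true; true; true; true; true; true; true]]
  [::].
Proof. by vm_compute. Qed.

(** * The universal transversal property as a hitting condition *)

Definition rainbow_transversal (T : finType) (k : nat) (G : {set {perm T}}) : Prop :=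
  forall (U : finType) (c : T -> U) (A : {set T}), #|c @: [set: T]| = k -> #|A| = k ->
  exists2 g : {perm T}, g \in G & {in g @: A &, injective c}.

(** A colouring gives the partition into colour classes, and [pblock P] colours the points by their
    blocks. Among k-sets, sections are those with distinct colours. *)
Lemma universal_transversalP (T : finType) (k : nat) (G : {set {perm T}}) :
  universal_transversal k G <-> rainbow_transversal k G.
Proof.
split=> [ut U c A cc cA | rt I P cI partP cP].
  have partP := preim_partitionP c [set: T].
  have cP : #|preim_partition c [set: T]| = k.
    rewrite -cc -(card_in_imset (f := fun u => [set y in [set: T] | u == c y])).
      by rewrite -imset_comp.
    move=> _ v /imsetP[x _ ->] _ /= /setP/(_ x).
    by rewrite !inE eqxx => /esym/eqP.
  have [g gG trg] := ut A _ cA partP cP; exists g => // x y xA yA cxy.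
  apply: (pblock_inj trg) => //; apply/eqP.
  rewrite eq_pblock ?(partition_trivIset partP) ?(cover_partition partP) ?inE //.
  by rewrite pblock_equivalence_partition ?inE ?cxy //; split=> // /eqP->.
have trivP := partition_trivIset partP; have covP := cover_partition partP.
have inP x : pblock P x \in P by rewrite pblock_mem // covP.
have imP : pblock P @: [set: T] = P.
  apply/setP=> B; apply/imsetP/idP => [[x _ ->]//|BP].
  have [x xB] : exists x, x \in B by apply/set0Pn; apply: (partition_neq0 partP).
  by exists x => //; rewrite (def_pblock trivP BP).
have cimP : #|pblock P @: [set: T]| = k by rewrite imP.
have [g gG inj_g] := rt _ (pblock P) I cimP cI.
exists g => //; rewrite /is_transversal partP subsetT /=; apply/forall_inP => B BP.
have : B \in pblock P @: (g @: I).
  suff -> : pblock P @: (g @: I) = P by [].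
  apply/eqP; rewrite eqEcard card_in_imset // card_imset ?cP ?cI ?leqnn ?andbT.
    by apply/subsetP => _ /imsetP[x _ ->].
  exact: perm_inj.
case/imsetP => x xI eB; apply/cards1P; exists x; apply/setP => y; rewrite !inE.
have mem_own z : z \in pblock P z by rewrite mem_pblock covP.
apply/andP/eqP => [[yI yB]|->]; last by rewrite xI eB.
by apply: inj_g => //; rewrite -eB; apply: def_pblock.
Qed.

Lemma exists_superset (T : finType) (A : {set T}) (m : nat) :
  #|A| <= m <= #|T| -> exists2 B : {set T}, A \subset B & #|B| = m.
Proof.
case/andP=> leAm lemT; elim: m leAm lemT => [|m IH].
  by rewrite leqn0 => /eqP cA _; exists A.
rewrite leq_eqVlt => /orP[/eqP cA _|]; first by exists A.
rewrite ltnS => leAm ltmT; have [B sAB cB] := IH leAm (ltnW ltmT).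
have /subsetPn[x _ xB] : ~~ ([set: T] \subset B).
  by apply: contraTN ltmT => /subset_leq_card; rewrite cardsT cB -leqNgt.
exists (x |: B); last by rewrite cardsU1 xB cB.
exact: subset_trans sAB (subsetU1 _ _).
Qed.

Section Consequences.
Variables (n k : nat) (G : {group 'S_n}).
Hypothesis ut : universal_transversal k G.
Implicit Types (A B K S : {set 'I_n}) (X : {set {set 'I_n}}) (g : 'S_n).

Lemma preim_imset g A : g @^-1: (g @: A) = A.
Proof. by apply/setP=> i; rewrite inE (mem_imset _ _ perm_inj). Qed.

Lemma stable_family_imset X g A : stable_family G X -> g \in G ->
  (g @: A \in X) = (A \in X).
Proof. by move=> stX gG; rewrite -(stX g _ gG) preim_imset. Qed.

Lemma hits_rainbow (c : seq nat) : size c = n -> all (fun v => v < k) c ->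
  all (fun v => v \in c) (iota 0 k) -> hits k G (Rainbow c).
Proof.
move=> sc ltk onto X stX [A AX cA].
case: k ut cA ltk onto => [|k'] ut' cA ltk onto.
  exists (bits A); first by rewrite bits_subsets cA.
  rewrite bitsK AX andbT /=; have /eqP := count_bits A; rewrite cA eqn0Ngt -has_count.
  by move/hasPn=> noA; rewrite (_ : mask _ _ = [::]) //; apply/nilP;
    rewrite /nilp size_mask ?size_bits // count_bits cA.
pose f (x : 'I_n) : 'I_k'.+1 := inord (nth 0 c x).
have fE x : val (f x) = nth 0 c x.
  by rewrite /= inordK //; apply: (allP ltk); rewrite mem_nth ?sc.
have cf : #|f @: [set: 'I_n]| = k'.+1.
  rewrite -[RHS]card_ord; apply: eq_card => v; rewrite [RHS]inE; apply/imsetP.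
  have /(nthP 0)[i] : val v \in c by apply: (allP onto); rewrite mem_iota ltn_ord.
  rewrite sc => lin e; exists (Ordinal lin) => //; apply: val_inj.
  by rewrite fE /= e.
have [g gG inj] := (iffLR (universal_transversalP _ _)) ut' _ f A cf cA.
have card_gA : #|g @: A| = k'.+1 by rewrite card_imset // => ? ? /perm_inj.
exists (bits (g @: A)); first by rewrite bits_subsets card_gA.
rewrite bitsK stable_family_imset // AX andbT /=.
have -> : c = [seq val (f i) | i <- enum 'I_n].
  apply: (@eq_from_nth _ 0) => [|i]; first by rewrite size_map size_enum_ord.
  rewrite sc => lin; rewrite (nth_map (Ordinal lin)) ?size_enum_ord //.
  by rewrite fE /= nth_enum_ord.
rewrite -map_mask -filter_mask map_comp map_inj_uniq; last exact: val_inj.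
rewrite map_inj_in_uniq => [|x y]; first by rewrite filter_uniq ?enum_uniq.
by rewrite !mem_filter => /andP[xA _] /andP[yA _]; apply: inj.
Qed.

Hypothesis kn : k <= n.

(** Enlarge [A] to a set [B] of k - 1 points, give these distinct colours and all other points one
    further colour, [None]. A rainbow image of [K] shows every colour, so it contains [B]; the
    inverse element moves [A] into [K]. *)
Lemma ut_cover A K : #|A| < k -> #|K| = k -> exists2 g, g \in G & g @: A \subset K.
Proof.
move=> ltA cK.
have [|B sAB cB] := @exists_superset _ A k.-1.
  by rewrite card_ord -ltnS prednK ?ltA //; lia.
pose f (x : 'I_n) := if x \in B then Some x else None.
have cf : #|f @: [set: 'I_n]| = k.
  have -> : f @: [set: 'I_n] = None |: (some @: B).
    apply/setP=> -[x|]; rewrite !inE /=.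
      rewrite (mem_imset _ _ Some_inj); apply/imsetP/idP => [[y _]|xB].
        by rewrite /f; case: ifP => // yB [->].
      by exists x; rewrite ?inE /f ?xB.
    have /subsetPn[x _ xB] : ~~ ([set: 'I_n] \subset B).
      by apply/negP => /subset_leq_card; rewrite cardsT card_ord cB; lia.
    by apply/imsetP; exists x; rewrite ?inE /f ?(negbTE xB).
  rewrite cardsU1 card_imset ?cB; last exact: Some_inj.
  by rewrite (_ : None \notin _) /=; [lia | apply/imsetP => -[]].
have [g gG inj] := (iffLR (universal_transversalP _ _)) ut _ f K cf cK.
exists (g^-1)%g; rewrite ?groupV //.
suff sB : B \subset g @: K.
  apply/subsetP => _ /imsetP[x xA ->]; have /imsetP[y yK ->] := subsetP sB x (subsetP sAB x xA).
  by rewrite permK.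
have : f @: (g @: K) = f @: [set: 'I_n].
  apply/eqP; rewrite eqEcard imsetS ?subsetT //= cf card_in_imset //.
  by rewrite card_imset ?cK // => ? ? /perm_inj.
move/setP=> e; apply/subsetP => x xB.
have /imsetP[y yK] : Some x \in f @: (g @: K).
  by rewrite e; apply/imsetP; exists x; rewrite ?inE /f ?xB.
by rewrite /f; case: ifP => // _ [->].
Qed.

Lemma hits_within (j : nat) (a : bitseq) : j < k -> a \in subsets n k ->
  hits j G (Within a).
Proof.
move=> ltjk ask X stX [A AX cA]; have sa : size a = n.
  by move: ask; rewrite mem_subsets => /andP[/eqP].
have [g gG sub] := @ut_cover A (setb n a) (eq_ind_r (fun i => i < k) ltjk cA) (card_setb_subsets
  ask).
exists (bits (g @: A)).
  by rewrite bits_subsets card_imset ?cA // => ? ? /perm_inj.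
by rewrite /= (subbP (size_bits _) sa) bitsK sub stable_family_imset.
Qed.

End Consequences.

Lemma homogeneousP (n k : nat) (G : {group 'S_n}) :
  k <= n -> homogeneous k G <-> set_homogeneous k G.
Proof.
move=> lekn; split=> [hom A B cA cB | hom].
  have := atransP2 hom (x := A) (y := B); rewrite !inE cA cB => /(_ (eqxx _) (eqxx _)).
  by case=> g gG ->; exists g.
have [A _ cA] : exists2 A : {set 'I_n}, set0 \subset A & #|A| = k.
  by apply: exists_superset; rewrite cards0 card_ord.
apply/imsetP; exists A; rewrite ?inE ?cA //; apply/setP=> B; rewrite inE.
apply/eqP/orbitP => [cB|[g gG <-]]; first by have [g gG <-] := hom A B cA cB; exists g.
by rewrite /= /setact card_imset // => ? ? /perm_inj.
Qed.

(** * Pairs of points as a two-coloured complete graph *)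

Section Cliques.
Variables (n : nat) (G : {group 'S_n}) (X : {set {set 'I_n}}).
Hypothesis stX : stable_family G X.
Implicit Types (S A : {set 'I_n}) (b : bool) (x y : 'I_n).

Definition clique b S : bool :=
  [forall x in S, forall y in S, (x != y) ==> (([set x; y] \in X) == b)].

Lemma cliqueP b S :
  reflect ({in S &, forall x y, x != y -> ([set x; y] \in X) = b}) (clique b S).
Proof.
apply: (iffP forall_inP) => [H x y xS yS xy | H x xS].
  by have /forall_inP/(_ y yS)/implyP/(_ xy)/eqP := H x xS.
by apply/forall_inP => y yS; apply/implyP => xy; rewrite H.
Qed.

Lemma clique_imset b S (g : 'S_n) : g \in G -> clique b S -> clique b (g @: S).
Proof.
move=> gG /cliqueP clS; apply/cliqueP => _ _ /imsetP[x xS ->] /imsetP[y yS ->].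
rewrite (inj_eq perm_inj) => xy; rewrite -(clS x y) //.
rewrite -(stable_family_imset [set x; y] stX gG); congr (_ \in X).
by rewrite imsetU !imset_set1.
Qed.

Lemma cliqueS b S A : A \subset S -> clique b S -> clique b A.
Proof.
move=> /subsetP sub /cliqueP clS; apply/cliqueP => x y xA yA.
by apply: clS; apply: sub.
Qed.

Lemma clique2 b x y : ([set x; y] \in X) = b -> clique b [set x; y].
Proof.
move=> <-; apply/cliqueP => u v; rewrite !inE.
by case/orP=> /eqP-> /orP[]/eqP->; rewrite ?eqxx // setUC.
Qed.

Definition neighbours b x : {set 'I_n} := [set y | (y != x) && (([set x; y] \in X) == b)].

Lemma clique_neighbours b x S :
  S \subset neighbours b x -> clique b S -> clique b (x |: S) /\ #|x |: S| = #|S|.+1.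
Proof.
move=> /subsetP sub /cliqueP clS; split.
  apply/cliqueP => u v; rewrite !inE => /orP[/eqP->|uS] /orP[/eqP->|vS]; rewrite ?eqxx //.
  - by move=> _; have := sub v vS; rewrite inE => /andP[_ /eqP].
  - by move=> _; have := sub u uS; rewrite inE setUC => /andP[_ /eqP].
  - exact: clS.
by rewrite cardsU1; case: (boolP (x \in S)) => // /sub; rewrite inE eqxx.
Qed.

Lemma card_neighbours x : #|neighbours true x| + #|neighbours false x| = n.-1.
Proof.
have <- : #|[set~ x]| = n.-1 by rewrite cardsC1 card_ord.
rewrite -[RHS](cardsID (neighbours true x)); congr (_ + _); apply: eq_card => y; rewrite !inE.
  by case: (y == x); case: (_ \in X).
by case: (y == x); case: (_ \in X).
Qed.

End Cliques.

Section TwoHomogeneous.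
Variables (n k : nat) (G : {group 'S_n}).
Hypothesis ut : universal_transversal k G.

(** By [ut_cover] a point can be moved into any pair. With a third point z, x goes to y or z, and y
    goes to x or z; if both go to z, one move followed by the inverse of the other takes x to y. *)
Lemma ut_transitive : k = 2 -> 2 < n -> set_homogeneous 1 G.
Proof.
move=> k2 lt2n; have le2n : k <= n by lia.
have one (x y z : 'I_n) : y != z -> exists2 g : 'S_n, g \in G & g x = y \/ g x = z.
  move=> yz; have cA : #|[set x]| < k by rewrite cards1 k2.
  have cK : #|[set y; z]| = k by rewrite cards2 yz k2.
  have [g gG] := ut_cover ut le2n cA cK.
  rewrite imset_set1 sub1set !inE => /orP[]/eqP e; exists g; rewrite ?e //; auto.
have tr (x y : 'I_n) : exists2 g : 'S_n, g \in G & g x = y.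
  have [z] : exists z, z \notin [set x; y].
    have /subsetPn[z _ zB] : ~~ ([set: 'I_n] \subset [set x; y]).
      apply/negP => /subset_leq_card; rewrite cardsT card_ord cards2.
      by case: (x != y) => /=; lia.
    by exists z.
  rewrite !inE negb_or => /andP[zx zy]; case: (eqVneq x y) => [->|xy].
    by exists 1%g; rewrite ?perm1 ?group1.
  have yz : y != z by rewrite eq_sym.
  have xz : x != z by rewrite eq_sym.
  have [g gG [gy|gz]] := one x y z yz; first by exists g.
  have [h hG [hx|hz]] := one y x z xz.
    by exists (h^-1)%g; rewrite ?groupV // -hx permK.
  by exists (g * h^-1)%g; rewrite ?groupM ?groupV // permM gz -hz permK.
move=> A B /eqP/cards1P[x ->] /eqP/cards1P[y ->]; have [g gG <-] := tr x y.
by exists g; rewrite // imset_set1.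
Qed.

(* If some pair orbit were proper, colour the pairs by membership in it: every
   k-set would contain a copy of each smaller coloured set, which Ramsey-type
   arguments exclude. *)
Lemma ut_2homogeneous : 2 < k < 6 -> k.*2 <= n -> set_homogeneous 2 G.
Proof.
move=> /andP[lt2k ltk6] le2kn A B cA cB.
pose X : {set {set 'I_n}} := [set g @: A | g : 'S_n in G].
have stX : stable_family G X by apply: stable_family_orbit.
case: (boolP (B \in X)) => [/imsetP[g gG ->]|BX]; first by exists g.
have AX : A \in X by apply/imsetP; exists 1%g; rewrite ?group1 //;
  rewrite -[LHS]imset_id; apply: eq_imset => i; rewrite perm1.
exfalso; have kn : k <= n by lia.
have pair b : exists2 P : {set 'I_n}, #|P| = 2 & clique X b P.
  case: b; [exists A => //; move: cA AX | exists B => //; move: cB (negbTE BX)].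
    by move=> /eqP/cards2P[x [y [_ ->]]]; apply: clique2.
  by move=> /eqP/cards2P[x [y [_ ->]]]; apply: clique2.
have cover b (S K : {set 'I_n}) : #|S| < k -> #|K| = k -> clique X b S ->
    exists2 S' : {set 'I_n}, S' \subset K & clique X b S' /\ #|S'| = #|S|.
  move=> ltS cK clS; have [g gG sub] := ut_cover ut kn ltS cK.
  exists (g @: S) => //; split; first exact: (clique_imset stX).
  by rewrite card_imset // => ? ? /perm_inj.
(* A clique of k - 1 points cannot exist: a k-set around two disjoint edges of the other colour
   contains a copy of it that leaves out a single point, so one of the two edges lies inside the
   copy. *)
have no_small b (S : {set 'I_n}) : 3 < k -> clique X b S -> #|S|.+1 = k -> False.
  move=> lt3k clS cS; have [P cP clP] := pair (~~ b).
  have [K1 K1C cK1] : exists2 K1 : {set 'I_n}, K1 \subset ~: P & #|K1| = k.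
    have : 0 < #|[set K1 : {set 'I_n} | (K1 \subset ~: P) && (#|K1| == k)]|.
      by rewrite cards_draws bin_gt0; have := cardsC P; rewrite card_ord cP; lia.
    by case/card_gt0P => K1; rewrite inE => /andP[? /eqP]; exists K1.
  have ltPk : #|P| < k by rewrite cP.
  have [P' sP'K1 [clP' cP']] := cover _ P K1 ltPk cK1 clP.
  have disjPP' : [disjoint P & P'].
    rewrite disjoint_sym disjoints_subset; exact: subset_trans sP'K1 K1C.
  have cPP' : #|P :|: P'| = 4 by rewrite cardsU disjoint_setI0 // cards0 cP' cP.
  have [|K2 sub2 cK2] := @exists_superset _ (P :|: P') k; first by rewrite cPP' card_ord lt3k.
  have ltSk : #|S| < k by rewrite -cS.
  have [S' sS'K2 [clS' cS']] := cover _ S K2 ltSk cK2 clS.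
  have noP (Q : {set 'I_n}) : #|Q| = 2 -> clique X (~~ b) Q -> Q \subset S' -> False.
    move=> /eqP/cards2P[x [y [xy ->]]] /cliqueP clQ /(cliqueS)/(_ clS')/cliqueP clQ'.
    by have := clQ x y; rewrite (clQ' x y) ?set21 ?set22 // => /(_ isT isT xy); case: (b).
  have cD : #|K2 :\: S'| = 1 by rewrite cardsD (setIidPr sS'K2) cK2 cS' -cS subSnn.
  have /eqP/cards1P[z zE] := cD.
  have sub (Q : {set 'I_n}) : Q \subset K2 -> z \notin Q -> Q \subset S'.
    move=> /subsetP QK zQ; apply/subsetP => x xQ.
    have : x \notin K2 :\: S' by rewrite zE inE; apply: contraNneq zQ => <-.
    by rewrite inE (QK x xQ) andbT negbK.
  case: (boolP (z \in P)) => zP; last first.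
    by apply: (noP P) => //; apply: sub => //; apply: subset_trans sub2; apply: subsetUl.
  apply: (noP P'); rewrite ?cP' //; apply: sub.
    by apply: subset_trans sub2; apply: subsetUr.
  by move/pred0P: disjPP' => /(_ z); rewrite /= zP /= => ->.
have n0 : 0 < n by lia.
pose x := Ordinal n0.
(* Pigeonhole: the n - 1 >= 2k - 1 other points include k neighbours of [x] in one colour. *)
have [b [S sSN cS]] : exists b, exists2 S : {set 'I_n}, S \subset neighbours X b x & #|S| = k.
  have sub b : k <= #|neighbours X b x| -> exists2 S : {set 'I_n}, S \subset neighbours X b x & #|S|
    = k.
    move=> le; have : 0 < #|[set S : {set 'I_n} | (S \subset neighbours X b x) && (#|S| == k)]|.
      by rewrite cards_draws bin_gt0.
    by case/card_gt0P => S; rewrite inE => /andP[? /eqP]; exists S.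
  have := card_neighbours X x; case: (leqP k #|neighbours X true x|) => [/sub|lt sum].
    by exists true.
  by exists false; apply: sub; lia.
have [P cP clP] := pair b; have ltPk : #|P| < k by rewrite cP.
have [P' sP'S [clP' cP']] := cover _ P S ltPk cS clP.
have [clT cT] := clique_neighbours (subset_trans sP'S sSN) clP'.
(* For k = 3 the triangle is a k-set without an edge of the other colour. For k = 5 its copy among
   the neighbours of [x] extends to a clique of 4 points, and for k = 4 it already has k - 1 points;
   [no_small] excludes both. *)
case: (ltngtP k 4) => [lt4|gt4|k4].
- have [Q cQ clQ] := pair (~~ b); have ltQk : #|Q| < k by rewrite cQ.
  have cT' : #|x |: P'| = k by apply/eqP; rewrite cT cP' cP eqn_leq lt2k -ltnS lt4.
  have [Q' sQ'T [clQ' cQ']] := cover _ Q _ ltQk cT' clQ.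
  have /eqP/cards2P[u [v [uv eQ']]] : #|Q'| = 2 by rewrite cQ'.
  move: clQ' (cliqueS sQ'T clT); rewrite eQ' => /cliqueP c1 /cliqueP c2.
  by have := c1 u v; rewrite (c2 u v) ?set21 ?set22 // => /(_ isT isT uv); case: (b).
- have ltTk : #|x |: P'| < k by rewrite cT cP' cP ltnW.
  have [Q' sQ'S [clQ' cQ']] := cover _ _ _ ltTk cS clT.
  have [clU cU] := clique_neighbours (subset_trans sQ'S sSN) clQ'.
  apply: (no_small b _ (ltnW gt4) clU); apply/eqP.
  by rewrite cU cQ' cT cP' cP eqn_leq gt4 -ltnS ltk6.
- by apply: (no_small b _ _ clT); rewrite ?cT ?cP' ?cP k4.
Qed.

End TwoHomogeneous.

(** * Standard forms of small subgroups *)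

Local Open Scope group_scope.

Section Conjugation.
Variables (n : nat) (G : {group 'S_n}) (s : 'S_n).
Implicit Types (A B : {set 'I_n}) (g : 'S_n).

Lemma imset_mul g h A : (g * h) @: A = h @: (g @: A).
Proof. by rewrite -imset_comp; apply: eq_imset => x; rewrite /= permM. Qed.

Lemma card_imperm g A : #|g @: A| = #|A|.
Proof. by rewrite card_imset //; apply: perm_inj. Qed.

Lemma imset_permK g A : g @: (g^-1 @: A) = A.
Proof.
by rewrite -imset_mul mulVg -[RHS]imset_id; apply: eq_imset => x; rewrite perm1.
Qed.

Lemma universal_transversal_conj k :
  universal_transversal k G -> universal_transversal k (G :^ s).
Proof.
move=> /universal_transversalP rt; apply/universal_transversalP => U c A cc cA.
have cc' : #|(c \o s) @: [set: 'I_n]| = k.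
  by rewrite imset_comp (_ : s @: _ = setT) //; apply/eqP; rewrite eqEcard subsetT card_imperm
    leqnn.
have [|g gG inj] := rt _ _ (s^-1 @: A) cc'; first by rewrite card_imperm.
exists (g ^ s); first by rewrite memJ_conjg.
have -> : (g ^ s) @: A = s @: (g @: (s^-1 @: A)) by rewrite conjgE !imset_mul.
move=> _ _ /imsetP[x xA ->] /imsetP[y yA ->] e; congr (s _).
by apply: inj.
Qed.

Lemma set_homogeneous_conj t : set_homogeneous t G -> set_homogeneous t (G :^ s).
Proof.
move=> hom A B cA cB.
have [||g gG e] := hom (s^-1 @: A) (s^-1 @: B); rewrite ?card_imperm //.
exists (g ^ s); first by rewrite memJ_conjg.
by rewrite conjgE !imset_mul e imset_permK.
Qed.

End Conjugation.

(** [s] takes the i-th entry of [L] to i, so an element that permutes the entries of [L] by [q] gets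
    the image list [q] after conjugation. *)
Lemma standard_labelling (n : nat) (G : {group 'S_n}) (L : seq 'I_n) :
  uniq L -> size L = n -> exists s : 'S_n, forall c (q : seq nat), c \in G ->
    size q = n -> (forall i, i < n -> nth 0 q i < n /\
      forall x, c (nth x L i) = nth x L (nth 0 q i)) -> listed (G :^ s) q.
Proof.
move=> uL sL.
have inj : injective (fun i : 'I_n => nth i L i).
  move=> i j; rewrite (set_nth_default i j) ?sL // => /eqP.
  by rewrite nth_uniq ?sL // => /eqP/val_inj.
exists (perm inj)^-1 => c q cG sq qP.
apply/listedP; exists (c ^ (perm inj)^-1); first by rewrite memJ_conjg.
apply: (@eq_from_nth _ 0); rewrite size_images // => i lin.
rewrite (nth_images 0 _ (Ordinal lin)) conjgE invgK !permM (permE inj) /=.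
have [ltq e] := qP i lin; rewrite (e (Ordinal lin)).
rewrite (_ : nth _ L _ = perm inj (Ordinal ltq)) ?permK //.
by rewrite (permE inj) /=; apply: set_nth_default; rewrite sL.
Qed.

Lemma size_cycle_list n p m : size (cycle_list n p m) = n.
Proof. by rewrite size_map size_iota. Qed.

Lemma nth_cycle_list n p m i : i < n -> nth 0 (cycle_list n p m) i =
  if i < p * m then i %/ p * p + (i %% p).+1 %% p else i.
Proof. by move=> lin; rewrite (nth_map 0) ?size_iota // nth_iota. Qed.

Local Close Scope group_scope.

(** * Cycle structure of an element of prime order *)

Section PrimeOrder.
Variables (n p : nat) (c : 'S_n).
Hypotheses (p_pr : prime p) (cp : (c ^+ p = 1)%g).
Implicit Types (x y : 'I_n) (L : seq 'I_n).

Lemma uniq_traject_prime x : c x != x -> uniq (traject c x p).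
Proof.
move=> cx; suff <- : #|porbit c x| = p by apply: uniq_traject_porbit.
have : #|porbit c x| %| p.
  rewrite porbitE (dvdn_trans (dvdn_orbit _ _ _)) // -orderE.
  by rewrite order_dvdn cp.
case/primeP: p_pr => _ H /H/orP[/eqP e1|/eqP //].
by have := iter_porbit c x; rewrite e1 /= => /eqP; rewrite (negbTE cx).
Qed.

Definition cycled (m : nat) L : Prop :=
  [/\ uniq L, size L = p * m, {in L, forall x, c x != x} &
      forall i x, i < p * m -> c (nth x L i) = nth x L (i %/ p * p + (i %% p).+1 %% p)].

Let p_gt0 : 0 < p := prime_gt0 p_pr.

Lemma cycled_index m i : i < p * m -> i %/ p * p + (i %% p).+1 %% p < p * m.
Proof.
move=> lti; have := ltn_pmod (i %% p).+1 p_gt0; move: (_ %% p) => r ltr.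
apply: (@leq_trans (i %/ p * p + p)); first by rewrite ltn_add2l.
by rewrite addnC -mulSn mulnC leq_mul2l ltn_divLR // mulnC lti orbT.
Qed.

Lemma cycled_closed m L x : cycled m L -> x \in L -> c x \in L.
Proof.
case=> uL sL _ eL /(nthP x)[i]; rewrite sL => lti <-.
by rewrite eL // mem_nth // sL cycled_index.
Qed.

Lemma cycled_extend m L x : cycled m L -> c x != x -> x \notin L ->
  cycled m.+1 (L ++ traject c x p).
Proof.
move=> cL cx xL; have [uL sL movL eL] := cL.
have inL j y : y \in L -> (c ^+ j)%g y \in L.
  by move=> yL; elim: j => [|j IH]; rewrite ?expg0 ?perm1 // expgSr permM (cycled_closed cL).
have trL y : y \in traject c x p -> y \notin L.
  case/trajectP => i ltip ->; rewrite -permX; apply: contra xL => /(inL (p - i)).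
  by rewrite -permM -expgD subnKC ?cp ?perm1 // ltnW.
split.
- rewrite cat_uniq uL uniq_traject_prime // andbT /=.
  by apply/hasPn => y /trL.
- by rewrite size_cat size_traject sL mulnS addnC.
- move=> y; rewrite mem_cat => /orP[/movL //|/trajectP[i _ ->]].
  by rewrite -!permX -permM -expgSr expgS permM (inj_eq perm_inj).
move=> i y lti; rewrite !nth_cat sL; case: (ltnP i (p * m)) => [ltm|lem].
  by rewrite eL // cycled_index.
have [r ltr ei] : exists2 r, r < p & i = p * m + r.
  by exists (i - p * m); rewrite ?subnKC // ltn_subLR // -mulnSr.
rewrite {}ei addKn [p * m]mulnC divnMDl // modnMDl (divn_small ltr) (modn_small ltr) addn0.
rewrite ltnNge leq_addr addKn /=.
rewrite !(set_nth_default x y) ?size_traject ?ltn_pmod //.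
rewrite !nth_traject ?ltn_pmod // -iterS; case: (ltngtP r.+1 p) ltr => // [lt|e] _.
  by rewrite modn_small.
by rewrite e modnn /= -permX cp perm1.
Qed.

Lemma prime_cycles : c != 1%g -> exists m L, [/\ 0 < m, p * m <= n,
  uniq L, size L = n &
  forall i, i < n -> nth 0 (cycle_list n p m) i < n /\
    forall x, c (nth x L i) = nth x L (nth 0 (cycle_list n p m) i)].
Proof.
move=> c1.
have [m [L [cL full]]] : exists m L, cycled m L /\ (forall x, c x != x -> x \in L).
  have : cycled 0 [::] by split; rewrite ?muln0 // => ? ?; rewrite ltn0.
  move: {2}(n - _) (leqnn (n - size (@nil 'I_n))) => d; move: 0 [::].
  elim: d => [|d IH] m L led cL; last first.
    case: (boolP [forall x, (c x != x) ==> (x \in L)]) => [/forallP all|].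
      by exists m, L; split=> // x cx; have /implyP := all x; apply.
    rewrite negb_forall => /existsP[x]; rewrite negb_imply => /andP[cx xL].
    apply: (IH m.+1 _ _ (cycled_extend cL cx xL)).
    by rewrite size_cat size_traject; lia.
  exists m, L; split=> // x _; case: cL => uL _ _ _.
  have le : size (enum 'I_n) <= size L by rewrite size_enum_ord; lia.
  have sub : {subset L <= enum 'I_n} by move=> ? _; rewrite mem_enum.
  by have [_ ->] := uniq_min_size uL sub le; rewrite mem_enum.
have [uL sL movL eL] := cL.
pose R := [seq x <- enum 'I_n | x \notin L].
have uLR : uniq (L ++ R).
  rewrite cat_uniq uL filter_uniq ?enum_uniq // andbT /=.
  by apply/hasPn => x; rewrite mem_filter => /andP[].
have sLR : size (L ++ R) = n.
  rewrite -[RHS](card_ord n) -(card_uniqP uLR); apply: eq_card => x.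
  by rewrite mem_cat mem_filter mem_enum andbT orbN.
have lepm : p * m <= n by rewrite -sLR -sL size_cat leq_addr.
exists m, (L ++ R); split => //.
  case: m {eL lepm cL} sL => // sL; case/eqP: c1; apply/permP => x; rewrite perm1.
  apply/eqP; apply: contraT => /full; by rewrite (size0nil (etrans sL (muln0 _))).
move=> i lin; rewrite nth_cycle_list //; case: ifP => [ltm|/negbT].
  have ltm' := cycled_index ltm.
  split=> [|x]; first exact: leq_trans ltm' lepm.
  by rewrite !nth_cat sL ltm ltm' eL.
rewrite -leqNgt => lem; split=> // x.
set y := nth x _ i; have : y \in R.
  by rewrite /y nth_cat sL ltnNge lem /= mem_nth // -(ltn_add2l (size L)) -size_cat sLR sL subnKC.
rewrite mem_filter => /andP[yL _]; apply/eqP; apply: contraNT yL => /full; exact.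
Qed.

End PrimeOrder.

(** * Transitive Sylow subgroups and regular groups of order nine *)

Section Regular.
Variables (n p a : nat) (H : {group 'S_n}) (W : {set 'I_n}) (x0 : 'I_n).
Hypotheses (p_pr : prime p) (a_gt0 : 0 < a) (cW : #|W| = p ^ a).
Hypotheses (orbH : orbit 'P H x0 = W) (fixH : forall h x, h \in H -> x \notin W -> h x = x).

(** Comparing the orbit-stabiliser formulas of [H] and of a Sylow p-subgroup [P] shows that [P] is
    still transitive on the p-power set [W]. A central [z] of order p fixing one point of [W] would
    fix all of [W] by transitivity, and it fixes the rest by [fixH], so it would be 1. *)
Lemma transitive_pgroup : exists P : {group 'S_n},
  [/\ P \subset H, (p.-group P)%g, orbit 'P P x0 = W &
      exists2 z : 'S_n, z \in 'Z(P)%g & #[z]%g = p /\ forall x, x \in W -> z x != x].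
Proof.
have [P sylP] := Sylow_exists p H; have [sPH pP _] := and3P sylP.
have trP : orbit 'P P x0 = W.
  apply/eqP; rewrite eqEcard -{1}orbH imsetS //= cW.
  have := card_orbit_stab 'P H x0; have := card_orbit_stab 'P P x0; rewrite orbH cW => eP eH.
  have cP : #|P| = (p ^ a * #|'C_H[x0 | 'P]%g|`_p)%N.
    rewrite (card_Hall sylP) -eH partnM ?cardG_gt0 ?expn_gt0 ?prime_gt0 //.
    by congr (_ * _)%N; rewrite part_pnat_id // pnatX pnat_id.
  have dv : #|'C_P[x0 | 'P]%g| %| #|'C_H[x0 | 'P]%g|`_p.
    rewrite -(part_pnat_id (pgroupS (subsetIl P _) pP)) partn_dvd // cardSg //.
    exact: setSI.
  have c_gt0 : 0 < #|'C_P[x0 | 'P]%g| by apply: cardG_gt0.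
  rewrite -(leq_pmul2r c_gt0) eP cP leq_mul2l.
  by rewrite (dvdn_leq _ dv) ?orbT // part_gt0.
exists P; split=> //.
have Pn1 : P :!=: 1%g.
  apply: contraTneq (leqnn #|W|) => P1; rewrite -{2}trP P1 cW -ltnNge.
  rewrite (_ : orbit _ _ _ = [set x0]) ?cards1; last by rewrite /orbit imset_set1 act1.
  by rewrite -(exp1n a) ltn_exp2r ?prime_gt1.
have Zn1 : 'Z(P)%g != 1%g by apply: contraNneq Pn1 => /(trivg_center_pgroup pP)/eqP.
have pZ : (p.-group 'Z(P))%g := pgroupS (center_sub P) pP.
have [_ pdiv _] := pgroup_pdiv pZ Zn1.
have [z zZ oz] := Cauchy p_pr pdiv; exists z => //; split=> // x xW.
have /centerP[zP cz] := zZ.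
apply/eqP => zx.
suff z1 : z = 1%g by move: (prime_gt1 p_pr); rewrite -oz z1 order1.
apply/permP => y; rewrite perm1; case: (boolP (y \in W)) => yW; last first.
  by apply: fixH => //; apply: (subsetP sPH).
move: xW yW; rewrite -trP => /orbitP[h hP hx] /orbitP[k kP <-].
rewrite /= /aperm -permM -cz // permM; congr (k _).
apply: (@perm_inj _ h); rewrite -permM cz // permM.
by move: hx; rewrite /= /aperm => ->.
Qed.

End Regular.

Lemma nth_columns n i : i < n ->
  nth 0 (columns n) i = if i < 9 then (i + 3) %% 9 else i.
Proof. by move=> lin; rewrite (nth_map 0) ?size_iota // nth_iota. Qed.

Section Nine.
Variables (n : nat) (H : {group 'S_n}) (W : {set 'I_n}) (x0 : 'I_n).
Hypotheses (cW : #|W| = 9).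
Hypotheses (orbH : orbit 'P H x0 = W) (fixH : forall h x, h \in H -> x \notin W -> h x = x).

Lemma nine_le : 9 <= n.
Proof. by rewrite -cW -[X in _ <= X]card_ord max_card. Qed.

Lemma standard_nine (L0 : seq 'I_n) : uniq L0 -> L0 =i W -> exists s : 'S_n,
  forall c (q : seq nat), c \in H -> size q = n ->
  (forall i, i < 9 -> nth 0 q i < 9 /\ forall x, c (nth x L0 i) = nth x L0 (nth 0 q i)) ->
  (forall i, 9 <= i < n -> nth 0 q i = i) -> listed (H :^ s)%g q.
Proof.
move=> uL eL; pose R := [seq x <- enum 'I_n | x \notin L0].
have sL : size L0 = 9 by rewrite -(card_uniqP uL) -cW; apply: eq_card.
have uLR : uniq (L0 ++ R).
  rewrite cat_uniq uL filter_uniq ?enum_uniq // andbT /=.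
  by apply/hasPn => x; rewrite mem_filter => /andP[].
have sLR : size (L0 ++ R) = n.
  rewrite -[RHS](card_ord n) -(card_uniqP uLR); apply: eq_card => x.
  by rewrite mem_cat mem_filter mem_enum andbT orbN.
have [s sP] := standard_labelling H uLR sLR; exists s => c q cH sq q9 qfix.
apply: (sP _ _ cH sq) => i lin; case: (ltnP i 9) => [lt9|le9].
  have [ltq e] := q9 i lt9; split=> [|x]; first exact: leq_trans ltq nine_le.
  by rewrite !nth_cat sL lt9 ltq.
have -> : nth 0 q i = i by rewrite qfix ?le9.
split=> // x; apply: fixH => //; set y := nth x _ i; have : y \in R.
  by rewrite /y nth_cat sL ltnNge le9 /= mem_nth // -(ltn_add2l 9) -sL -size_cat sLR sL subnKC.
by rewrite mem_filter eL => /andP[].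
Qed.

(** Take a central [z] of order 3 in a transitive 3-group and an [h] moving [x0] out of its
    [z]-orbit. They commute, so they generate an abelian group that is transitive, hence regular, on
    [W]. It is elementary abelian or cyclic according to whether [h ^+ 3] fixes [x0]. *)
Lemma regular_nine : exists s : 'S_n,
  all (listed (H :^ s)%g) (C9 n) \/ all (listed (H :^ s)%g) (E9 n).
Proof.
have [P [sPH pP orbP [z /centerP[zP cz] [oz movz]]]] :=
  transitive_pgroup (isT : prime 3) (isT : 0 < 2) cW orbH fixH.
have le9 := nine_le.
have z3 : (z ^+ 3 = 1)%g by rewrite -oz expg_order.
have x0W : x0 \in W by rewrite -orbP orbit_refl.
have inW h x : h \in P -> x \in W -> h x \in W.
  by rewrite -orbP => hP; have := orbit_actr 'P x0 x hP => /= ->.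
pose sim x y := exists a, y = (z ^+ a)%g x.
have simE x y : sim x y -> exists2 a, a < 3 & y = (z ^+ a)%g x.
  case=> a ->; exists (a %% 3); first by rewrite ltn_mod.
  by rewrite {1}(divn_eq a 3) mulnC expgD expgM z3 expg1n mul1g.
have sim_trans x y w : sim x y -> sim y w -> sim x w.
  by move=> [a ->] [b ->]; exists (a + b)%N; rewrite expgD permM.
have sim_sym x y : sim x y -> sim y x.
  move/simE=> [a lta ->]; exists (3 - a); rewrite -permM -expgD subnKC ?z3 ?perm1 //.
  exact: ltnW.
have [y yW nsim] : exists2 y, y \in W & ~ sim x0 y.
  have : ~~ (W \subset [set (z ^+ (a : 'I_3))%g x0 | a in 'I_3]).
    apply/negP => /subset_leq_card; rewrite cW leqNgt => /negP[].
    by apply: leq_ltn_trans (leq_imset_card _ _) _; rewrite card_ord.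
  case/subsetPn=> y yW yN; exists y => // /simE[a lta ey]; case/negP: yN.
  by apply/imsetP; exists (Ordinal lta).
have [h hP ey] : exists2 h, h \in P & h x0 = y.
  by move: yW; rewrite -orbP => /orbitP[h hP <-]; exists h.
rewrite -{}ey {y yW} in nsim.
have czh a b : ((z ^+ a) * (h ^+ b) = (h ^+ b) * (z ^+ a))%g.
  by apply: commuteX2; apply: cz.
have sim_h b x w : sim x w -> sim ((h ^+ b)%g x) ((h ^+ b)%g w).
  by move=> [a ->]; exists a; rewrite -!permM czh.
have sim_hV b x w : sim ((h ^+ b)%g x) ((h ^+ b)%g w) -> sim x w.
  by move=> [a]; rewrite -permM -czh permM => /perm_inj; exists a.
(* [h] has odd order 3^e, so it is a power of [h ^+ 2]: if [h ^+ 2] kept [x0] in its [z]-orbit, so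
   would [h]. *)
have nsim2 : ~ sim x0 ((h ^+ 2)%g x0).
  move=> s2; have [e oh] : exists e, #[h]%g = 3 ^ e.
    by have [e oe] := p_natP (mem_p_elt pP hP); exists e.
  have sm m : sim x0 ((h ^+ (2 * m))%g x0).
    elim: m => [|m IH]; first by exists 0; rewrite muln0 !expg0.
    by rewrite mulnS expgD permM; apply: sim_trans IH _; apply: sim_h.
  have := sm (uphalf (3 ^ e)).
  have -> : 2 * uphalf (3 ^ e) = #[h]%g.+1.
    by rewrite oh; have := odd_double_half (3 ^ e).+1; rewrite /= oddX /= orbT; lia.
  by rewrite expgS expg_order mulg1.
have nsimk k : 0 < k < 3 -> ~ sim x0 ((h ^+ k)%g x0) by case: k => [|[|[|k]]].
have bb b b' a a' : b < b' < 3 ->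
    (h ^+ b)%g ((z ^+ a)%g x0) <> (h ^+ b')%g ((z ^+ a')%g x0).
  move=> /andP[ltb ltb'] e; apply: (@nsimk (b' - b)); first by lia.
  apply: (sim_hV b); rewrite -permM -expgD subnK; last exact: ltnW.
  apply: (@sim_trans _ ((h ^+ b)%g ((z ^+ a)%g x0))); first by apply: sim_h; exists a.
  by rewrite e; apply: sim_h; apply: sim_sym; exists a'.
have za a a' : a < a' < 3 -> (z ^+ a)%g x0 <> (z ^+ a')%g x0.
  move=> /andP[lta lta'] e.
  have : (z ^+ (a' - a))%g x0 = x0.
    by apply: (@perm_inj _ (z ^+ a)%g); rewrite -permM -expgD subnK // ltnW.
  have mz := movz _ x0W; case ed: (a' - a) => [|[|[|d]]]; try lia.
    by rewrite expg1 => /eqP; apply/negP.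
  move=> e2; have : (z ^+ 3)%g x0 = z x0 by rewrite (expgD z 2 1) permM e2 expg1.
  by rewrite z3 perm1 => /esym/eqP; apply/negP.
pose pt b a := (h ^+ b)%g ((z ^+ a)%g x0).
pose L0 := [seq pt b a | b <- iota 0 3, a <- iota 0 3].
have uL0 : uniq L0.
  apply: allpairs_uniq; rewrite ?iota_uniq // => u v /allpairsP U /allpairsP V.
  case: U V => -[b a] [ltb lta ->] [[b' a'] [ltb' lta' ->]].
  move: ltb lta ltb' lta'; rewrite !mem_iota !add0n /= => ltb lta ltb' lta' e.
  case: (ltngtP b b') => [lt|lt|eb].
  - by case: (@bb b b' a a'); rewrite ?lt.
  - by case: (@bb b' b a' a); rewrite ?lt.
  move: e; rewrite /pt eb => /perm_inj e.
  case: (ltngtP a a') => [lt|lt|-> //].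
  - by case: (@za a a'); rewrite ?lt.
  - by case: (@za a' a); rewrite ?lt.
have eL0 : L0 =i W.
  have sub : {subset L0 <= enum W}.
    move=> _ /allpairsP[[b a] /= [_ _ ->]]; rewrite mem_enum /pt.
    by rewrite !inW ?groupX.
  have le : size (enum W) <= size L0 by rewrite -cardE cW.
  by have [_ e] := uniq_min_size uL0 sub le; move=> x; rewrite e mem_enum.
have [a lta h3] : exists2 a, a < 3 & (h ^+ 3)%g x0 = (z ^+ a)%g x0.
  have : (h ^+ 3)%g x0 \in L0 by rewrite eL0 inW // groupX.
  case/allpairsP=> -[b a] []; rewrite !mem_iota !add0n /= => ltb lta e.
  case: b ltb e => [|b] ltb e; first by exists a; rewrite // e /pt expg0 perm1.
  have k3 : 0 < 3 - b.+1 < 3 by lia.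
  case: (nsimk _ k3); apply: (sim_hV b.+1); rewrite -permM -expgD subnK ?e; last exact: ltnW.
  by apply: sim_h; exists a.
have zpt b a' : z (pt b a') = pt b a'.+1.
  have zh : (h ^+ b * z = z * h ^+ b)%g by have := czh 1 b; rewrite expg1.
  by rewrite /pt expgSr -!permM -!mulgA zh.
have hpt b a' : h (pt b a') = pt b.+1 a' by rewrite /pt -permM -expgSr.
have pt3 b : pt b 3 = pt b 0 by rewrite /pt z3 expg0.
have zH := subsetP sPH _ zP; have hH := subsetP sPH _ hP.
case: (posnP a) => [a0|a_gt0].
  have p3 a' : pt 3 a' = pt 0 a'.
    by rewrite /pt -permM czh permM h3 a0 !expg0 !perm1.
  have [s sP] := standard_nine uL0 eL0; exists s; right.
  have zL : listed (H :^ s)%g (cycle_list n 3 3).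
    apply: (sP z) => //; rewrite ?size_cycle_list // => i.
      move=> lt9; rewrite (nth_cycle_list _ _ (leq_trans lt9 le9)).
      by do 9?[case: i lt9 => [|i] lt9 //; first by split=> // x; rewrite /= zpt ?pt3].
    by case/andP=> ge9 ltn; rewrite nth_cycle_list // ltnNge ge9.
  have hL : listed (H :^ s)%g (columns n).
    apply: (sP h) => //; rewrite ?size_map ?size_iota // => i.
      move=> lt9; rewrite (nth_columns (leq_trans lt9 le9)) lt9.
      by do 9?[case: i lt9 => [|i] lt9 //; first by split=> // x; rewrite /= hpt ?p3].
    by case/andP=> ge9 ltn; rewrite nth_columns // ltnNge ge9.
  apply/allP => _ /allpairsP[[q r] /= [/mapP[i _ ->] /mapP[j _ ->] ->]].
  by apply: listed_lmul; apply: listed_pow.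
pose L1 := [seq (h ^+ i)%g x0 | i <- iota 0 9].
have hE b c : (h ^+ (b + 3 * c))%g x0 = pt b (a * c).
  rewrite addnC expgD permM /pt; congr ((_ : {perm _}) _).
  elim: c => [|c IH]; first by rewrite !muln0 !expg0.
  by rewrite !mulnS expgD permM h3 -permM (czh a) permM IH -permM -expgD addnC.
have ptm b a' : pt b (a' %% 3) = pt b a'.
  by rewrite /pt [in RHS](divn_eq a' 3) mulnC expgD expgM z3 expg1n mul1g.
have sub : {subset L0 <= L1}.
  move=> u /allpairsP[[b a'] []]; rewrite !mem_iota !add0n /= => ltb lta' ->.
  (* As a is 1 or 2, a * a = 1 modulo 3, and c = a * a' solves a * c = a'. *)
  have [c ltc ->] : exists2 c, c < 3 & pt b a' = pt b (a * c).
    exists ((a * a') %% 3); rewrite ?ltn_mod // -(ptm _ (a * _)) modnMmr mulnA.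
    have aa : (a * a) %% 3 = 1 by move: lta a_gt0; clear; case: a => [|[|[|a]]].
    by rewrite -modnMml aa mul1n modn_small.
  by rewrite -hE; apply: map_f; rewrite mem_iota; lia.
have [_ eL] := uniq_min_size uL0 sub (leqnn _).
have uL1 : uniq L1.
  by rewrite (eq_uniq (s2 := L0)) // => x; rewrite eL.
have eL1 : L1 =i W by move=> x; rewrite -eL eL0.
have h9 : (h ^+ 9)%g x0 = x0.
  by rewrite (hE 0 3) -ptm modnMl /pt !expg0 !perm1.
have [s sP] := standard_nine uL1 eL1; exists s; left.
suff hL : listed (H :^ s)%g (cycle_list n 9 1).
  by apply/allP => _ /mapP[i _ ->]; apply: listed_pow.
apply: (sP h) => //; rewrite ?size_cycle_list // => i.
  move=> lt9; rewrite (nth_cycle_list _ _ (leq_trans lt9 le9)) lt9.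
  rewrite divn_small // mul0n add0n (modn_small lt9).
  split=> [|x]; first by rewrite ltn_mod.
  rewrite !(nth_map 0) ?size_iota ?ltn_mod // !nth_iota ?ltn_mod // !add0n.
  rewrite -permM -expgSr; case: (ltngtP i.+1 9) lt9 => // [lt|e] _.
    by rewrite modn_small.
  by rewrite e modnn h9 expg0 perm1.
by case/andP=> ge9 ltn; rewrite nth_cycle_list // ltnNge ge9.
Qed.

End Nine.

(** [Within] the full set yields the clause of all orbits; it serves where the design condition
    alone excludes a family. *)
Definition valid (n k j : nat) (s : selector) : bool :=
  match s with
  | Rainbow c => [&& j == k, size c == n, all (fun v => v < k) c &
                     all (fun v => v \in c) (iota 0 k)]
  | Within a => (j < k) && (a \in subsets n k) || (a == nseq n true)
  end.

Lemma hits_all (n k : nat) (G : {group 'S_n}) : hits k G (Within (nseq n true)).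
Proof.
move=> X _ [A AX cA]; exists (bits A); first by rewrite bits_subsets cA.
rewrite /= (@subbP n) ?size_bits ?size_nseq // bitsK AX andbT.
by apply/subsetP => i _; rewrite inE nth_nseq ltn_ord.
Qed.

Lemma hits_valid (n k j : nat) (G : {group 'S_n}) (s : selector) :
  universal_transversal k G -> k <= n -> valid n k j s -> hits j G s.
Proof.
move=> ut kn; case: s => [c /and4P[/eqP-> /eqP sc ltk onto]|a /orP[/andP[jk ak]|/eqP->]].
- exact: hits_rainbow.
- exact: (hits_within ut kn jk ak).
- exact: hits_all.
Qed.

Lemma allP_In (A : Type) (p : pred A) (l : seq A) :
  all p l -> forall x, List.In x l -> p x.
Proof. by elim: l => //= y l IH /andP[py /IH H] x [<- //|/H]. Qed.

Lemma ut_search (n k j : nat) (G : {group 'S_n}) T t ms d sels :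
  universal_transversal k G -> k <= n ->
  search n j T t ms d sels [::] -> all (valid n k j) sels -> all (listed G) T -> set_homogeneous t G
    ->
  set_homogeneous j G.
Proof.
move=> ut kn srch /allP_In val TG homt A B cA cB.
pose X : {set {set 'I_n}} := [set g @: A | g : 'S_n in G].
have stX : stable_family G X by apply: stable_family_orbit.
case: (boolP (B \in X)) => [/imsetP[g gG ->]|BX]; first by exists g.
have AX : A \in X by apply/imsetP; exists 1%g; rewrite ?group1 //;
  rewrite -[LHS]imset_id; apply: eq_imset => i; rewrite perm1.
have hit s : List.In s sels -> hits j G s by move/val; apply: hits_valid.
have prX : nontrivial_family j X by split; [exists A | exists B; rewrite ?in_setC].
by have [Y _] := searchP TG hit homt srch stX prX.
Qed.

Lemma set_homogeneous_conjV (n t : nat) (G : {group 'S_n}) (s : 'S_n) :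
  set_homogeneous t (G :^ s)%g -> set_homogeneous t G.
Proof. by move/(@set_homogeneous_conj _ (G :^ s)%G s^-1%g); rewrite /= conjsgK. Qed.

Lemma ut_search_conj (n k j : nat) (G : {group 'S_n}) (s : 'S_n) T t ms d sels :
  universal_transversal k G -> k <= n ->
  search n j T t ms d sels [::] -> all (valid n k j) sels -> all (listed (G :^ s)%g) T ->
    set_homogeneous t G ->
  set_homogeneous j G.
Proof.
move=> /(universal_transversal_conj s) ut kn srch val TG /(set_homogeneous_conj s) hom.
apply: (@set_homogeneous_conjV _ _ _ s).
exact: (@ut_search n k j (G :^ s)%G T t ms d sels).
Qed.

Section Subgroups.
Variables (n : nat) (G : {group 'S_n}).

Lemma bin_dvd_order (t : nat) : t <= n -> set_homogeneous t G -> 'C(n, t) %| #|G|.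
Proof.
move=> tn /(homogeneousP G tn) /atrans_dvd; congr (is_true (_ %| _)).
have := cards_draws [set: 'I_n] t; rewrite cardsT card_ord => <-.
by apply: eq_card => A; rewrite !inE subsetT.
Qed.

Lemma set_homogeneous1P : set_homogeneous 1 G ->
  forall x, orbit 'P G x = [set: 'I_n].
Proof.
move=> hom x; apply/setP=> y; rewrite inE; apply/orbitP.
have [g gG] := hom [set x] [set y] (cards1 x) (cards1 y).
by rewrite imset_set1 => /set1_inj e; exists g.
Qed.

Lemma prime_cycles_in (p : nat) : prime p -> p %| #|G| -> exists (s : 'S_n) (m : nat),
  [/\ 0 < m, p * m <= n & all (listed (G :^ s)%g) (cycles n p m)].
Proof.
move=> p_pr dv; have [c cG oc] := Cauchy p_pr dv.
have cp : (c ^+ p = 1)%g by rewrite -oc expg_order.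
have c1 : c != 1%g by rewrite -order_gt1 oc prime_gt1.
have [m [L [m0 pm uL sL H]]] := prime_cycles p_pr cp c1.
have [s sP] := standard_labelling G uL sL; exists s, m; split=> //.
have cL : listed (G :^ s)%g (cycle_list n p m) by apply: (sP c); rewrite ?size_cycle_list.
by apply/allP => _ /mapP[i _ ->]; apply: listed_pow.
Qed.

(** A central involution of a transitive 2-group has no fixed point, so on 8 points it consists of 4
    transpositions; with fewer of them the label 7 would be fixed. *)
Lemma involution_in : n = 8 -> set_homogeneous 1 G ->
  exists s : 'S_n, all (listed (G :^ s)%g) (cycles n 2 4).
Proof.
move=> n8 hom; have x0 : 'I_n by rewrite n8; apply: ord0.
have cW : #|[set: 'I_n]| = 2 ^ 3 by rewrite cardsT card_ord n8.
have fixW (h : 'S_n) (x : 'I_n) : h \in G -> x \notin [set: 'I_n] -> h x = x.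
  by rewrite inE.
have [P [sPG pP _ [z zZ [oz movz]]]] :=
  transitive_pgroup (isT : prime 2) (isT : 0 < 3) cW (set_homogeneous1P hom x0) fixW.
have zG : z \in G by apply: (subsetP sPG); case/centerP: zZ.
have z2 : (z ^+ 2 = 1)%g by rewrite -oz expg_order.
have z1 : z != 1%g by rewrite -order_gt1 oz.
have [m [L [m0 pm uL sL H]]] := prime_cycles (isT : prime 2) z2 z1.
have m4 : m = 4.
  apply/eqP; rewrite eqn_leq; apply/andP; split; first by lia.
  rewrite leqNgt; apply/negP => ltm.
  have lt7 : 7 < n by rewrite n8.
  have [_ /(_ x0)] := H 7 lt7; rewrite nth_cycle_list // ifN; last by lia.
  by move/eqP; apply/negP; apply: movz; rewrite inE.
have [s sP] := standard_labelling G uL sL; exists s; rewrite m4 in H.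
have cL : listed (G :^ s)%g (cycle_list n 2 4) by apply: (sP z); rewrite ?size_cycle_list.
by apply/allP => _ /mapP[i _ ->]; apply: listed_pow.
Qed.

Lemma nine_in_nine : n = 9 -> set_homogeneous 1 G -> exists s : 'S_n,
  all (listed (G :^ s)%g) (C9 n) \/ all (listed (G :^ s)%g) (E9 n).
Proof.
move=> n9 hom; have x0 : 'I_n by rewrite n9; apply: ord0.
apply: (@regular_nine _ _ [set: 'I_n] x0); first by rewrite cardsT card_ord.
  exact: set_homogeneous1P.
by move=> h x; rewrite inE.
Qed.

(** For distinct x, y and a third point z, a map of {x, z} onto {x, y} takes x to y, or else z to y;
    a map of {x, y} onto {z, y} takes x to y, or else x to z. In the remaining case their composite
    takes x to y. *)
Lemma set_homogeneous_21 : 2 < n -> set_homogeneous 2 G -> set_homogeneous 1 G.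
Proof.
move=> n3 hom A B /eqP/cards1P[x ->] /eqP/cards1P[y ->].
suff [g gG e] : exists2 g : 'S_n, g \in G & g x = y by exists g; rewrite // imset_set1 e.
have pair (u v u' v' : 'I_n) : u != v -> u' != v' ->
    exists2 g : 'S_n, g \in G & (g u = u' /\ g v = v') \/ (g u = v' /\ g v = u').
  move=> uv uv'; have [||g gG] := hom [set u; v] [set u'; v']; rewrite ?cards2 ?uv ?uv' //.
  rewrite imsetU !imset_set1 => e; exists g => //.
  have := uv; rewrite -(inj_eq (@perm_inj _ g)).
  move: (set21 (g u) (g v)) (set22 (g u) (g v)); rewrite e !inE.
  by case/orP=> /eqP-> /orP[]/eqP->; rewrite ?eqxx //; auto.
have [z] : exists z, z \notin [set x; y].
  have /subsetPn[z _ zB] : ~~ ([set: 'I_n] \subset [set x; y]).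
    apply/negP => /subset_leq_card; rewrite cardsT card_ord cards2.
    by case: (x != y) => /=; lia.
  by exists z.
rewrite !inE negb_or => /andP[zx zy]; case: (eqVneq x y) => [->|xy].
  by exists 1%g; rewrite ?perm1 ?group1.
have xz : x != z by rewrite eq_sym.
have [g gG [[gx gz]|[gx _]]] := pair x z x y xz xy; last by exists g.
have [h hG [[hx _]|[hx _]]] := pair x y z y xy zy; last by exists h.
by exists (h * g)%g; rewrite ?groupM // permM hx.
Qed.

(** The order of [G] is divisible by 10, so an involution swaps some pair, and its conjugates flip
    every pair. Hence [G] is 2-transitive, and [regular_nine] applies to the stabiliser of [w0] on
    the other nine points. *)
Lemma ten_in_ten : n = 10 -> set_homogeneous 2 G -> exists s : 'S_n,
  all (listed (G :^ s)%g) (C9 n) \/ all (listed (G :^ s)%g) (E9 n).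
Proof.
move=> n10 hom; have hom1 : set_homogeneous 1 G by apply: set_homogeneous_21; rewrite ?n10.
have w0 : 'I_n by rewrite n10; apply: ord0.
have [x0 xw] : exists x0, x0 != w0.
  have /subsetPn[x _ xB] : ~~ ([set: 'I_n] \subset [set w0]).
    by apply/negP => /subset_leq_card; rewrite cardsT card_ord cards1 n10.
  by exists x; rewrite inE in xB.
have cW : #|[set~ w0]| = 9 by rewrite cardsC1 card_ord n10.
have even : 2 %| #|G|.
  by apply: dvdn_trans (bin_dvd_order _ hom1); rewrite ?bin1 n10.
have [u uG ou] := Cauchy (isT : prime 2) even.
have [a ua] : exists a, u a != a.
  apply/existsP; rewrite -negb_forall; apply/negP => /forallP all1.
  have u1 : u = 1%g by apply/permP => i; rewrite perm1; move/eqP: (all1 i); apply.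
  by rewrite u1 order1 in ou.
have uu : u (u a) = a by rewrite -permM -[(u * u)%g]/(u ^+ 2)%g -ou expg_order perm1.
have flip x : x != w0 -> exists2 t : 'S_n, t \in G & t w0 = x /\ t x = w0.
  move=> xw0; have [||h hG] := hom [set w0; x] [set a; u a].
  - by rewrite cards2 eq_sym xw0.
  - by rewrite cards2 eq_sym ua.
  rewrite imsetU !imset_set1 => e; exists (h * u * h^-1)%g; first by rewrite !groupM ?groupV.
  have neq : h w0 != h x by rewrite (inj_eq perm_inj) eq_sym.
  move: neq (set21 (h w0) (h x)) (set22 (h w0) (h x)); rewrite e !inE !permM.
  move=> + /orP[]/eqP e1 /orP[]/eqP e2; rewrite e1 e2 ?eqxx ?uu // => _.
    by rewrite -{1}e2 -e1 !permK.
  by rewrite -{1}e1 -e2 !permK.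
have [||s sP] := @regular_nine n ('C_G[w0 | 'P])%G [set~ w0] x0 cW.
- apply/setP=> y; rewrite !inE; apply/orbitP/idP => [[g]|yw].
    rewrite inE => /andP[_ /astab1P /= gw] <-; rewrite /= /aperm in gw *.
    by rewrite -gw (inj_eq perm_inj).
  have [||g gG] := hom [set w0; x0] [set w0; y]; rewrite ?cards2 1?eq_sym ?xw ?yw //.
  rewrite imsetU !imset_set1 => e.
  suff [k kG [kw kx]] : exists2 k : 'S_n, k \in G & k w0 = w0 /\ k x0 = y.
    by exists k => //; rewrite inE kG; apply/astab1P.
  have neq : g w0 != g x0 by rewrite (inj_eq perm_inj) eq_sym.
  move: neq (set21 (g w0) (g x0)) (set22 (g w0) (g x0)); rewrite e !inE.
  move=> + /orP[]/eqP e1 /orP[]/eqP e2; rewrite e1 e2 ?eqxx // => _; first by exists g.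
  have [t tG [tw tx]] := flip x0 xw; exists (t * g)%g; rewrite ?groupM // !permM tw tx.
  by rewrite e1 e2.
- move=> h x; rewrite inE => /andP[_ /astab1P /= hw]; rewrite !inE negbK => /eqP ->.
  exact: hw.
exists s; have sub q : listed (('C_G[w0 | 'P])%G :^ s)%g q -> listed (G :^ s)%g q.
  case/listedP=> g gC <-; rewrite listed_images; apply: subsetP gC.
  by rewrite conjSg subsetIl.
by case: sP => H; [left|right]; apply: sub_all H.
Qed.

End Subgroups.

Lemma set_homogeneous_or (n k j : nat) (G : {group 'S_n}) T t ms d sels sv :
  universal_transversal k G -> k <= n ->
  search n j T t ms d sels sv -> all (valid n k j) sels -> all (listed G) T -> set_homogeneous t G
    ->
  set_homogeneous j G \/ exists X : {set {set 'I_n}},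
    [/\ stable_family G X, nontrivial_family j X & values j T X \in sv].
Proof.
move=> ut kn srch /allP_In val TG homt.
have hit s : List.In s sels -> hits j G s by move/val; apply: hits_valid.
case: (boolP [exists A : {set 'I_n}, exists B : {set 'I_n},
    [&& #|A| == j, #|B| == j & B \notin [set g @: A | g : 'S_n in G]]]).
  case/existsP=> A /existsP[B /and3P[/eqP cA /eqP cB BX]]; right.
  pose X : {set {set 'I_n}} := [set g @: A | g : 'S_n in G].
  have stX : stable_family G X by apply: stable_family_orbit.
  have AX : A \in X by apply/imsetP; exists 1%g; rewrite ?group1 //;
    rewrite -[LHS]imset_id; apply: eq_imset => i; rewrite perm1.
  have ntX : nontrivial_family j X by split; [exists A | exists B; rewrite ?in_setC].
  have [Y [->|->] Ysv] := searchP TG hit homt srch stX ntX; first by exists X.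
  exists (~: X); split=> //; first exact: stable_familyC.
  by case: ntX => ? ?; split; rewrite ?setCK.
rewrite negb_exists => /forallP all; left=> A B cA cB.
have := all A; rewrite negb_exists => /forallP/(_ B).
by rewrite cA cB !eqxx /= negbK => /imsetP[g gG ->]; exists g.
Qed.

(** * From a family of j-sets to families of (j+1)-sets *)

Section Shadow.
Variables (n j : nat) (T : seq (seq nat)).

Definition shadow_count (f : bitseq -> bool) (b : bitseq) : nat :=
  count (fun i => nth false b i && f (set_nth false b i false)) (iota 0 n).

Definition shadow_misses (w : bitseq) (v : nat) (a : bitseq) : bool :=
  let rs := reps n j T in
  let tb := tabulate n j (fun b => index (canon T b) rs) in
  let vals := [seq (b, shadow_count (fun c => nth false w (get 0 tb c)) b)
                 | b <- subsets n j.+1] in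
  has (fun p => p.2 == v) vals && all (fun p => subb p.1 a ==> (p.2 != v)) vals.

Definition shadow (X : {set {set 'I_n}}) (A : {set 'I_n}) : nat :=
  #|[set a in A | A :\ a \in X]|.

(** [shadow X] is an invariant function, so its level set at [v] is a stable family; it contains a
    (j+1)-set but none inside [a]. *)
Lemma shadow_misses_contra (G : {group 'S_n}) X v a :
  all (listed G) T -> stable_family G X -> hits j.+1 G (Within a) ->
  shadow_misses (values j T X) v a -> False.
Proof.
move=> TG stX hit; rewrite /shadow_misses; set tb := tabulate _ _ _ => /andP[ex mis].
have shE b : b \in subsets n j.+1 ->
    shadow_count (fun c => nth false (values j T X) (get 0 tb c)) b = shadow X (setb n b).
  rewrite mem_subsets => /andP[/eqP sb /eqP cb].
  rewrite /shadow_count /shadow -count_bits -val_enum_ord /bits !count_map.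
  apply: eq_count => i /=; rewrite !inE; case bi: (nth false b i) => //=.
  have sE : setb n (set_nth false b i false) = setb n b :\ i.
    by apply/setP=> y; rewrite !inE nth_set_nth /= -val_eqE /=; case: eqP.
  have ss : size (set_nth false b i false) = n by rewrite size_set_nth sb (maxn_idPr _).
  rewrite (nth_values TG stX) ?sE // mem_subsets ss eqxx -(card_setb ss) sE.
  have := cardsD1 i (setb n b); rewrite card_setb // cb inE bi => -[->].
  exact: eqxx.
have stY : stable_family G [set A | shadow X A == v].
  move=> g A gG; rewrite !inE; congr (_ == v); rewrite /shadow.
  rewrite -(card_preperm g [set a in A | A :\ a \in X]); apply: eq_card => x.
  rewrite !inE -(stX g (A :\ g x) gG); congr (_ && (_ \in X)).
  by apply/setP=> y; rewrite !inE (inj_eq perm_inj).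
case/hasP: ex => _ /mapP[b bs ->] /= /eqP eb.
have [|c cs /andP[/= sub]] := hit _ stY.
  by exists (setb n b); rewrite ?inE -?shE ?eb // (card_setb_subsets bs).
rewrite inE -shE // => ev; move/allP: mis => /(_ (c, _) (map_f _ cs)) /=.
by rewrite sub ev.
Qed.

End Shadow.

(** * Identification of a group from an invariant family *)

(** Unlike [pull], this makes sense when [q] is only a prefix of a permutation and [b] has no point
    beyond it, as in [extensions]. *)
Definition push (n : nat) (q : seq nat) (b : bitseq) : bitseq :=
  foldr (fun y acc => set_nth false acc y true) (nseq n false) (mask b q).

(** Images of 0, 1, 2, ... are chosen in turn, and a set is compared with its image as soon as its
    largest point has one; therefore the sets are grouped by largest point. *)
Fixpoint extensions (n : nat) (tb : trie bool) (allow : nat -> nat -> bool)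
    (levels : seq (seq bitseq)) (p : seq nat) : seq (seq nat) :=
  if levels is bs :: levels' then
    flatten [seq (let p' := rcons p j in
                  if [&& j \notin p, allow (size p) j &
                      all (fun b => get false tb (push n p' b) == get false tb b) bs]
                  then extensions n tb allow levels' p' else [::]) | j <- iota 0 n]
  else [:: p].

Definition max_level (n k i : nat) : seq bitseq :=
  [seq b <- subsets n k | nth false b i && ~~ has id (drop i.+1 b)].

Definition levels (n k : nat) : seq (seq bitseq) := [seq max_level n k i | i <- iota 0 n].

Fixpoint bfs (A : eqType) (f : seq nat -> A -> A) (gens : seq (seq nat)) (fuel : nat)
    (todo seen : seq A) : seq A :=
  match fuel, todo with
  | fuel'.+1, x :: todo' =>
    let new := [seq y <- undup [seq f q x | q <- gens] | y \notin seen] in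
    bfs f gens fuel' (todo' ++ new) (seen ++ new)
  | _, _ => seen
  end.

Definition word (gens : seq (seq nat)) (n : nat) (w : seq nat) : seq nat :=
  foldl (fun p i => lmul p (nth [::] gens i)) (iota 0 n) w.

Lemma nth_foldr_set (n : nat) (l : seq nat) (y : nat) :
  nth false (foldr (fun z acc => set_nth false acc z true) (nseq n false) l) y = (y \in l).
Proof.
elim: l => [|z l IH] /=; first by rewrite nth_nseq if_same.
by rewrite nth_set_nth /= IH inE; case: eqP.
Qed.

Lemma size_push (n : nat) (q : seq nat) (b : bitseq) :
  all (fun y => y < n) q -> size (push n q b) = n.
Proof.
move=> H; rewrite /push; have : all (fun y => y < n) (mask b q).
  by apply/allP => y /mem_mask; apply: (allP H).
elim: (mask b q) => [|z l IH] /=; first by rewrite size_nseq.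
by case/andP=> ltz /IH s; rewrite size_set_nth s (maxn_idPr ltz).
Qed.

Section Images.
Variable n : nat.
Implicit Types (g : 'S_n) (b : bitseq).

Lemma images_lt g : all (fun y => y < n) (images g).
Proof. by apply/allP => _ /mapP[i _ ->]; apply: ltn_ord. Qed.

Lemma push_images g b : size b = n -> setb n (push n (images g) b) = g @: setb n b.
Proof.
move=> sb; apply/setP=> y; rewrite inE nth_foldr_set.
have -> : mask b (images g) = [seq val (g i) | i <- enum (setb n b)].
  rewrite -[in LHS](setbK sb) /images -map_mask -filter_mask; congr map.
  by rewrite enumT; apply: eq_filter.
apply/mapP/imsetP => -[x xb e]; exists x; rewrite ?mem_enum // in xb *.
  exact: val_inj.
by rewrite e.
Qed.

Lemma push_bits g b : size b = n -> push n (images g) b = bits (g @: setb n b).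
Proof. by move=> sb; rewrite -push_images // setbK // size_push // images_lt. Qed.

Lemma images_exists (p : seq nat) : size p = n -> uniq p -> all (fun y => y < n) p ->
  exists g : 'S_n, images g = p.
Proof.
move=> sp up /allP ltp.
have lt (i : 'I_n) : nth 0 p i < n by apply: ltp; rewrite mem_nth ?sp.
have inj : injective (fun i : 'I_n => Ordinal (lt i)).
  by move=> i j [/eqP]; rewrite nth_uniq ?sp // => /eqP/val_inj.
exists (perm inj); apply: (@eq_from_nth _ 0); rewrite size_images // => i lin.
by rewrite (nth_images 0 _ (Ordinal lin)) permE.
Qed.

Definition gen_group (N : seq (seq nat)) : {group 'S_n} :=
  <<[set g : 'S_n | images g \in N]>>%G.

Lemma gen_group_listed N q : q \in N -> size q = n -> uniq q ->
  all (fun y => y < n) q -> listed (gen_group N) q.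
Proof.
move=> qN sq uq ltq; have [g gq] := images_exists sq uq ltq.
by apply/listedP; exists g => //; apply: mem_gen; rewrite inE gq.
Qed.

Lemma gen_groupS (G : {group 'S_n}) N : all (listed G) N -> gen_group N \subset G.
Proof.
move=> /allP NG; rewrite gen_subG; apply/subsetP => g; rewrite inE => /NG.
by rewrite listed_images.
Qed.

Lemma listed_word (G : {group 'S_n}) gens w :
  all (fun i => i < size gens) w -> all (listed G) gens -> listed G (word gens n w).
Proof.
move=> ltw /allP Gg; rewrite /word; move: (listed1 G); move: (iota 0 n) => p.
elim: w p ltw => //= i w IH p /andP[lti ltw] Gp; apply: IH => //.
by apply: listed_lmul => //; apply/Gg/mem_nth.
Qed.

Definition preserves (k : nat) (tb : trie bool) (g : 'S_n) : Prop :=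
  forall b, b \in subsets n k -> get false tb (push n (images g) b) = get false tb b.

Lemma preservesM k tb g h : preserves k tb g -> preserves k tb h -> preserves k tb (g * h)%g.
Proof.
move=> pg ph b bs; have sb : size b = n by move: bs; rewrite mem_subsets => /andP[/eqP].
rewrite -(pg b bs) -(ph (push n (images g) b)).
  by rewrite !push_bits ?size_bits // bitsK imset_mul.
by rewrite push_bits // bits_subsets card_imperm (card_setb_subsets bs).
Qed.

Lemma extensionsP k tb (allow : nat -> nat -> bool) g m d : preserves k tb g -> m + d <= n ->
  (forall i : 'I_n, allow i (g i)) ->
  take (m + d) (images g) \in
    extensions n tb allow (take d (drop m (levels n k))) (take m (images g)).
Proof.
move=> pg + al; elim: d m => [|d IH] m led; first by rewrite addn0 take0 /= inE.
have ltm : m < n by lia.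
rewrite (drop_nth [::]) ?size_map ?size_iota //= (nth_map 0) ?size_iota // nth_iota // add0n.
have smi : m < size (images g) by rewrite size_images.
apply/flattenP; eexists; first apply: map_f.
  have : nth 0 (images g) m \in iota 0 n.
    by rewrite mem_iota /= add0n (nth_images 0 g (Ordinal ltm)).
  by apply.
rewrite -take_nth // size_take smi ifT; first by rewrite addnS -addSn; apply: IH; lia.
apply/and3P; split.
- rewrite -[X in X \notin _](nth_take 0 (ltnSn m)).
  have : uniq (images g) by rewrite map_inj_uniq ?enum_uniq // => ? ? /val_inj/perm_inj.
  by move/(take_uniq m.+1); rewrite (take_nth 0) // rcons_uniq nth_rcons size_take smi ltnn eqxx =>
    /andP[].
- by rewrite (nth_images 0 g (Ordinal ltm)); apply: (al (Ordinal ltm)).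
apply/allP => b; rewrite mem_filter => /andP[/andP[_ nod] bs].
rewrite -(pg b bs) /push; apply/eqP; congr (get _ _ (foldr _ _ _)).
have sb : size b = n by move: bs; rewrite mem_subsets => /andP[/eqP].
rewrite -(cat_take_drop m.+1 b) -{2}(cat_take_drop m.+1 (images g)).
rewrite -{1}[take m.+1 (images g)]cats0 !mask_cat ?size_take ?size_images ?sb //.
have no t : mask (drop m.+1 b) t = [::].
  apply/nilP; rewrite /nilp; elim: (drop _ b) nod t => [|[] c IHc] //= nod [|x t] //=.
  exact: IHc.
by rewrite !no.
Qed.

(** One direction suffices: all that is found is reachable. Too little fuel makes the result
    smaller, and the checks that rely on it then fail. *)
Lemma bfsP (A : eqType) (f : seq nat -> A -> A) (P : A -> Prop) gens fuel todo seen :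
  (forall q x, q \in gens -> P x -> P (f q x)) ->
  (forall x, x \in todo -> P x) -> (forall x, x \in seen -> P x) ->
  forall x, x \in bfs f gens fuel todo seen -> P x.
Proof.
move=> step; elim: fuel todo seen => [|fuel IH] [|y todo] seen //= Ptodo Pseen.
set new := [seq _ <- _ | _].
have Pnew x : x \in new -> P x.
  rewrite mem_filter mem_undup => /andP[_ /mapP[q qg ->]].
  by apply: step => //; apply: Ptodo; rewrite mem_head.
apply: IH => x; rewrite mem_cat => /orP[]; [|exact: Pnew|exact: Pseen|exact: Pnew].
by move=> xt; apply: Ptodo; rewrite inE xt orbT.
Qed.

End Images.

Section Automorphisms.
Variables (n k : nat) (tb : trie bool).
Implicit Types (g h : 'S_n).

Definition fixes_table (q : seq nat) : bool :=
  all (fun b => get false tb (push n q b) == get false tb b) (subsets n k).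

Definition aut_set : {set 'S_n} := [set g | fixes_table (images g)].

Lemma aut_setP g : reflect (preserves k tb g) (g \in aut_set).
Proof. by rewrite inE; apply: (iffP allP) => H b bs; apply/eqP/H. Qed.

Lemma group_set_aut : group_set aut_set.
Proof.
apply/group_setP; split; last first.
  by move=> g h /aut_setP pg /aut_setP ph; apply/aut_setP/preservesM.
apply/aut_setP => b; rewrite mem_subsets => /andP[/eqP sb _]; congr get.
rewrite push_bits // -[RHS](setbK sb); congr bits; rewrite -[RHS]imset_id.
by apply: eq_imset => x; rewrite perm1.
Qed.

Canonical aut_group := Group group_set_aut.

Definition perm_list (q : seq nat) : bool :=
  [&& size q == n, uniq q & all (fun y => y < n) q].

Lemma gen_group_perm_list N q : q \in N -> perm_list q -> listed (gen_group n N) q.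
Proof. by move=> qN /and3P[/eqP sq uq ltq]; apply: gen_group_listed. Qed.

(* Every automorphism agrees on the first b points with an element generated by N,
   and F contains the automorphisms that fix these points. *)
Definition upper_check (N F : seq (seq nat)) (b fuel : nat) : bool :=
  let reach := bfs (fun q t => lmul t q) N fuel [:: iota 0 b] [:: iota 0 b] in
  [&& b <= n, all perm_list N, all fixes_table N,
      all (fun p => p \in reach)
          (extensions n tb (fun _ _ => true) (take b (levels n k)) [::]) &
      all (fun p => p \in F)
          (extensions n tb (fun i j => (i < b) ==> (j == i)) (levels n k) [::])].

Lemma gen_group_aut N : all fixes_table N -> gen_group n N \subset aut_group.
Proof.
move/allP=> fixN; rewrite gen_subG; apply/subsetP => g; rewrite !inE; exact: fixN.
Qed.

Lemma take_images (b : nat) g : b <= n -> take b (images g) = lmul (iota 0 b) (images g).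
Proof.
move=> lebn; have sb : size (take b (images g)) = b by rewrite size_takel ?size_images.
apply: (@eq_from_nth _ 0); first by rewrite sb size_map size_iota.
by rewrite sb => i ltib; rewrite nth_take // (nth_map 0) ?size_iota // nth_iota.
Qed.

(** The prefix of [g] is among those reached, so some [w] generated by [N] agrees with [g] on the
    first [b] points. Then [g * w^-1] fixes these points and is found in [F]. *)
Lemma upper_bound N F b fuel g : upper_check N F b fuel -> g \in aut_group ->
  exists2 u, u \in aut_group /\ images u \in F & exists2 w, w \in gen_group n N & g = (u * w)%g.
Proof.
case/and5P=> lebn /allP permN fixN /allP reachP /allP FP gA.
have /reachP : take b (images g) \in extensions n tb (fun _ _ => true) (take b (levels n k)) [::].
  have := @extensionsP n k tb (fun _ _ => true) g 0 b (elimT (aut_setP g) gA).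
  by rewrite add0n drop0 take0; apply.
have step q t : q \in N ->
    (exists2 w, w \in gen_group n N & t = lmul (iota 0 b) (images w)) ->
    exists2 w, w \in gen_group n N & lmul t q = lmul (iota 0 b) (images w).
  move=> qN [w wN ->]; have /listedP[h hN <-] := gen_group_perm_list qN (permN q qN).
  exists (w * h)%g; first by rewrite groupM.
  rewrite -lmul_images /lmul -map_comp; apply/eq_in_map => i; rewrite mem_iota add0n /= => ltib.
  by rewrite (nth_map 0) // size_images (leq_trans ltib).
have init x : x \in [:: iota 0 b] ->
    exists2 w, w \in gen_group n N & x = lmul (iota 0 b) (images w).
  rewrite inE => /eqP->; exists 1%g; rewrite ?group1 // images1 /lmul.
  rewrite -[LHS]map_id; apply/eq_in_map => i; rewrite mem_iota add0n /= => ltib.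
  by rewrite nth_iota // (leq_trans ltib).
case/(bfsP step init init) => w wN; rewrite take_images // => e.
have wA : w \in aut_group := subsetP (gen_group_aut fixN) w wN.
have uA : (g * w^-1)%g \in aut_group by rewrite groupM ?groupV.
exists (g * w^-1)%g; last by exists w; rewrite // mulgKV.
split=> //; apply: FP.
have := @extensionsP n k tb (fun i j => (i < b) ==> (j == i)) _ 0 n (elimT (aut_setP _) uA).
rewrite add0n drop0 take0 !take_oversize ?size_images ?size_map ?size_iota //; apply=> // i.
apply/implyP => ltib; rewrite permM.
have : nth 0 (lmul (iota 0 b) (images g)) i = nth 0 (lmul (iota 0 b) (images w)) i by rewrite e.
rewrite !(nth_map 0) ?size_iota // nth_iota // add0n !nth_images => /val_inj ->.
by rewrite permK.
Qed.

(** Every automorphism is [w] or [s * w] with [w] generated by [N], hence in [G]; so [G] is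
    determined by whether it contains [s]. *)
Lemma between N s b fuel (G : {group 'S_n}) : perm_list s ->
  upper_check N [:: iota 0 n; s] b fuel ->
  all (listed G) N -> G \subset aut_group ->
  G = gen_group n N :> {set 'S_n} \/ G = gen_group n (s :: N) :> {set 'S_n}.
Proof.
move=> ps chk NG GA; have sub := gen_groupS NG.
have factor g : g \in G -> g \in gen_group n N \/ listed G s /\ g \in gen_group n (s :: N).
  move=> gG; have [u [_ uF] [w wN e]] := upper_bound chk (subsetP GA g gG).
  move: uF; rewrite !inE => /orP[]/eqP es.
    by left; rewrite e (_ : u = 1%g) ?mul1g //; apply: images_inj; rewrite images1.
  have uG : u \in G.
    by rewrite -(groupMr _ (subsetP sub w wN)) -e.
  right; rewrite -es listed_images uG e; split=> //; apply: groupM.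
    by apply: mem_gen; rewrite inE es mem_head.
  apply: subsetP wN; apply: genS; apply/subsetP => x; rewrite !inE => ->.
  exact: orbT.
case: (boolP (listed G s)) => Gs.
  right; apply/eqP; rewrite eqEsubset gen_groupS /= ?Gs // andbT; apply/subsetP => g gG.
  case: (factor g gG) => [|[]//]; apply: subsetP; apply: genS; apply/subsetP => x.
  by rewrite !inE => ->; rewrite orbT.
left; apply/eqP; rewrite eqEsubset sub andbT; apply/subsetP => g gG.
by case: (factor g gG) => // -[H]; rewrite H in Gs.
Qed.

Lemma between1 N b fuel (G : {group 'S_n}) :
  upper_check N [:: iota 0 n] b fuel ->
  all (listed G) N -> G \subset aut_group -> G = gen_group n N :> {set 'S_n}.
Proof.
move=> chk NG GA; have sub := gen_groupS NG.
apply/eqP; rewrite eqEsubset sub andbT; apply/subsetP => g gG.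
have [u [_ uF] [w wN e]] := upper_bound chk (subsetP GA g gG).
move: uF; rewrite inE e => /eqP es.
by rewrite (_ : u = 1%g) ?mul1g //; apply: images_inj; rewrite es images1.
Qed.

End Automorphisms.

Section Identify.
Variables (n k : nat) (T : seq (seq nat)) (G : {group 'S_n}).

Definition table (w : bitseq) : trie bool :=
  let rs := reps n k T in tabulate n k (fun b => nth false w (index (canon T b) rs)).

Lemma get_table X b : all (listed G) T -> stable_family G X -> b \in subsets n k ->
  get false (table (values k T X)) b = (setb n b \in X).
Proof.
by move=> TG stX bs; rewrite get_tabulate // -(nth_values TG stX bs) get_tabulate.
Qed.

Lemma stable_sub_aut X : all (listed G) T -> stable_family G X ->
  G \subset aut_group n k (table (values k T X)).
Proof.
move=> TG stX; apply/subsetP => g gG; apply/aut_setP => b bs.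
have sb : size b = n by move: (bs); rewrite mem_subsets => /andP[/eqP].
have bs' : push n (images g) b \in subsets n k.
  by rewrite push_bits // bits_subsets card_imperm (card_setb_subsets bs).
by rewrite !get_table // push_images // (stable_family_imset _ stX gG).
Qed.

(** If the orbit [Y] of [A] missed a k-set of [X], it would be a nontrivial stable family, so [Y] or
    its complement would be a survivor, and [Y] would lie properly below [X]. The condition on [sv]
    forbids this. *)
Lemma survivor_transitive t ms d sels sv X :
  universal_transversal k G -> k <= n -> all (valid n k k) sels ->
  search n k T t ms d sels sv -> all (listed G) T -> set_homogeneous t G ->
  all (fun w => (subb w (values k T X) ==> (w == values k T X)) &&
     (subb (map negb w) (values k T X) ==> (map negb w == values k T X))) sv ->
  stable_family G X -> nontrivial_family k X ->
  forall A B : {set 'I_n}, A \in X -> B \in X -> #|A| = k -> #|B| = k ->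
  exists2 g : 'S_n, g \in G & g @: A = B.
Proof.
move=> ut kn /allP_In val srch TG homt /allP single stX [_ [C CX cC]] A B AX BX cA cB.
pose Y : {set {set 'I_n}} := [set g @: A | g : 'S_n in G].
have stY : stable_family G Y by apply: stable_family_orbit.
case: (boolP (B \in Y)) => [/imsetP[g gG ->]|BY]; first by exists g.
have AY : A \in Y by apply/imsetP; exists 1%g; rewrite ?group1 //;
  rewrite -[LHS]imset_id; apply: eq_imset => i; rewrite perm1.
have YX : Y \subset X.
  by apply/subsetP => _ /imsetP[g gG ->]; rewrite (stable_family_imset A stX gG).
have hit s : List.In s sels -> hits k G s by move/val; apply: hits_valid.
have ntY : nontrivial_family k Y by split; [exists A | exists B; rewrite ?in_setC].
have subv : subb (values k T Y) (values k T X).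
  rewrite /subb /values; elim: (reps _ _ _) => //= r l ->; rewrite andbT.
  by apply/implyP/subsetP.
suff : values k T Y == values k T X.
  move/eqP=> e; have bB : bits B \in subsets n k by rewrite bits_subsets cB.
  have := nth_values TG stX bB; rewrite -e (nth_values TG stY bB) !bitsK BX.
  by rewrite (negbTE BY).
have [Z YZ Zsv] := searchP TG hit homt srch stY ntY.
case: YZ Zsv => -> /single/andP[H1 H2]; first exact: (implyP H1).
have e : map negb (values k T (~: Y)) = values k T Y.
  by rewrite /values -map_comp; apply: eq_map => r /=; rewrite in_setC negbK.
by move: H2; rewrite e subv.
Qed.

Definition carries (I J : bitseq) (i j : nat) : bool := nth false I i == nth false J j.

Definition candidates (tb : trie bool) (p : bitseq * bitseq) : seq (seq nat) :=
  extensions n tb (carries p.1 p.2) (levels n k) [::].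

Lemma candidatesP tb I J (g : 'S_n) : g \in aut_group n k tb ->
  g @: setb n I = setb n J -> images g \in candidates tb (I, J).
Proof.
move=> gA e.
have := @extensionsP n k tb (carries I J) g 0 n (elimT (aut_setP _ _ g) gA).
rewrite add0n drop0 take0 !take_oversize ?size_images ?size_map ?size_iota //.
apply=> // i; apply/eqP.
have := mem_imset (setb n I) i (@perm_inj _ g); rewrite e !inE => ->.
by [].
Qed.

Definition choices (A : Type) : seq (seq A) -> seq (seq A) :=
  foldr (fun c acc => [seq x :: y | x <- c, y <- acc]) [:: [::]].

(* The group contains one candidate for each pair of sets in ps, but it is unknown
   which one: words has an entry for each choice, and each entry has to produce N. *)
Definition lower_check (tb : trie bool) (gens : seq (seq nat)) (ps : seq (bitseq * bitseq))
    (words : seq (seq (seq nat))) (N : seq (seq nat)) : bool :=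
  let m := size gens + size ps in
  let cs := choices [seq candidates tb p | p <- ps] in
  (size cs == size words) &&
  all (fun c => all (all (fun i => i < m)) c.2 &&
         all (fun x => x \in [seq word (gens ++ c.1) n w | w <- c.2]) N)
      (zip cs words).

Lemma lower_bound tb gens ps words N : all (listed G) gens -> G \subset aut_group n k tb ->
  (forall p, p \in ps -> exists2 g : 'S_n, g \in G & g @: setb n p.1 = setb n p.2) ->
  lower_check tb gens ps words N -> all (listed G) N.
Proof.
move=> Gg GA ex /andP[/eqP sz /allP chk].
have [c cc [Gc sc]] : exists2 c, c \in choices [seq candidates tb p | p <- ps] &
    all (listed G) c /\ size c = size ps.
  elim: ps ex {sz chk} => [|[I J] ps IH] ex; first by exists [::].
  have [|c cc [Gc sc]] := IH; first by move=> p pps; apply: ex; rewrite inE pps orbT.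
  have [g gG e] := ex (I, J) (mem_head _ _).
  exists (images g :: c); last by rewrite /= listed_images gG Gc sc.
  by apply: allpairs_f => //; apply: candidatesP e; apply: subsetP gG.
have /(nthP [::])[i lti e] := cc.
have := chk (c, nth [::] words i); have -> : (c, nth [::] words i) =
    nth ([::], [::]) (zip (choices [seq candidates tb p | p <- ps]) words) i.
  by rewrite nth_zip // e.
rewrite mem_nth ?size_zip -?sz ?minnn // => /(_ isT); rewrite nth_zip // e.
case/andP=> /allP lt /allP inW; apply/allP => x /inW /mapP[w wW ->].
apply: listed_word; last by rewrite all_cat Gg Gc.
by have := lt w wW; rewrite size_cat sc.
Qed.

(** Minimality of [w0] among the invariant families, tested for both signs because survivors are
    recorded up to complement only. *)
Definition single (w0 : bitseq) (sv : seq bitseq) : bool :=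
  all (fun w => (subb w w0 ==> (w == w0)) && (subb (map negb w) w0 ==> (map negb w == w0))) sv.

(** The sets of a prescribed pair may both lie in [X] or both outside, provided that the family
    containing them is minimal: [G] is then transitive on its k-sets and some element carries one
    set to the other. *)
Theorem identify t ms d sels sv w0 gens ps words N X :
  universal_transversal k G -> k <= n -> all (valid n k k) sels ->
  search n k T t ms d sels sv -> all (listed G) T -> set_homogeneous t G ->
  stable_family G X -> nontrivial_family k X -> values k T X = w0 ->
  [&& all (fun q => q \in T) gens,
      all (fun p => [&& p.1 \in subsets n k, p.2 \in subsets n k,
             get false (table w0) p.1 == get false (table w0) p.2 &
             single (if get false (table w0) p.1 then w0 else map negb w0) sv]) ps &
      lower_check (table w0) gens ps words N] ->
  all (listed G) N /\ G \subset aut_group n k (table w0).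
Proof.
move=> ut kn val srch TG homt stX ntX <- /and3P[/allP gT /allP psP chk].
have GA := stable_sub_aut TG stX; split=> //.
apply: (lower_bound _ GA _ chk); first by apply/allP => q /gT; apply: (allP TG).
move=> [I J] /psP /= /and4P[Is Js /eqP]; rewrite !get_table // => eIJ sgl.
have [cI cJ] := (card_setb_subsets Is, card_setb_subsets Js).
case: ifP sgl => IX sgl.
  by apply: (survivor_transitive ut kn val srch TG homt sgl stX ntX); rewrite // -eIJ.
have stXC := stable_familyC stX.
have ntXC : nontrivial_family k (~: X).
  by case: ntX => ? ?; split; rewrite ?setCK.
have eXC : map negb (values k T X) = values k T (~: X).
  by rewrite /values -map_comp; apply: eq_map => r /=; rewrite in_setC.
rewrite eXC in sgl.
by apply: (survivor_transitive ut kn val srch TG homt sgl stXC ntXC); rewrite ?in_setC -?eIJ ?IX.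
Qed.

(** The third condition makes [p] normalise [T], so that the conjugate of the group by [p] still
    contains the elements listed in [T]. *)
Definition relabel_check (w w0 : bitseq) (p : seq nat) : bool :=
  let rs := reps n k T in
  [&& perm_list n p, all (perm_list n) T,
      all (fun q => has (fun q' => lmul q' p == lmul p q) T) T &
      [seq nth false w (index (canon T (pull p r)) rs) | r <- rs] == w0].

Lemma relabel w0 p X : all (listed G) T -> stable_family G X -> nontrivial_family k X ->
  relabel_check (values k T X) w0 p ->
  exists s : 'S_n, all (listed (G :^ s)%g) T /\ exists Y : {set {set 'I_n}},
    [/\ stable_family (G :^ s)%g Y, nontrivial_family k Y & values k T Y = w0].
Proof.
move=> TG stX ntX /and4P[pp /allP permT /allP normT /eqP vals].
have [s es] : exists s : 'S_n, images s = p.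
  by case/and3P: pp => /eqP sp up ltp; apply: images_exists.
subst p.
exists s; split.
  apply/allP => q qT; have /hasP[q' q'T /eqP e] := normT q qT.
  have /listedP[g gG eg] := allP TG q' q'T.
  have [h eh] : exists h : 'S_n, images h = q.
    by case/and3P: (permT q qT) => /eqP sq uq ltq; apply: images_exists.
  rewrite -eh listed_images; move: e; rewrite -eg -eh !lmul_images => /images_inj e.
  by rewrite (_ : h = g ^ s)%g ?memJ_conjg // conjgE e mulKg.
exists [set A : {set 'I_n} | s @^-1: A \in X]; split.
- move=> _ A /imsetP[g gG ->]; rewrite !inE -(stX g (s @^-1: A) gG); congr (_ \in X).
  by apply/setP=> x; rewrite !inE conjgE !permM permK.
- have tr (Z : {set {set 'I_n}}) : (exists2 A, A \in Z & #|A| = k) ->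
      exists2 A, A \in [set A : {set 'I_n} | s @^-1: A \in Z] & #|A| = k.
    by case=> A AZ cA; exists (s @: A); rewrite ?inE ?preim_imset ?card_imperm.
  case: ntX => /tr exX /tr exC; split=> //; case: exC => A.
  by rewrite !inE => AX cA; exists A; rewrite ?inE.
rewrite -vals; apply/eq_in_map => r rr; rewrite inE -pull_images.
have rs := reps_subsets TG rr; have ps : pull (images s) r \in subsets n k.
  rewrite mem_subsets size_pull eqxx /= -(card_setb (size_pull s r)) pull_images.
  by rewrite card_preperm (card_setb_subsets rs).
by rewrite -(nth_values TG stX ps) get_tabulate.
Qed.

End Identify.

Definition identify_check (n k : nat) (T : seq (seq nat)) (sv : seq bitseq) (w0 : bitseq)
    (relabels gens : seq (seq nat)) (ps : seq (bitseq * bitseq))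
    (words : seq (seq (seq nat))) (N : seq (seq nat)) : bool :=
  let tb := table n k T w0 in
  [&& all (fun w => has (fun p => relabel_check n k T w w0 p ||
                                  relabel_check n k T (map negb w) w0 p) relabels) sv,
      all (fun q => q \in T) gens &
      all (fun p => [&& p.1 \in subsets n k, p.2 \in subsets n k,
             get false tb p.1 == get false tb p.2 &
             single (if get false tb p.1 then w0 else map negb w0) sv]) ps &&
      lower_check n k tb gens ps words N].

Lemma ut_identify (n k : nat) (G : {group 'S_n}) (r : 'S_n) T t ms d sels sv w0
    relabels gens ps words N :
  universal_transversal k G -> k <= n -> set_homogeneous t G ->
  all (listed (G :^ r)%g) T -> search n k T t ms d sels sv ->
  all (valid n k k) sels ->
  identify_check n k T sv w0 relabels gens ps words N ->
  set_homogeneous k G \/ exists s : 'S_n,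
    all (listed (G :^ s)%g) N /\ (G :^ s)%g \subset aut_group n k (table n k T w0).
Proof.
move=> ut kn hom TG srch val /and3P[/allP relP gT /andP[psP lo]].
have utr := universal_transversal_conj r ut; have homr := set_homogeneous_conj r hom.
case: (@set_homogeneous_or n k k (G :^ r)%G _ _ _ _ _ _ utr kn srch val TG homr).
  by move/(@set_homogeneous_conjV n k G r); left.
case=> X [stX ntX vX]; right.
have [p pin [X' [stX' ntX' rel]]] : exists2 p, p \in relabels &
    exists X' : {set {set 'I_n}}, [/\ stable_family (G :^ r)%g X', nontrivial_family k X' &
      relabel_check n k T (values k T X') w0 p].
  have /hasP[p pin /orP[rel|rel]] := relP _ vX; exists p => //; first by exists X.
  exists (~: X); split; first exact: stable_familyC.
    by case: ntX => ? ?; split; rewrite ?setCK.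
  rewrite (_ : values k T (~: X) = map negb (values k T X)) //.
  by rewrite /values -map_comp; apply: eq_map => b /=; rewrite in_setC.
have [s [TGs [Y [stY ntY vY]]]] := @relabel n k T (G :^ r)%G w0 p X' TG stX' ntX' rel.
exists (r * s)%g; rewrite conjsgM.
apply: (@identify n k T ((G :^ r) :^ s)%G t ms d sels sv w0 gens ps words N Y) => //.
- exact: (@universal_transversal_conj n (G :^ r)%G s).
- exact: (@set_homogeneous_conj n (G :^ r)%G s).
- by rewrite gT psP lo.
Qed.

(* A family is given by its values on the orbit representatives.  The points of the
   affine plane are (a, b) |-> a + 3 b; those of the projective lines are x |-> x
   (a + b iota |-> a + 3 b over GF(9)), with infinity last; the pairs {3i, 3i+1}
   and {3i+2, 3i+4} modulo 5 have the indices i and 5 + i. *)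
Definition C5_list : seq (seq nat) :=
  [:: [:: 1; 2; 3; 4; 0]].
Definition D5_extra : seq nat := [:: 0; 4; 3; 2; 1].
(** The edges of the pentagon: the orbit of {0, 2} comes first in [reps]. *)
Definition C5_family : bitseq := [:: false; true].

Definition C7_list : seq (seq nat) :=
  [:: [:: 1; 2; 3; 4; 5; 6; 0]].
Definition D7_extra : seq nat := [:: 0; 6; 5; 4; 3; 2; 1].
(** The edges of the heptagon: [reps] lists the cyclic distances in the order 3, 2, 1. *)
Definition C7_family : bitseq := [:: false; false; true].

Definition C4_affine_list : seq (seq nat) :=
  [:: [:: 1; 2; 0; 4; 5; 3; 7; 8; 6]; [:: 3; 4; 5; 6; 7; 8; 0; 1; 2];
    [:: 0; 3; 6; 2; 5; 8; 1; 4; 7]].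
Definition D8_affine_extra : seq nat := [:: 0; 1; 2; 6; 7; 8; 3; 4; 5].
(** Pairs in a common row or column: the rook graph of the 3 by 3 grid. *)
Definition C4_affine_family : bitseq := [:: false; false; true; true].

Definition A5_pairs_list : seq (seq nat) :=
  [:: [:: 1; 2; 3; 4; 0; 6; 7; 8; 9; 5]; [:: 2; 1; 6; 9; 7; 3; 0; 8; 4; 5]].
Definition S5_pairs_extra : seq nat := [:: 0; 1; 2; 7; 5; 4; 6; 3; 9; 8].
(** The Petersen graph, whose edges join disjoint 2-subsets. *)
Definition A5_pairs_family : bitseq :=
  [:: false; true; false; false; false; false; true; true; false].

Definition PSL25_list : seq (seq nat) :=
  [:: [:: 1; 2; 3; 4; 0; 5]; [:: 0; 3; 4; 2; 5; 1]].
(** The 2-(6,3,2) design of the triples {i, i+1, i+2} and {i, i+2, infinity}. *)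
Definition PSL25_family : bitseq := [:: false; true; true; false].

Definition AGL17_list : seq (seq nat) :=
  [:: [:: 1; 2; 3; 4; 5; 6; 0]; [:: 0; 3; 6; 2; 5; 1; 4]].
(** All triples except the lines of the two Fano planes {i, i+1, i+3} and {i, i+2, i+3}. *)
Definition AGL17_family : bitseq := [:: true; true; false; false; true].

Definition PGL27_list : seq (seq nat) :=
  [:: [:: 1; 2; 3; 4; 5; 6; 0; 7]; [:: 0; 4; 3; 6; 5; 2; 7; 1]; [:: 0; 3; 6; 2; 5; 1; 4; 7]].
(** The 42 harmonic quadruples of the projective line over GF(7). *)
Definition PGL27_family : bitseq :=
  [:: true; false; true; false; true; true; true; false; false; true].

Definition PSL29_list : seq (seq nat) :=
  [:: [:: 1; 2; 0; 4; 5; 3; 7; 8; 6; 9]; [:: 3; 4; 5; 6; 7; 8; 0; 1; 2; 9];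
    [:: 0; 2; 9; 8; 6; 4; 5; 3; 7; 1]; [:: 0; 5; 4; 9; 7; 8; 3; 2; 1; 6]].
Definition PSigmaL29_extra : seq nat := [:: 0; 1; 2; 6; 7; 8; 3; 4; 5; 9].
(** One of the two orbits of PSL(2,9) on triples, of 60 triples each. *)
Definition PSL29_family : bitseq :=
  [:: false; false; true; true; true; true; false; false; true; false; false; false; false; true; true; true].

(** * Certificates that identify the group from its family *)

Lemma identify_C5 : identify_check 5 2 (cycles 5 5 1)
  [:: [:: true; false]]
  C5_family [:: [:: 0; 1; 2; 3; 4]] [:: [:: 1; 2; 3; 4; 0]]
  [::]
  [:: [:: [:: 0]]]
  C5_list.
Proof. by vm_compute. Qed.

(** Only the identity of the generated group fixes the first b points (here b = 1), and the fuel is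
    the order of that group plus one; so it is for the other exceptional families. *)
Lemma upper_C5 : upper_check 5 2 (table 5 2 (cycles 5 5 1) C5_family) C5_list
  [:: iota 0 5; D5_extra] 1 6.
Proof. by vm_compute. Qed.

(** Multiplication by 3 and by 2 modulo 7 permutes the distance classes, so up to complement every
    survivor becomes the heptagon. *)
Lemma identify_C7 : identify_check 7 2 (cycles 7 7 1)
  [:: [:: true; true; false]; [:: true; false; true]; [:: true; false; false]]
  C7_family [:: [:: 0; 1; 2; 3; 4; 5; 6]; [:: 0; 3; 6; 2; 5; 1; 4]; [:: 0; 2; 4; 6; 1; 3; 5]] [::
    [:: 1; 2; 3; 4; 5; 6; 0]]
  [::]
  [:: [:: [:: 0]]]
  C7_list.
Proof. by vm_compute. Qed.

Lemma upper_C7 : upper_check 7 2 (table 7 2 (cycles 7 7 1) C7_family) C7_list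
  [:: iota 0 7; D7_extra] 1 8.
Proof. by vm_compute. Qed.

(** Each survivor consists of two of the four directions of the plane; the relabelings are linear
    maps that carry these two, or the other two, to rows and columns. *)
Lemma identify_C4_affine : identify_check 9 2 (E9 9)
  [:: [:: true; true; false; false]; [:: true; false; true; false]; [:: true; false; false; true]]
  C4_affine_family [:: [:: 0; 3; 6; 1; 4; 7; 2; 5; 8]; [:: 0; 3; 6; 4; 7; 1; 8; 2; 5];
    [:: 0; 3; 6; 7; 1; 4; 5; 8; 2]] [:: [:: 1; 2; 0; 4; 5; 3; 7; 8; 6];
    [:: 3; 4; 5; 6; 7; 8; 0; 1; 2]]
  [:: ([:: true; true; false; false; false; false; false; false; false],
    [:: true; false; false; true; false; false; false; false; false]);
    ([:: true; false; false; false; true; false; false; false; false],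
    [:: true; false; false; false; false; false; false; true; false])]
  [:: [:: [:: 0]; [:: 1]; [:: 3; 2]];
   [:: [:: 0]; [:: 1]; [:: 2; 3; 2]];
   [:: [:: 0]; [:: 1]; [:: 0; 1; 3]];
   [:: [:: 0]; [:: 1]; [:: 0; 1; 2; 3]];
   [:: [:: 0]; [:: 1]; [:: 2]];
   [:: [:: 0]; [:: 1]; [:: 2]];
   [:: [:: 0]; [:: 1]; [:: 2]];
   [:: [:: 0]; [:: 1]; [:: 2]];
   [:: [:: 0]; [:: 1]; [:: 0; 3; 2; 3]];
   [:: [:: 0]; [:: 1]; [:: 2; 3; 2]];
   [:: [:: 0]; [:: 1]; [:: 0; 1; 3]];
   [:: [:: 0]; [:: 1]; [:: 1; 2; 2; 2]];
   [:: [:: 0]; [:: 1]; [:: 0; 2; 3]];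
   [:: [:: 0]; [:: 1]; [:: 2; 3; 2]];
   [:: [:: 0]; [:: 1]; [:: 0; 1; 3]];
   [:: [:: 0]; [:: 1]; [:: 1; 3; 2]]]
  C4_affine_list.
Proof. by vm_compute. Qed.

Lemma upper_C4_affine : upper_check 9 2 (table 9 2 (E9 9) C4_affine_family) C4_affine_list
  [:: iota 0 9; D8_affine_extra] 2 37.
Proof. by vm_compute. Qed.

(** The relabelings rotate the second 5-cycle, five of them after doubling the labels modulo 5 in
    both cycles. *)
Lemma identify_A5_pairs : identify_check 10 2 (cycles 10 5 2)
  [:: [:: true; false; true; true; true; true; false; false; true];
    [:: true; false; true; true; true; false; true; false; true];
    [:: true; false; true; true; false; true; true; false; true];
    [:: true; false; true; false; true; true; true; false; true];
    [:: true; false; true; false; false; false; false; false; true];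
    [:: true; false; false; true; true; true; true; false; true];
    [:: true; false; false; true; false; false; false; false; true];
    [:: true; false; false; false; true; false; false; false; true];
    [:: true; false; false; false; false; true; false; false; true];
    [:: true; false; false; false; false; false; true; false; true]]
  A5_pairs_family [:: [:: 0; 1; 2; 3; 4; 5; 6; 7; 8; 9]; [:: 0; 1; 2; 3; 4; 6; 7; 8; 9; 5];
    [:: 0; 1; 2; 3; 4; 7; 8; 9; 5; 6]; [:: 0; 1; 2; 3; 4; 8; 9; 5; 6; 7];
    [:: 0; 2; 4; 1; 3; 8; 5; 7; 9; 6]; [:: 0; 1; 2; 3; 4; 9; 5; 6; 7; 8];
    [:: 0; 2; 4; 1; 3; 6; 8; 5; 7; 9]; [:: 0; 2; 4; 1; 3; 9; 6; 8; 5; 7];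
    [:: 0; 2; 4; 1; 3; 7; 9; 6; 8; 5]; [:: 0; 2; 4; 1; 3; 5; 7; 9; 6; 8]] [::
    [:: 1; 2; 3; 4; 0; 6; 7; 8; 9; 5]]
  [:: ([:: true; false; false; false; false; true; false; false; false; false],
    [:: true; true; false; false; false; false; false; false; false; false])]
  [:: [:: [:: 0]; [:: 1; 1; 1; 1; 0; 0]];
   [:: [:: 0]; [:: 1; 0; 0]];
   [:: [:: 0]; [:: 1; 0; 1; 0; 0; 1]];
   [:: [:: 0]; [:: 0; 0; 1; 0; 0; 1; 0]];
   [:: [:: 0]; [:: 0; 0; 1; 0; 0; 1; 0]];
   [:: [:: 0]; [:: 0; 0; 1; 1; 1; 0; 0]];
   [:: [:: 0]; [:: 0; 0; 1; 1; 0; 0; 0]];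
   [:: [:: 0]; [:: 0; 0; 0; 0; 1]]]
  A5_pairs_list.
Proof. by vm_compute. Qed.

Lemma upper_A5_pairs : upper_check 10 2 (table 10 2 (cycles 10 5 2) A5_pairs_family) A5_pairs_list
  [:: iota 0 10; S5_pairs_extra] 3 61.
Proof. by vm_compute. Qed.

Lemma identify_PSL25 : identify_check 6 3 (cycles 6 5 1)
  [:: [:: true; false; false; true]]
  PSL25_family [:: [:: 0; 1; 2; 3; 4; 5]] [:: [:: 1; 2; 3; 4; 0; 5]]
  [:: ([:: true; false; true; false; false; true], [:: true; true; true; false; false; false])]
  [:: [:: [:: 0]; [:: 1; 1]];
   [:: [:: 0]; [:: 1; 0; 0; 1; 0; 1; 0]];
   [:: [:: 0]; [:: 0; 0; 0; 0; 1; 1]];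
   [:: [:: 0]; [:: 1; 0; 0; 0; 0]];
   [:: [:: 0]; [:: 0; 0; 0; 0; 1; 0]];
   [:: [:: 0]; [:: 0; 0; 1]]]
  PSL25_list.
Proof. by vm_compute. Qed.

Lemma upper_PSL25 : upper_check 6 3 (table 6 3 (cycles 6 5 1) PSL25_family) PSL25_list
  [:: iota 0 6] 3 61.
Proof. by vm_compute. Qed.

(** Here the family and its complement are both minimal. The first pair is outside the family and
    exchanges a line of one Fano plane for a line of the other; the second pair is inside. *)
Lemma identify_AGL17 : identify_check 7 3 (cycles 7 7 1)
  [:: [:: true; true; false; false; true]]
  AGL17_family [:: [:: 0; 1; 2; 3; 4; 5; 6]] [:: [:: 1; 2; 3; 4; 5; 6; 0]]
  [:: ([:: true; true; false; true; false; false; false],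
    [:: true; false; true; true; false; false; false]);
    ([:: true; true; false; false; false; false; true],
    [:: true; false; true; false; false; true; false])]
  [:: [:: [:: 0]; [:: 1]];
   [:: [:: 0]; [:: 1]];
   [:: [:: 0]; [:: 0; 1; 2]];
   [:: [:: 0]; [:: 1; 1; 2; 1; 1]];
   [:: [:: 0]; [:: 1; 2; 0; 2]];
   [:: [:: 0]; [:: 0; 0; 2; 1; 2]]]
  AGL17_list.
Proof. by vm_compute. Qed.

Lemma upper_AGL17 : upper_check 7 3 (table 7 3 (cycles 7 7 1) AGL17_family) AGL17_list
  [:: iota 0 7] 2 43.
Proof. by vm_compute. Qed.

Lemma identify_PGL27 : identify_check 8 4 (cycles 8 7 1)
  [:: [:: true; false; true; false; true; true; true; false; false; true]]
  PGL27_family [:: [:: 0; 1; 2; 3; 4; 5; 6; 7]] [:: [:: 1; 2; 3; 4; 5; 6; 0; 7]]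
  [:: ([:: true; true; false; true; false; false; false; true],
    [:: true; true; true; false; true; false; false; false])]
  [:: [:: [:: 0]; [:: 1; 0; 0; 1; 0; 0; 1; 0; 1]; [:: 1; 0; 0; 0; 0; 0; 0; 1; 0; 0; 1]];
   [:: [:: 0]; [:: 1; 1; 0; 0; 1; 0; 1]; [:: 1; 1; 0; 0; 1; 0]];
   [:: [:: 0]; [:: 0; 1; 0; 0; 1; 1; 0; 1]; [:: 1; 1; 0; 1; 0; 0; 1; 1; 0]];
   [:: [:: 0]; [:: 0; 0; 0; 0; 1; 0; 0; 0; 0; 0; 1]; [:: 0; 1; 0; 0; 0; 0; 0; 0; 1; 0; 0; 1]];
   [:: [:: 0]; [:: 1; 1; 0; 0; 0; 0; 0]; [:: 0; 1; 1; 1; 1; 0; 1; 1; 1]];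
   [:: [:: 0]; [:: 0; 0; 0; 0; 0; 0; 1; 1]; [:: 0; 0; 1; 0; 1; 0; 0; 1]];
   [:: [:: 0]; [:: 1; 0; 1; 0; 0; 1; 1]; [:: 0; 1; 1; 1; 0; 0; 1; 1; 0]];
   [:: [:: 0]; [:: 1; 1; 1; 1; 1; 0; 0; 1]; [:: 1; 0; 1; 0; 1; 0; 1; 1]];
   [:: [:: 0]; [:: 1; 0; 0; 1; 0]; [:: 0; 1; 1; 1; 0; 0; 0; 1; 1]];
   [:: [:: 0]; [:: 0; 0; 0; 0; 1; 1; 0]; [:: 0; 1; 1; 1; 1; 0; 1; 1; 1; 0]];
   [:: [:: 0]; [:: 1; 1; 1; 0; 1; 1; 1]; [:: 0; 1; 1; 0; 0; 1]];
   [:: [:: 0]; [:: 0; 1; 0; 0; 1; 0; 0]; [:: 1; 0; 0; 1; 1]]]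
  PGL27_list.
Proof. by vm_compute. Qed.

Lemma upper_PGL27 : upper_check 8 4 (table 8 4 (cycles 8 7 1) PGL27_family) PGL27_list
  [:: iota 0 8] 3 337.
Proof. by vm_compute. Qed.

Lemma identify_PSL29 : identify_check 10 3 (E9 10)
  [::
    [:: true; true; false; false; false; false; true; true; false; true; true; true; true; false; false; false];
    [:: true; false; true; true; false; false; true; false; false; false; true; true; false; false; true; true];
    [:: true; false; false; false; true; true; true; false; true; false; true; true; false; true; false; false]]
  PSL29_family [:: [:: 0; 3; 6; 1; 4; 7; 2; 5; 8; 9]; [:: 0; 3; 6; 7; 1; 4; 5; 8; 2; 9];
    [:: 0; 3; 6; 4; 7; 1; 8; 2; 5; 9]] [:: [:: 1; 2; 0; 4; 5; 3; 7; 8; 6; 9];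
    [:: 3; 4; 5; 6; 7; 8; 0; 1; 2; 9]]
  [:: ([:: true; true; false; false; false; false; false; false; false; true],
    [:: true; true; true; false; false; false; false; false; false; false])]
  [:: [:: [:: 0]; [:: 1]; [:: 0; 2; 0; 0; 2]; [:: 0; 0; 2; 1; 2; 0]];
   [:: [:: 0]; [:: 1]; [:: 0; 2; 0; 0; 2]; [:: 0; 0; 2; 1; 1; 2; 0]];
   [:: [:: 0]; [:: 1]; [:: 2; 2; 2; 2]; [:: 0; 0; 2; 0; 1; 2; 0; 0]];
   [:: [:: 0]; [:: 1]; [:: 2]; [:: 0; 0; 2; 1; 1; 2; 2; 0]];
   [:: [:: 0]; [:: 1]; [:: 0; 2; 0; 2]; [:: 0; 0; 2; 1; 2; 0]];
   [:: [:: 0]; [:: 1]; [:: 2; 0; 0]; [:: 0; 0; 2; 1; 1; 2; 0]];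
   [:: [:: 0]; [:: 1]; [:: 0; 0; 2; 2]; [:: 2; 2; 2; 1; 2]];
   [:: [:: 0]; [:: 1]; [:: 0; 0; 2; 2]; [:: 2; 2; 2; 1; 1; 2]];
   [:: [:: 0]; [:: 1]; [:: 0; 2; 2; 0]; [:: 2; 2; 1; 1; 2; 2]];
   [:: [:: 0]; [:: 1]; [:: 0; 2; 2; 0]; [:: 2; 2; 1; 1; 2; 2]];
   [:: [:: 0]; [:: 1]; [:: 0; 0; 2; 0; 2]; [:: 0; 0; 2; 0; 0; 1; 2]];
   [:: [:: 0]; [:: 1]; [:: 2; 0]; [:: 2; 2; 1; 1; 2]]]
  PSL29_list.
Proof. by vm_compute. Qed.

Lemma upper_PSL29 : upper_check 10 3 (table 10 3 (E9 10) PSL29_family) PSL29_list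
  [:: iota 0 10; PSigmaL29_extra] 3 361.
Proof. by vm_compute. Qed.

(** * Groups of degree less than 11 with the universal transversal property *)

Definition conj_to_gen (n : nat) (G : {group 'S_n}) (N : seq (seq nat)) : Prop :=
  exists s : 'S_n, (G :^ s)%g = gen_group n N :> {set 'S_n}.

Lemma conj_to_gen_between (n k : nat) (G : {group 'S_n}) tb N x b fuel :
  perm_list n x -> upper_check n k tb N [:: iota 0 n; x] b fuel ->
  (exists s : 'S_n, all (listed (G :^ s)%g) N /\ (G :^ s)%g \subset aut_group n k tb) ->
  conj_to_gen G N \/ conj_to_gen G (x :: N).
Proof.
move=> px chk [s [NG GA]].
by case: (@between n k tb N x b fuel (G :^ s)%G px chk NG GA) => e; [left|right]; exists s.
Qed.

Lemma conj_to_gen_between1 (n k : nat) (G : {group 'S_n}) tb N b fuel :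
  upper_check n k tb N [:: iota 0 n] b fuel ->
  (exists s : 'S_n, all (listed (G :^ s)%g) N /\ (G :^ s)%g \subset aut_group n k tb) ->
  conj_to_gen G N.
Proof.
by move=> chk [s [NG GA]]; exists s; apply: (@between1 n k tb N b fuel (G :^ s)%G chk NG GA).
Qed.

Lemma prime_cycles_ex (n p t : nat) (G : {group 'S_n}) : prime p -> t <= n ->
  set_homogeneous t G -> p %| 'C(n, t) -> exists (s : 'S_n) (m : nat),
  [/\ 0 < m, p * m <= n & all (listed (G :^ s)%g) (cycles n p m)].
Proof.
move=> p_pr tn hom dv; apply: prime_cycles_in => //.
exact: dvdn_trans dv (bin_dvd_order tn hom).
Qed.

Lemma one_cycle (n p t : nat) (G : {group 'S_n}) : prime p -> t <= n < 2 * p ->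
  set_homogeneous t G -> p %| 'C(n, t) -> exists s : 'S_n,
  all (listed (G :^ s)%g) (cycles n p 1).
Proof.
move=> p_pr /andP[tn ltn] hom dv.
have [s [m [m0 mp sm]]] := prime_cycles_ex p_pr tn hom dv.
have ltm2 : m < 2 by rewrite -(ltn_pmul2r (prime_gt0 p_pr)) mulnC (leq_ltn_trans mp).
by exists s; move: sm; have -> : m = 1 by lia.
Qed.

Lemma case_4_2 (G : {group 'S_4}) :
  universal_transversal 2 G -> set_homogeneous 2 G.
Proof.
move=> ut; have h1 : set_homogeneous 1 G by apply: (ut_transitive ut).
exact: (ut_search ut isT search_4_2 isT isT h1).
Qed.

Lemma case_5_2 (G : {group 'S_5}) : universal_transversal 2 G ->
  set_homogeneous 2 G \/ conj_to_gen G C5_list \/ conj_to_gen G (D5_extra :: C5_list).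
Proof.
move=> ut; have h1 : set_homogeneous 1 G by apply: (ut_transitive ut).
have [r rT] := @one_cycle 5 5 1 G isT isT h1 isT.
have [|H] := ut_identify ut isT h1 rT search_5_2 isT identify_C5; [by left|right].
exact: (conj_to_gen_between _ upper_C5 H).
Qed.

Lemma case_6_2 (G : {group 'S_6}) :
  universal_transversal 2 G -> set_homogeneous 2 G.
Proof.
move=> ut; have h1 : set_homogeneous 1 G by apply: (ut_transitive ut).
have [s [m [m0 mp sm]]] := @prime_cycles_ex 6 3 1 G isT isT h1 isT.
case: m m0 mp sm => [|[|[|m]]] // _ mp sm; last by lia.
  exact: (ut_search_conj ut isT search_6_2a isT sm _).
exact: (ut_search_conj ut isT search_6_2b isT sm _).
Qed.

Lemma case_7_2 (G : {group 'S_7}) : universal_transversal 2 G ->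
  set_homogeneous 2 G \/ conj_to_gen G C7_list \/ conj_to_gen G (D7_extra :: C7_list).
Proof.
move=> ut; have h1 : set_homogeneous 1 G by apply: (ut_transitive ut).
have [r rT] := @one_cycle 7 7 1 G isT isT h1 isT.
have [|H] := ut_identify ut isT h1 rT search_7_2 isT identify_C7; [by left|right].
exact: (conj_to_gen_between _ upper_C7 H).
Qed.

Lemma case_8_2 (G : {group 'S_8}) :
  universal_transversal 2 G -> set_homogeneous 2 G.
Proof.
move=> ut; have h1 : set_homogeneous 1 G by apply: (ut_transitive ut).
have [s sT] := involution_in (erefl 8) h1.
exact: (ut_search_conj ut isT search_8_2 isT sT _).
Qed.

Lemma case_9_2 (G : {group 'S_9}) : universal_transversal 2 G ->
  set_homogeneous 2 G \/ conj_to_gen G C4_affine_list \/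
  conj_to_gen G (D8_affine_extra :: C4_affine_list).
Proof.
move=> ut; have h1 : set_homogeneous 1 G by apply: (ut_transitive ut).
have [r [rT|rT]] := nine_in_nine (erefl 9) h1.
  by left; apply: (ut_search_conj ut isT search_9_2C isT rT _).
have [|H] := ut_identify ut isT h1 rT search_9_2E isT identify_C4_affine; [by left|right].
exact: (conj_to_gen_between _ upper_C4_affine H).
Qed.

Lemma case_10_2 (G : {group 'S_10}) : universal_transversal 2 G ->
  set_homogeneous 2 G \/ conj_to_gen G A5_pairs_list \/
  conj_to_gen G (S5_pairs_extra :: A5_pairs_list).
Proof.
move=> ut; have h1 : set_homogeneous 1 G by apply: (ut_transitive ut).
have [s [m [m0 mp sm]]] := @prime_cycles_ex 10 5 1 G isT isT h1 isT.
case: m m0 mp sm => [|[|[|m]]] // _ mp sm; last by lia.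
  by left; apply: (ut_search_conj ut isT search_10_2a isT sm _).
have [|H] := ut_identify ut isT h1 sm search_10_2b isT identify_A5_pairs; [by left|right].
exact: (conj_to_gen_between _ upper_A5_pairs H).
Qed.

Lemma case_6_3 (G : {group 'S_6}) : universal_transversal 3 G ->
  set_homogeneous 3 G \/ conj_to_gen G PSL25_list.
Proof.
move=> ut; have h2 : set_homogeneous 2 G by apply: (ut_2homogeneous ut).
have [r rT] := @one_cycle 6 5 2 G isT isT h2 isT.
have [|H] := ut_identify ut isT h2 rT search_6_3 isT identify_PSL25; [by left|right].
exact: (conj_to_gen_between1 upper_PSL25 H).
Qed.

Lemma case_7_3 (G : {group 'S_7}) : universal_transversal 3 G ->
  set_homogeneous 3 G \/ conj_to_gen G AGL17_list.
Proof.
move=> ut; have h2 : set_homogeneous 2 G by apply: (ut_2homogeneous ut).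
have [r rT] := @one_cycle 7 7 2 G isT isT h2 isT.
have [|H] := ut_identify ut isT h2 rT search_7_3 isT identify_AGL17; [by left|right].
exact: (conj_to_gen_between1 upper_AGL17 H).
Qed.

Lemma case_8_3 (G : {group 'S_8}) :
  universal_transversal 3 G -> set_homogeneous 3 G.
Proof.
move=> ut; have h2 : set_homogeneous 2 G by apply: (ut_2homogeneous ut).
have [r rT] := @one_cycle 8 7 2 G isT isT h2 isT.
exact: (ut_search_conj ut isT search_8_3 isT rT _).
Qed.

Lemma case_8_4 (G : {group 'S_8}) : universal_transversal 4 G ->
  set_homogeneous 4 G \/ conj_to_gen G PGL27_list.
Proof.
move=> ut; have h2 : set_homogeneous 2 G by apply: (ut_2homogeneous ut).
have [r rT] := @one_cycle 8 7 2 G isT isT h2 isT.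
have [|H] := ut_identify ut isT h2 rT search_8_4 isT identify_PGL27; [by left|right].
exact: (conj_to_gen_between1 upper_PGL27 H).
Qed.

Lemma case_9_3 (G : {group 'S_9}) :
  universal_transversal 3 G -> set_homogeneous 3 G.
Proof.
move=> ut; have h2 : set_homogeneous 2 G by apply: (ut_2homogeneous ut).
have h1 : set_homogeneous 1 G by apply: set_homogeneous_21.
have [r [rT|rT]] := nine_in_nine (erefl 9) h1.
  exact: (ut_search_conj ut isT search_9_3C isT rT _).
exact: (ut_search_conj ut isT search_9_3E isT rT _).
Qed.

(** Homogeneity is raised one step at a time: covering by 4-sets gives 3-homogeneity, which turns a
    family of 4-sets into a 3-design. *)
Lemma case_9_4 (G : {group 'S_9}) :
  universal_transversal 4 G -> set_homogeneous 4 G.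
Proof.
move=> ut; have h2 : set_homogeneous 2 G by apply: (ut_2homogeneous ut).
have h1 : set_homogeneous 1 G by apply: set_homogeneous_21.
have [r [rT|rT]] := nine_in_nine (erefl 9) h1.
  have h3 := ut_search_conj ut isT search_9_4_3C isT rT h2.
  exact: (ut_search_conj ut isT search_9_4C isT rT _).
have h3 := ut_search_conj ut isT search_9_4_3E isT rT h2.
exact: (ut_search_conj ut isT search_9_4E isT rT _).
Qed.

Lemma case_10_3 (G : {group 'S_10}) : universal_transversal 3 G ->
  set_homogeneous 3 G \/ conj_to_gen G PSL29_list \/
  conj_to_gen G (PSigmaL29_extra :: PSL29_list).
Proof.
move=> ut; have h2 : set_homogeneous 2 G by apply: (ut_2homogeneous ut).
have [r [rT|rT]] := ten_in_ten (erefl 10) h2.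
  by left; apply: (ut_search_conj ut isT search_10_3C isT rT _).
have [|H] := ut_identify ut isT h2 rT search_10_3E isT identify_PSL29; [by left|right].
exact: (conj_to_gen_between _ upper_PSL29 H).
Qed.

Lemma case_10_4 (G : {group 'S_10}) :
  universal_transversal 4 G -> set_homogeneous 4 G.
Proof.
move=> ut; have h2 : set_homogeneous 2 G by apply: (ut_2homogeneous ut).
have [r [rT|rT]] := ten_in_ten (erefl 10) h2.
  have h3 := ut_search_conj ut isT search_10_4_3C isT rT h2.
  exact: (ut_search_conj ut isT search_10_4C isT rT _).
have h3 := ut_search_conj ut isT search_10_4_3E isT rT h2.
exact: (ut_search_conj ut isT search_10_4E isT rT _).
Qed.

Lemma case_10_5 (G : {group 'S_10}) :
  universal_transversal 5 G -> set_homogeneous 5 G.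
Proof.
move=> ut; have h2 : set_homogeneous 2 G by apply: (ut_2homogeneous ut).
have [r [rT|rT]] := ten_in_ten (erefl 10) h2.
  have h3 := ut_search_conj ut isT search_10_5_3C isT rT h2.
  have h4 := ut_search_conj ut isT search_10_5_4C isT rT h3.
  exact: (ut_search_conj ut isT search_10_5C isT rT _).
have h3 : set_homogeneous 3 G.
  have utr := universal_transversal_conj r ut; have h2r := set_homogeneous_conj r h2.
  case: (@set_homogeneous_or 10 5 3 (G :^ r)%G _ _ _ _ _ _ utr isT search_10_5_3E isT rT h2r).
    exact: set_homogeneous_conjV.
  (* The surviving triple systems are excluded by the invariant family of the
     4-sets that contain exactly v of their triples. *)
  case=> X [stX _ vX]; exfalso.
  have hit : hits 4 (G :^ r)%G (Within [:: true; true; true; true; true;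
      false; false; false; false; false]) by apply: (hits_valid utr).
  have : has (fun v => shadow_misses 10 3 (E9 10) (values 3 (E9 10) X) v
      [:: true; true; true; true; true; false; false; false; false; false]) [:: 0; 4].
    by move: vX; rewrite !inE => /or3P[]/eqP->; vm_compute.
  by case/hasP => v _; apply: (shadow_misses_contra rT stX hit).
have h4 := ut_search_conj ut isT search_10_5_4E isT rT h3.
exact: (ut_search_conj ut isT search_10_5E isT rT _).
Qed.

(** * Universal transversal property and non-homogeneity of the exceptions *)

(* A colouring is normalized by naming each colour after the first point that
   has it; [cs] is the colouring of the points treated so far. *)
Fixpoint always_rainbow (k : nat) (edges : seq (seq bitseq)) (cs used : seq nat) : bool :=
  if edges is bs :: edges' then
    let i := size cs in
    all (fun c => let cs' := rcons cs c in
           has (fun b => uniq (mask b cs')) bs ||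
           always_rainbow k edges' cs' (if c == i then i :: used else used))
        (if size used < k then i :: used else used)
  else size used < k.

Definition edge_levels (n : nat) (bs : seq bitseq) : seq (seq bitseq) :=
  [seq [seq b <- bs | nth false b i && ~~ has id (drop i.+1 b)] | i <- iota 0 n].

Definition first_named (cs : seq nat) : Prop :=
  forall i, i < size cs -> nth 0 cs i \in i :: take i cs.

Lemma mask_take (A : Type) (m : nat) (b : bitseq) (s : seq A) :
  ~~ has id (drop m b) -> mask b (take m s) = mask b s.
Proof.
elim: b m s => [|x b IH] [|m] [|y s] //=; last by move/IH => ->.
rewrite negb_or => /andP[/negbTE -> nob].
have -> : mask b s = [::].
  by elim: b s nob {IH} => [|[] b IHb] [|z s] //= nob; rewrite IHb.
by [].
Qed.

(** A normalized colouring follows one branch of the search, with [used] the colours seen before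
    point i. The branch cannot end at a leaf, where fewer than k colours are used, so it stops at a
    rainbow set. *)
Lemma always_rainbowP k n (bs : seq bitseq) (cs used : seq nat) (i : nat) :
  size cs = n -> first_named cs -> i <= n -> uniq used -> used =i take i cs ->
  all (fun c => c < i) used ->
  always_rainbow k (drop i (edge_levels n bs)) (take i cs) used ->
  size (undup cs) = k -> exists2 b, b \in bs & uniq (mask b cs).
Proof.
move=> sc fn + + + + + sk; move ed: (n - i) => d.
elim: d i ed used => [|d IH] i ed used lei uu eu ltu.
  have ei : i = n by lia.
  rewrite drop_oversize ?size_map ?size_iota ?ei //= ltnNge -sk.
  have -> : size (undup cs) = size used; last by rewrite leqnn.
  apply/eqP; rewrite -(uniq_size_uniq uu) ?undup_uniq // => x.
  by rewrite mem_undup eu take_oversize // sc ei.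
have lti : i < n by lia.
rewrite (drop_nth [::]) ?size_map ?size_iota //= (nth_map 0) ?size_iota // nth_iota // add0n.
rewrite size_take sc lti; set c := nth 0 cs i.
have cin : c \in i :: used by have := fn i; rewrite sc => /(_ lti); rewrite !inE eu.
have iu : i \notin used by apply/negP => /(allP ltu); rewrite ltnn.
(* With k colours in use no new one is tried: a first occurrence at i would make k + 1 colours. *)
move/allP/(_ c); case: ifP => [ltk|nltk]; last first.
  case: (eqVneq c i) => [ci|nci] => [_|H].
    have sub : {subset i :: used <= undup cs}.
      move=> x; rewrite inE mem_undup => /orP[/eqP->|]; first by rewrite -ci mem_nth ?sc.
      by rewrite eu => /mem_take.
    have := uniq_leq_size _ sub; rewrite /= iu uu sk => /(_ isT); lia.
  have cu : c \in used by move: cin; rewrite inE (negbTE nci).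
  move: (H cu); rewrite -take_nth ?sc // => /orP[/hasP[b]|].
    rewrite mem_filter => /andP[/andP[_ nod] bb]; rewrite mask_take // => ub.
    by exists b.
  apply: IH => //; [lia| |by apply: sub_all ltu => x ltx; apply: ltnW].
  move=> x; rewrite (take_nth 0) ?sc // mem_rcons inE -/c eu.
  by case: eqP => // ->; rewrite -eu cu.
move/(_ cin); rewrite -take_nth ?sc // => /orP[/hasP[b]|].
  rewrite mem_filter => /andP[/andP[_ nod] bb]; rewrite mask_take // => ub.
  by exists b.
case: (eqVneq c i) => [ci|nci]; apply: IH => //; try lia.
- by rewrite /= iu.
- by move=> x; rewrite (take_nth 0) ?sc // mem_rcons !inE -/c ci eu.
- by rewrite /= ltnSn; apply: sub_all ltu => x ltx; apply: ltnW.
- move=> x; rewrite (take_nth 0) ?sc // mem_rcons inE -/c eu.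
  have cu : c \in used by move: cin; rewrite inE (negbTE nci).
  by case: eqP => // ->; rewrite -eu cu.
- by apply: sub_all ltu => x ltx; apply: ltnW.
Qed.

(** Renaming each colour to the index of its first point keeps the rainbow sets and gives a
    [first_named] list. *)
Lemma rainbow_edge (n k : nat) (bs : seq bitseq) (U : finType) (f : 'I_n -> U) :
  always_rainbow k (edge_levels n bs) [::] [::] -> #|f @: [set: 'I_n]| = k ->
  all (fun b => size b == n) bs ->
  exists2 b, b \in bs & {in setb n b &, injective f}.
Proof.
move=> chk cf /allP szb; pose F := [seq f i | i <- enum 'I_n].
have sF : size F = n by rewrite size_map size_enum_ord.
pose cs := [seq index x F | x <- F].
have scs : size cs = n by rewrite size_map.
have fn : first_named cs.
  move=> i; rewrite scs => lti; set j := nth 0 cs i.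
  have lti' : i < size F by rewrite sF.
  have fi : F <> [::] by move=> e; rewrite e in lti'.
  have u0 : U by case: (F) fi.
  have ej : j = index (nth u0 F i) F by rewrite /j (nth_map u0).
  have leji : j <= i by rewrite ej index_nth.
  rewrite inE; case: eqP => //= nji; have ltji : j < i by rewrite ltn_neqAle leji; apply/andP;
    split=> //; apply/eqP.
  have e2 : nth u0 F j = nth u0 F i by rewrite ej nth_index // mem_nth.
  have -> : j = nth 0 (take i cs) j.
    by rewrite nth_take // (nth_map u0) ?e2 -?ej // sF; apply: ltn_trans ltji lti.
  by apply: mem_nth; rewrite size_take scs lti.
have szk : size (undup cs) = k.
  rewrite -cf; have /perm_size : perm_eq (undup cs) [seq index x F | x <- undup F].
    apply: uniq_perm; rewrite ?undup_uniq //.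
      rewrite map_inj_in_uniq ?undup_uniq // => x y; rewrite !mem_undup => xF yF e.
      by rewrite -(nth_index x xF) e nth_index.
    move=> x; rewrite mem_undup; apply/mapP/mapP => -[y yF ->]; exists y => //.
      by rewrite mem_undup.
    by rewrite mem_undup in yF.
  move=> ->; rewrite size_map -(card_uniqP (undup_uniq F)); apply: eq_card => x.
  rewrite mem_undup; apply/mapP/imsetP => -[y _ ->]; exists y => //.
  by rewrite mem_enum.
have e0 : [::] =i take 0 cs by rewrite take0.
have chk0 : always_rainbow k (drop 0 (edge_levels n bs)) (take 0 cs) [::] by rewrite drop0 take0.
have [b bb ub] := @always_rainbowP k n bs cs [::] 0 scs fn (leq0n n) isT e0 isT chk0 szk.
exists b => //; have sb := eqP (szb b bb).
have uF : uniq (mask b F) by move: ub; rewrite /cs -map_mask => /map_uniq.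
have eF : mask b F = [seq f i | i <- enum (setb n b)].
  rewrite -[in LHS](setbK sb) /F -map_mask -filter_mask; congr map.
  by rewrite enumT; apply: eq_filter.
by apply/dinjectiveP; rewrite /dinjectiveb -eF.
Qed.

Definition transversal_check (n k : nat) (N : seq (seq nat)) (starts : seq bitseq) : bool :=
  let os := [seq bfs (push n) N (size (subsets n k)).+1 [:: b] [:: b] | b <- starts] in
  [&& all (perm_list n) N, all (fun b => b \in subsets n k) starts,
      all (fun b => has (fun o => b \in o) os) (subsets n k) &
      all (fun o => always_rainbow k (edge_levels n o) [::] [::]) os].

Lemma transversal_checkP (n k : nat) N starts :
  transversal_check n k N starts -> universal_transversal k (gen_group n N).
Proof.
case/and4P=> /allP permN /allP startP /allP cover /allP rainbow.
apply/universal_transversalP => U f A cf cA.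
have /cover/hasP[o oos Ao] : bits A \in subsets n k by rewrite bits_subsets cA.
have [b0 b0s eo] := mapP oos.
have sb0 : size b0 = n by have := startP _ b0s; rewrite mem_subsets => /andP[/eqP].
pose orb x := size x = n /\ exists2 g : 'S_n, g \in gen_group n N & setb n x = g @: setb n b0.
have orbP x : x \in o -> orb x.
  rewrite eo; apply: bfsP => [q y qN [sy [g gN ey]]|y|y]; rewrite ?inE.
  - have /listedP[h hN <-] := gen_group_perm_list qN (permN q qN).
    split; first by rewrite size_push // images_lt.
    by exists (g * h)%g; rewrite ?groupM // imset_mul -ey push_images.
  - by move/eqP->; split=> //; exists 1%g; rewrite ?group1 //;
      rewrite -[LHS]imset_id; apply: eq_imset => i; rewrite perm1.
  - by move/eqP->; split=> //; exists 1%g; rewrite ?group1 //;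
      rewrite -[LHS]imset_id; apply: eq_imset => i; rewrite perm1.
have [|b bo inj] := @rainbow_edge n k o U f (rainbow o oos) cf.
  by apply/allP => x /orbP[->].
have [_ [g gN eA]] := orbP _ Ao; have [_ [h hN eb]] := orbP _ bo.
exists (g^-1 * h)%g; first by rewrite groupM ?groupV.
rewrite imset_mul (_ : g^-1%g @: A = setb n b0) -?eb //.
by rewrite -(bitsK A) eA -imset_mul mulgV -[RHS]imset_id; apply: eq_imset => i; rewrite perm1.
Qed.

Definition mixed (n k : nat) (tb : trie bool) : bool :=
  has (get false tb) (subsets n k) && has (fun b => ~~ get false tb b) (subsets n k).

Lemma gen_group_not_homogeneous (n k : nat) tb N :
  all (fixes_table n k tb) N -> mixed n k tb -> ~ set_homogeneous k (gen_group n N).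
Proof.
move=> fixN /andP[/hasP[b bs tb_b] /hasP[c cs /negP tb_c]] hom.
have [g gN e] := hom _ _ (card_setb_subsets bs) (card_setb_subsets cs).
have /aut_setP/(_ b bs) := subsetP (gen_group_aut fixN) g gN.
move: (bs) (cs); rewrite !mem_subsets => /andP[/eqP sb _] /andP[/eqP sc _].
by rewrite push_bits // e setbK // tb_b => tb_c'; apply: tb_c; rewrite tb_c'.
Qed.
(** When two groups share a family, the transversal check is made for the smaller one, as the
    property passes to overgroups, and the invariance of the family is checked for the larger
    one. *)
Lemma transversal_C5 : transversal_check 5 2 C5_list
  [:: [:: true; true; false; false; false];
   [:: true; false; true; false; false]].
Proof. by vm_compute. Qed.

Lemma fixes_C5 :
  all (fixes_table 5 2 (table 5 2 (cycles 5 5 1) C5_family)) (D5_extra :: C5_list) &&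
  mixed 5 2 (table 5 2 (cycles 5 5 1) C5_family).
Proof. by vm_compute. Qed.

Lemma transversal_C7 : transversal_check 7 2 C7_list
  [:: [:: true; true; false; false; false; false; false];
   [:: true; false; true; false; false; false; false];
   [:: true; false; false; true; false; false; false]].
Proof. by vm_compute. Qed.

Lemma fixes_C7 :
  all (fixes_table 7 2 (table 7 2 (cycles 7 7 1) C7_family)) (D7_extra :: C7_list) &&
  mixed 7 2 (table 7 2 (cycles 7 7 1) C7_family).
Proof. by vm_compute. Qed.

Lemma transversal_C4_affine : transversal_check 9 2 C4_affine_list
  [:: [:: true; true; false; false; false; false; false; false; false];
   [:: true; false; false; false; true; false; false; false; false]].
Proof. by vm_compute. Qed.

Lemma fixes_C4_affine :
  all (fixes_table 9 2 (table 9 2 (E9 9) C4_affine_family)) (D8_affine_extra :: C4_affine_list) &&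
  mixed 9 2 (table 9 2 (E9 9) C4_affine_family).
Proof. by vm_compute. Qed.

Lemma transversal_A5_pairs : transversal_check 10 2 A5_pairs_list
  [:: [:: true; true; false; false; false; false; false; false; false; false];
   [:: true; false; true; false; false; false; false; false; false; false]].
Proof. by vm_compute. Qed.

Lemma fixes_A5_pairs :
  all (fixes_table 10 2 (table 10 2 (cycles 10 5 2) A5_pairs_family)) (S5_pairs_extra ::
    A5_pairs_list) &&
  mixed 10 2 (table 10 2 (cycles 10 5 2) A5_pairs_family).
Proof. by vm_compute. Qed.

Lemma transversal_PSL25 : transversal_check 6 3 PSL25_list
  [:: [:: true; true; true; false; false; false];
   [:: true; true; false; true; false; false]].
Proof. by vm_compute. Qed.

Lemma fixes_PSL25 :
  all (fixes_table 6 3 (table 6 3 (cycles 6 5 1) PSL25_family)) PSL25_list &&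
  mixed 6 3 (table 6 3 (cycles 6 5 1) PSL25_family).
Proof. by vm_compute. Qed.

Lemma transversal_AGL17 : transversal_check 7 3 AGL17_list
  [:: [:: true; true; true; false; false; false; false];
   [:: true; true; false; true; false; false; false]].
Proof. by vm_compute. Qed.

Lemma fixes_AGL17 :
  all (fixes_table 7 3 (table 7 3 (cycles 7 7 1) AGL17_family)) AGL17_list &&
  mixed 7 3 (table 7 3 (cycles 7 7 1) AGL17_family).
Proof. by vm_compute. Qed.

Lemma transversal_PGL27 : transversal_check 8 4 PGL27_list
  [:: [:: true; true; true; true; false; false; false; false];
   [:: true; true; true; false; true; false; false; false]].
Proof. by vm_compute. Qed.

Lemma fixes_PGL27 :
  all (fixes_table 8 4 (table 8 4 (cycles 8 7 1) PGL27_family)) PGL27_list &&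
  mixed 8 4 (table 8 4 (cycles 8 7 1) PGL27_family).
Proof. by vm_compute. Qed.

Lemma transversal_PSL29 : transversal_check 10 3 PSL29_list
  [:: [:: true; true; true; false; false; false; false; false; false; false];
   [:: true; true; false; true; false; false; false; false; false; false]].
Proof. by vm_compute. Qed.

Lemma fixes_PSL29 :
  all (fixes_table 10 3 (table 10 3 (E9 10) PSL29_family)) (PSigmaL29_extra :: PSL29_list) &&
  mixed 10 3 (table 10 3 (E9 10) PSL29_family).
Proof. by vm_compute. Qed.

(** * The exceptional groups in their natural actions *)

Section Realization.
Variables (n : nat) (U : finType) (e : 'I_n -> U).
Implicit Types (G : {group 'S_n}) (H : {set {perm U}}) (g : 'S_n).

Definition realizes G H : Prop :=
  (forall g, g \in G -> exists2 h : {perm U}, h \in H & forall x, e (g x) = h (e x)) /\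
  (forall h : {perm U}, h \in H -> exists2 g, g \in G & forall x, e (g x) = h (e x)).

Hypothesis bij_e : bijective e.

Lemma realizes_perm_isomorphic G H (s : 'S_n) :
  realizes (G :^ s)%G H -> perm_isomorphic G H.
Proof.
case: bij_e => e' eK e'K [GH HG].
pose f x := e (s x); pose f' y := (s^-1)%g (e' y).
have fK : cancel f f' by move=> x; rewrite /f' /f eK permK.
have f'K : cancel f' f by move=> y; rewrite /f' /f permKV e'K.
pose F (g : 'S_n) := perm (inj_comp (inj_comp (can_inj fK) (@perm_inj _ g)) (can_inj f'K)).
have FE g x : F g (f x) = f (g x) by rewrite permE /= fK.
have FM : {in G &, {morph F : g h / (g * h)%g}}.
  move=> g h _ _; apply/permP => y; rewrite -(f'K y) permM !FE permM.
  by [].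
have F1 g : F g = 1%g -> g = 1%g.
  move=> Fg1; apply/permP => x; apply: (can_inj fK).
  by rewrite -FE Fg1 !perm1.
have Fe g (h : {perm U}) : (forall x, e ((g ^ s)%g x) = h (e x)) -> F g = h.
  move=> eh; apply/permP => y; rewrite -(f'K y) FE /f -eh; congr e.
  by rewrite conjgE !permM permK.
exists f, (Morphism FM); split; first by exists f'.
  apply/eqP/setP => h; rewrite /= !inE; apply/imsetP/andP => [[g]|[h1 hH]].
    rewrite !inE => /andP[g1 gG] ->.
    have gs : (g ^ s)%g \in (G :^ s)%g by rewrite memJ_conjg.
    have [h' h'H /Fe eg] := GH _ gs; split; last by rewrite eg.
    by apply: contraNneq g1 => /F1 ->.
  have [_ /imsetP[g gG ->] /Fe eg] := HG h hH; exists g; last by rewrite eg.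
  rewrite !inE gG andbT; apply: contraNneq h1 => g1; rewrite -eg g1.
  apply/eqP/permP => y; rewrite -(f'K y) FE !perm1 //.
by move=> g x gG; rewrite /= FE.
Qed.

Lemma perm_isomorphic_conj G K H :
  realizes K H -> perm_isomorphic G H -> exists s : 'S_n, (G :^ s)%g = K :> {set 'S_n}.
Proof.
case: bij_e => e' eK e'K [KH HK] [f [phi [[f' fK f'K] /eqP/setP iso ef]]].
pose s := perm (inj_comp (can_inj e'K) (can_inj fK)).
have es x : e (s x) = f x by rewrite permE /= e'K.
(* [isom] equates the sets of nonidentity elements, so the identity is treated apart. *)
have phiH g : g \in G -> g != 1%g -> phi g \in H^#%g.
  by move=> gG g1; rewrite -iso; apply: imset_f; rewrite !inE g1.
have conjE (g k : 'S_n) : g \in G ->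
    (forall x, e (k x) = phi g (e x)) -> (g ^ s)%g = k.
  move=> gG ek; apply/permP => y; apply: (can_inj eK).
  by rewrite ek conjgE !permM es ef // -es permKV.
exists s; apply/setP => k; apply/imsetP/idP => [[g gG ->]|kK].
  case: (eqVneq g 1%g) => [->|g1]; first by rewrite conj1g group1.
  have := phiH g gG g1; rewrite !inE => /andP[_ /HK[k' k'K ek]].
  by rewrite (conjE _ _ gG ek).
have [h hH ek] := KH k kK.
case: (eqVneq h 1%g) => [h1|h1].
  exists 1%g => //; rewrite conj1g; apply/permP => x; apply: (can_inj eK).
  by rewrite ek h1 !perm1.
have : h \in H^#%g by rewrite !inE h1.
rewrite -iso => /imsetP[g]; rewrite !inE => /andP[_ gG] eh; exists g => //.
by rewrite (conjE _ _ gG (fun x => etrans (ek x) (congr1 (fun p : {perm U} => p (e x)) eh))).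
Qed.

End Realization.

Import GRing.Theory.

Lemma gen_group_ind (n : nat) (N : seq (seq nat)) (K : 'S_n -> Prop) :
  K 1%g -> (forall g h, K g -> K h -> K (g * h)%g) ->
  (forall g, images g \in N -> K g) -> forall g, g \in gen_group n N -> K g.
Proof.
move=> K1 KM KN g /gen_prodgP[m [c cN ->]]; apply: big_ind => // i _.
by apply: KN; have := cN i; rewrite inE.
Qed.

Lemma transport_perm (n : nat) (U : finType) (e : 'I_n -> U) (g : 'S_n) :
  bijective e -> exists p : {perm U}, forall x, e (g x) = p (e x).
Proof.
case=> e' eK e'K.
exists (perm (inj_comp (inj_comp (can_inj eK) (@perm_inj _ g)) (can_inj e'K))) => x.
by rewrite permE /= eK.
Qed.

Section Induced.
Variables (n : nat) (T : finType) (P : pred {set T}) (e : 'I_n -> {A : {set T} | P A}).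
Variables (C : (T -> T) -> Prop) (H : {set {perm {A : {set T} | P A}}}).
Hypothesis bij_e : bijective e.
Hypothesis HP : forall p, p \in H <-> exists2 f, C f & induced_by f p.
Hypothesis C1 : C id.
Hypothesis CM : forall f f', C f -> C f' -> C (f' \o f).

Definition moves (g : 'S_n) (f : T -> T) : Prop :=
  forall i, val (e (g i)) = f @: val (e i).

Lemma moves1 : moves 1%g id.
Proof. by move=> i; rewrite perm1 imset_id. Qed.

Lemma movesM g h f f' : moves g f -> moves h f' -> moves (g * h)%g (f' \o f).
Proof. by move=> mg mh i; rewrite permM mh mg imset_comp. Qed.

(** Compatibility is checked on generators and extends to products because [C] is closed under
    composition; [bij_e] makes the induced permutation of the subsets available. *)
Lemma realizes_induced N :
  (forall g, images g \in N -> exists2 f, C f & moves g f) ->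
  (forall f, C f -> exists2 g, g \in gen_group n N & moves g f) ->
  realizes e (gen_group n N) H.
Proof.
move=> NC CN; split=> [g gN|p /HP[f /CN[g gN mg] /forallP ip]].
  have [f Cf mg] : exists2 f, C f & moves g f.
    apply: (gen_group_ind (K := fun g => exists2 f, C f & moves g f) _ _ NC gN).
      by exists id => //; apply: moves1.
    move=> g1 g2 [f1 C1' m1] [f2 C2 m2]; exists (f2 \o f1); first exact: CM.
    exact: movesM.
  have [p ep] := transport_perm g bij_e; exists p => //; apply/HP; exists f => //.
  by case: bij_e => e' _ e'K; apply/forallP => A; rewrite -(e'K A) -ep mg.
exists g => // x; apply: val_inj; rewrite mg; apply/esym/eqP; exact: ip.
Qed.

End Induced.

(** * The projective groups of degree two *)

Section ProjectiveLine.
Variable F : finFieldType.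
Local Open Scope ring_scope.
Implicit Types (a b c d x y : F).

Definition vec2 x y : 'rV[F]_2 := \row_j (if j == 0 then x else y).
Definition mat2 a b c d : 'M[F]_2 :=
  \matrix_(i, j) (if i == 0 then (if j == 0 then a else b) else (if j == 0 then c else d)).
Definition line x y : {set 'rV[F]_2} := [set z *: vec2 x y | z : F].

Lemma vec2E (v : 'rV[F]_2) : v = vec2 (v 0 0) (v 0 1).
Proof.
by apply/rowP; case=> [[|[|m]] lt] //; rewrite mxE /=; congr (v 0 _); apply: val_inj.
Qed.

Lemma mat2E (A : 'M[F]_2) : A = mat2 (A 0 0) (A 0 1) (A 1 0) (A 1 1).
Proof.
apply/matrixP => i j; rewrite mxE.
by case: i => [[|[|m]] lti] //; case: j => [[|[|m']] ltj] //; congr (A _ _); apply: val_inj.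
Qed.

Lemma vec2_mat2 x y a b c d :
  vec2 x y *m mat2 a b c d = vec2 (x * a + y * c) (x * b + y * d).
Proof.
by apply/rowP => j; rewrite !mxE big_ord_recl big_ord1 !mxE /=; case: eqP.
Qed.

Lemma scale_vec2 z x y : z *: vec2 x y = vec2 (z * x) (z * y).
Proof. by apply/rowP => j; rewrite !mxE; case: eqP. Qed.

Lemma mul_mat2 a b c d a' b' c' d' : mat2 a b c d *m mat2 a' b' c' d' =
  mat2 (a * a' + b * c') (a * b' + b * d') (c * a' + d * c') (c * b' + d * d').
Proof.
apply/matrixP => i j; rewrite !mxE big_ord_recl big_ord1 !mxE /=.
by case: eqP => _; case: eqP.
Qed.

Lemma det_mat2 a b c d : \det (mat2 a b c d) = a * d - b * c.
Proof.
by rewrite (expand_det_row _ 0) big_ord_recl big_ord1 /cofactor !det_mx11 !mxE /=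
  expr0 expr1 mul1r mulN1r mulrN.
Qed.

Lemma vec2_inj x y x' y' : vec2 x y = vec2 x' y' -> x = x' /\ y = y'.
Proof.
by move/rowP => e; have := e 0; have := e 1; rewrite !mxE.
Qed.

Lemma line_scale z x y : z != 0 -> line (z * x) (z * y) = line x y.
Proof.
move=> z0; apply/setP=> v; apply/imsetP/imsetP => -[t _ ->].
  by exists (t * z); rewrite // !scale_vec2 !mulrA.
by exists (t / z); rewrite // !scale_vec2 !mulrA divfK.
Qed.

Lemma line_mat2 a b c d x y :
  (fun v => v *m mat2 a b c d) @: line x y = line (x * a + y * c) (x * b + y * d).
Proof.
rewrite -imset_comp; apply: eq_imset => z /=.
by rewrite -scalemxAl vec2_mat2.
Qed.

Lemma line_frobenius (s : {perm F}) x y : field_automorphism s ->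
  (fun v => map_mx s v) @: line x y = line (s x) (s y).
Proof.
case/andP=> _ /forallP sM; rewrite -imset_comp; apply/setP=> v.
have sMul z t : s (z * t) = s z * s t.
  by have /forallP/(_ t)/andP[_ /eqP] := sM z.
have mapE z : map_mx s (z *: vec2 x y) = s z *: vec2 (s x) (s y).
  by apply/rowP => j; rewrite !mxE sMul; case: eqP.
apply/imsetP/imsetP => -[z _ ->]; first by exists (s z); rewrite //= mapE.
by exists ((s^-1)%g z); rewrite //= mapE permKV.
Qed.

Lemma is_line_line x y : (x != 0) || (y != 0) -> is_line (line x y).
Proof.
move=> xy; apply/existsP; exists (vec2 x y); rewrite eqxx andbT.
apply: contraL xy => /eqP e; have [-> ->] : x = 0 /\ y = 0.
  by move/rowP: e => e; have := e 0; have := e 1; rewrite !mxE.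
by rewrite eqxx.
Qed.

End ProjectiveLine.

Lemma inj_surj_bij (T U : finType) (f : T -> U) :
  injective f -> (forall y, exists x, f x == y) -> bijective f.
Proof.
move=> inj surj; exists (fun y => xchoose (surj y)) => [x|y].
  by apply: inj; apply/eqP; apply: (xchooseP (surj (f x))).
by apply/eqP; apply: (xchooseP (surj y)).
Qed.

(* The element of F with index i is [x_ i]; the point with index i is the line
   through (1, x_i) for i < q, and the line through (0, 1) for i = q. *)
Section Labelled.
Local Open Scope ring_scope.
Variables (F : finFieldType) (q : nat) (x_ : nat -> F) (add mul : nat -> nat -> nat).
Hypothesis add_ : forall i j, x_ (add i j) = x_ i + x_ j.
Hypothesis mul_ : forall i j, x_ (mul i j) = x_ i * x_ j.
Hypothesis zero_ : x_ 0 = 0.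
Hypothesis one_ : x_ 1 = 1.
Hypothesis x_inj : forall i j, (i < q)%N -> (j < q)%N -> x_ i = x_ j -> i = j.
Hypothesis x_surj : forall y, exists2 i, (i < q)%N & x_ i = y.

Definition px (i : nat) : nat := if (i < q)%N then 1%N else 0%N.
Definition py (i : nat) : nat := if (i < q)%N then i else 1%N.

Lemma pxy_neq0 (i : nat) : (x_ (px i) != 0) || (x_ (py i) != 0).
Proof. by rewrite /px /py; case: ifP; rewrite one_ oner_eq0 ?orbT. Qed.

Definition point (i : 'I_q.+1) : proj_line F :=
  exist _ (line (x_ (px i)) (x_ (py i))) (is_line_line (pxy_neq0 i)).

Lemma mem_line (x y : F) : vec2 x y \in line x y.
Proof. by apply/imsetP; exists 1; rewrite // scale1r. Qed.

Lemma point_bij : bijective point.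
Proof.
apply: inj_surj_bij => [i j /(congr1 val) /= e|[L linL]].
  have := mem_line (x_ (px i)) (x_ (py i)); rewrite e => /imsetP[z _].
  have := mem_line (x_ (px j)) (x_ (py j)); rewrite -e => /imsetP[z' _].
  rewrite !scale_vec2 /px /py => /vec2_inj[e1 e2] /vec2_inj[e3 e4]; apply: val_inj => /=.
  move: e1 e2 e3 e4; case: ltnP => ltj; case: ltnP => lti; rewrite ?one_ ?zero_ ?mulr0 ?mulr1.
  - by move=> <-; rewrite mul1r => e2 _ _; apply: x_inj.
  - by move=> /eqP; rewrite oner_eq0.
  - by move=> _ _ /eqP; rewrite oner_eq0.
  - by move=> *; apply/eqP; rewrite eqn_leq; apply/andP; split;
      apply: leq_trans (_ : _ <= q)%N _; rewrite // -ltnS.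
have /existsP[v /andP[v0 /eqP eL]] := linL.
move: v0 eL; rewrite (vec2E v); move: (v 0 0) (v 0 1) => a b v0 eL.
case: (eqVneq a 0) => [a0|a0].
  exists ord_max; apply/eqP/val_inj; rewrite /= eL /px /py ltnn zero_ one_ a0.
  have b0 : b != 0.
    apply: contraNneq v0 => b0; rewrite a0 b0; apply/eqP/rowP => j.
    by rewrite !mxE if_same.
  by rewrite -(line_scale _ _ b0) mulr0 mulr1.
have [i ltiq ei] := x_surj (b / a).
exists (widen_ord (leqnSn q) (Ordinal ltiq)); apply/eqP/val_inj; rewrite /= eL /px /py ltiq.
by rewrite one_ ei -(line_scale _ _ a0) mulr1 mulrCA divff // mulr1.
Qed.

(** A computation with indices only: the image (u, w) of the coordinates of point i must be u (1, j)
    with u nonzero if j < q, and w (0, 1) with w nonzero if j = q. *)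
Definition matrix_check (a b c d : nat) (p : seq nat) : bool :=
  all (fun i => let u := add (mul (px i) a) (mul (py i) c) in
                let w := add (mul (px i) b) (mul (py i) d) in
                let j := nth 0%N p i in
                if (j < q)%N then [&& (0 < u)%N, (u < q)%N & w == mul u j]
                else [&& u == 0%N, (0 < w)%N & (w < q)%N]) (iota 0 q.+1).

Definition by_matrix (A : 'M[F]_2) (v : 'rV[F]_2) : 'rV[F]_2 := v *m A.

Lemma x_neq0 (i : nat) : (0 < i)%N -> (i < q)%N -> x_ i != 0.
Proof.
move=> i0 iq; apply/eqP; rewrite -zero_ => /x_inj e.
by rewrite e ?ltnn // (leq_ltn_trans _ iq) in i0.
Qed.

Lemma matrix_checkP (a b c d : nat) (g : 'S_q.+1) : matrix_check a b c d (images g) ->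
  moves point g (by_matrix (mat2 (x_ a) (x_ b) (x_ c) (x_ d))).
Proof.
move/allP=> chk i; have := chk (val i); rewrite mem_iota add0n ltn_ord => /(_ isT).
rewrite nth_images /= line_mat2 -!mul_ -!add_.
set u := add _ _; set w := add _ _; rewrite /px /py; case: ifP => _.
  case/and3P=> u0 uq /eqP ->; rewrite mul_ one_.
  by rewrite -(line_scale 1 (x_ (g i)) (x_neq0 u0 uq)) mulr1.
case/and3P=> /eqP -> w0 wq; rewrite zero_ one_.
by rewrite -(line_scale 0 1 (x_neq0 w0 wq)) mulr0 mulr1.
Qed.

Section Generated.
Variable N : seq (seq nat).

Definition reached (f : 'rV[F]_2 -> 'rV[F]_2) : Prop :=
  exists2 g, g \in gen_group q.+1 N & moves point g f.

Lemma reached_list (a b c d : nat) (p : seq nat) : p \in N -> perm_list q.+1 p ->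
  matrix_check a b c d p -> reached (by_matrix (mat2 (x_ a) (x_ b) (x_ c) (x_ d))).
Proof.
move=> pN pp chk; have /listedP[g gN eg] := gen_group_perm_list pN pp.
by exists g => //; apply: matrix_checkP; rewrite eg.
Qed.

Lemma reached_comp f f' : reached f -> reached f' -> reached (f' \o f).
Proof.
case=> g gN mg [h hN mh]; exists (g * h)%g; first by rewrite groupM.
exact: movesM.
Qed.

Lemma reached_ext f f' : f =1 f' -> reached f -> reached f'.
Proof. by move=> ff' [g gN mg]; exists g => // i; rewrite mg; apply: eq_imset. Qed.

Lemma reachedM A B :
  reached (by_matrix A) -> reached (by_matrix B) -> reached (by_matrix (A *m B)).
Proof.
move=> rA rB; apply: reached_ext (reached_comp rA rB) => v.
by rewrite /by_matrix /= mulmxA.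
Qed.

Lemma reached1 : reached (by_matrix (mat2 1 0 0 1)).
Proof.
exists 1%g; first exact: group1.
move=> i; rewrite perm1 /by_matrix /= line_mat2.
by rewrite !mulr0 !mulr1 addr0 add0r.
Qed.

Variables (u v : nat).
Hypothesis span : forall y, exists m m', y = x_ u *+ m + x_ v *+ m'.
Hypothesis upper_u : reached (by_matrix (mat2 1 (x_ u) 0 1)).
Hypothesis upper_v : reached (by_matrix (mat2 1 (x_ v) 0 1)).
Hypothesis lower_u : reached (by_matrix (mat2 1 0 (x_ u) 1)).
Hypothesis lower_v : reached (by_matrix (mat2 1 0 (x_ v) 1)).

Lemma reached_upper y : reached (by_matrix (mat2 1 y 0 1)).
Proof.
have upperD x y' : reached (by_matrix (mat2 1 x 0 1)) -> reached (by_matrix (mat2 1 y' 0 1)) ->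
    reached (by_matrix (mat2 1 (x + y') 0 1)).
  move=> rx ry; have := reachedM rx ry; rewrite mul_mat2.
  by rewrite !mulr0 !mul0r !mulr1 !mul1r addr0 !add0r addrC.
have upperMn x m : reached (by_matrix (mat2 1 x 0 1)) ->
    reached (by_matrix (mat2 1 (x *+ m) 0 1)).
  move=> rx; elim: m => [|m IH]; first by rewrite mulr0n; apply: reached1.
  by rewrite mulrS; apply: upperD.
by have [m [m' ->]] := span y; apply: (upperD); apply: upperMn.
Qed.

Lemma reached_lower y : reached (by_matrix (mat2 1 0 y 1)).
Proof.
have lowerD x y' : reached (by_matrix (mat2 1 0 x 1)) -> reached (by_matrix (mat2 1 0 y' 1)) ->
    reached (by_matrix (mat2 1 0 (x + y') 1)).
  move=> rx ry; have := reachedM rx ry; rewrite mul_mat2.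
  by rewrite !mulr0 !mul0r !mulr1 !mul1r ?addr0 ?add0r.
have lowerMn x m : reached (by_matrix (mat2 1 0 x 1)) ->
    reached (by_matrix (mat2 1 0 (x *+ m) 1)).
  move=> rx; elim: m => [|m IH]; first by rewrite mulr0n; apply: reached1.
  by rewrite mulrS; apply: lowerD.
by have [m [m' ->]] := span y; apply: (lowerD); apply: lowerMn.
Qed.

(** SL(2,F) is generated by transvections: a matrix with c nonzero is a product upper, lower, upper,
    and one with c = 0 becomes of this kind after multiplication by a lower one. By [span],
    transvections for the additive generators [x_ u] and [x_ v] are enough. *)
Lemma reached_SL2 A : \det A = 1 -> reached (by_matrix A).
Proof.
have main a b c d : c != 0 -> a * d - b * c = 1 -> reached (by_matrix (mat2 a b c d)).
  move=> c0 det1.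
  have -> : mat2 a b c d =
      mat2 1 ((a - 1) / c) 0 1 *m mat2 1 0 c 1 *m mat2 1 ((d - 1) / c) 0 1.
    have eb : b = (a * d - 1) / c by rewrite -det1 opprB addrC subrK mulfK.
    by rewrite !mul_mat2 eb; congr mat2; field.
  by apply: reachedM (reached_upper _); apply: reachedM (reached_upper _) (reached_lower _).
rewrite (mat2E A) det_mat2; move: (A 0 0) (A 0 1) (A 1 0) (A 1 1) => a b c d.
case: (eqVneq c 0) => [-> |c0]; last exact: main.
rewrite mulr0 subr0 => ad; have a0 : a != 0.
  by apply/eqP => a0; move/eqP: ad; rewrite a0 mul0r eq_sym oner_eq0.
have -> : mat2 a b 0 d = mat2 1 0 (-1) 1 *m mat2 a b a (b + d).
  by rewrite !mul_mat2; congr mat2; ring.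
apply: reachedM (reached_lower _) _; apply: main => //.
by rewrite -ad; ring.
Qed.

End Generated.

Definition mat_of (m : nat * nat * nat * nat) : 'M[F]_2 :=
  mat2 (x_ m.1.1.1) (x_ m.1.1.2) (x_ m.1.2) (x_ m.2).
Definition sl_check (m : nat * nat * nat * nat) : bool :=
  add (mul m.1.1.2 m.1.2) 1 == mul m.1.1.1 m.2.
Definition gen_check (p : seq nat) (m : nat * nat * nat * nat) : bool :=
  perm_list q.+1 p && matrix_check m.1.1.1 m.1.1.2 m.1.2 m.2 p.

Lemma sl_checkP m : sl_check m -> \det (mat_of m) = 1.
Proof.
case: m => [[[a b] c] d] /eqP /= e; rewrite /mat_of det_mat2 /= -!mul_ -e add_ one_.
by rewrite addrC addKr.
Qed.

Lemma reached_gen N p m : p \in N -> gen_check p m -> reached N (by_matrix (mat_of m)).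
Proof. by move=> pN /andP[]; apply: reached_list. Qed.

Lemma moves_gen g m : gen_check (images g) m -> moves point g (by_matrix (mat_of m)).
Proof. by case/andP=> _; apply: matrix_checkP. Qed.

Definition in_SL2 (f : 'rV[F]_2 -> 'rV[F]_2) : Prop :=
  exists2 A, \det A = 1 & f =1 by_matrix A.

Lemma PSL2P p : p \in PSL2 F <-> exists2 f, in_SL2 f & induced_by f p.
Proof.
rewrite inE; split=> [/existsP[A /andP[/eqP dA ip]]|[f [A dA fA] /forallP ip]].
  by exists (by_matrix A) => //; exists A.
apply/existsP; exists A; rewrite dA eqxx; apply/forallP => L.
by rewrite (eqP (ip L)); apply/eqP/eq_imset => w; apply: fA.
Qed.

Lemma in_SL2_id : in_SL2 id.
Proof. by exists 1%:M; [exact: det1 | move=> w; rewrite /by_matrix mulmx1]. Qed.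

Lemma in_SL2_comp f f' : in_SL2 f -> in_SL2 f' -> in_SL2 (f' \o f).
Proof.
case=> A dA fA [B dB fB]; exists (A *m B); first by rewrite det_mulmx dA dB mulr1.
by move=> w; rewrite /= fA fB /by_matrix mulmxA.
Qed.

Section TransvectionGenerators.
Variables (u v : nat) (N : seq (seq nat)).
Hypothesis span : forall y, exists m m', y = x_ u *+ m + x_ v *+ m'.
Hypothesis transvections :
  all (fun m => has (fun p => gen_check p m) N)
    [:: (1, u, 0, 1); (1, v, 0, 1); (1, 0, u, 1); (1, 0, v, 1)]%N.

Lemma transvections_SL2 A : \det A = 1 -> reached N (by_matrix A).
Proof.
have tr m : has (fun p => gen_check p m) N -> reached N (by_matrix (mat_of m)).
  by case/hasP => p pN; apply: reached_gen.
move: transvections; rewrite /= andbT => /and4P[/tr uu /tr uv /tr lu /tr lv] dA.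
move: uu uv lu lv; rewrite /mat_of /= zero_ one_ => uu uv lu lv.
exact: (reached_SL2 span uu uv lu lv).
Qed.

Lemma realizes_PSL2 :
  all (fun p => has (fun m => sl_check m && gen_check p m)
    [:: (1, u, 0, 1); (1, v, 0, 1); (1, 0, u, 1); (1, 0, v, 1)]%N) N ->
  realizes point (gen_group q.+1 N) (PSL2 F).
Proof.
move/allP=> allN; apply: (realizes_induced point_bij PSL2P in_SL2_id in_SL2_comp).
  move=> g /allN/hasP[m _ /andP[/sl_checkP dm gm]]; exists (by_matrix (mat_of m)).
    by exists (mat_of m).
  exact: moves_gen.
by move=> f [A dA fA]; apply: reached_ext (transvections_SL2 dA) => w; rewrite fA.
Qed.

Definition in_GL2 (f : 'rV[F]_2 -> 'rV[F]_2) : Prop :=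
  exists2 A, A \in unitmx & f =1 by_matrix A.

Lemma PGL2P p : p \in PGL2 F <-> exists2 f, in_GL2 f & induced_by f p.
Proof.
rewrite inE; split=> [/existsP[A /andP[uA ip]]|[f [A uA fA] /forallP ip]].
  by exists (by_matrix A) => //; exists A.
apply/existsP; exists A; rewrite uA; apply/forallP => L.
by rewrite (eqP (ip L)); apply/eqP/eq_imset => w; apply: fA.
Qed.

(** Any invertible A is diag(1, det A) times a matrix of determinant 1, and det A is a power of the
    primitive element [x_ d]. *)
Lemma realizes_PGL2 (d : nat) (r : seq nat) :
  (forall y : F, y != 0 -> exists i, y = x_ d ^+ i) -> x_ d != 0 ->
  all (fun p => has (fun m => sl_check m && gen_check p m)
    [:: (1, u, 0, 1); (1, v, 0, 1); (1, 0, u, 1); (1, 0, v, 1)]%N ||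
    (p == r)) N -> r \in N -> gen_check r (1, 0, 0, d)%N ->
  realizes point (gen_group q.+1 N) (PGL2 F).
Proof.
move=> prim d0 /allP allN rN rr.
have diag : reached N (by_matrix (mat2 1 0 0 (x_ d))).
  by have := reached_gen rN rr; rewrite /mat_of /= zero_ one_.
apply: (realizes_induced point_bij PGL2P).
- by exists 1%:M; [exact: unitmx1 | move=> w; rewrite /by_matrix mulmx1].
- move=> f f' [A uA fA] [B uB fB]; exists (A *m B); first by rewrite unitmx_mul uA.
  by move=> w; rewrite /= fA fB /by_matrix mulmxA.
- move=> g /allN/orP[/hasP[m _ /andP[/sl_checkP dm gm]]|/eqP eg].
    exists (by_matrix (mat_of m)); last exact: moves_gen.
    by exists (mat_of m) => //; rewrite unitmxE dm unitr1.
  exists (by_matrix (mat_of (1, 0, 0, d)%N)); last by apply: moves_gen; rewrite eg.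
  exists (mat_of (1, 0, 0, d)%N) => //; rewrite unitmxE /mat_of det_mat2 /= zero_ one_.
  by rewrite mul1r mul0r subr0 unitfE.
move=> f [A uA fA]; have dA : \det A != 0 by rewrite -unitfE -unitmxE.
have [i ei] := prim _ dA.
have diagX : reached N (by_matrix (mat2 1 0 0 (x_ d ^+ i))).
  elim: i {ei} => [|i IH]; first by rewrite expr0; apply: reached1.
  have := reachedM IH diag; rewrite mul_mat2 exprSr.
  by rewrite !mulr0 !mul0r !mul1r !addr0 add0r.
suff [B dB eA] : exists2 B, \det B = 1 & A = mat2 1 0 0 (x_ d ^+ i) *m B.
  apply: reached_ext (reachedM diagX (transvections_SL2 dB)) => w.
  by rewrite fA eA.
have z0 : x_ d ^+ i != 0 by rewrite -ei.
exists (mat2 (A 0 0) (A 0 1) (A 1 0 / x_ d ^+ i) (A 1 1 / x_ d ^+ i)).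
  have := ei; rewrite {1}(mat2E A) !det_mat2 => e.
  by rewrite !mulrA -mulrBl e divff.
rewrite [LHS]mat2E mul_mat2; congr mat2; rewrite ?mul0r ?mul1r ?add0r ?addr0 //.
  by rewrite mulrC divfK.
by rewrite mulrC divfK.
Qed.

Definition semilinear (f : 'rV[F]_2 -> 'rV[F]_2) : Prop :=
  exists2 A, \det A = 1 & exists2 s : {perm F}, field_automorphism s &
    f =1 fun w => by_matrix A (map_mx s w).

Lemma PSigmaL2P p : p \in PSigmaL2 F <-> exists2 f, semilinear f & induced_by f p.
Proof.
rewrite inE; split.
  case/existsP=> A /existsP[s /and3P[/eqP dA ss ip]].
  by exists (fun w => map_mx s w *m A) => //; exists A => //; exists s.
case=> f [A dA [s ss fA]] /forallP ip.
apply/existsP; exists A; apply/existsP; exists s; rewrite dA eqxx ss.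
by apply/forallP => L; rewrite (eqP (ip L)); apply/eqP/eq_imset => w; apply: fA.
Qed.

Lemma field_automorphismM (s s' : {perm F}) :
  field_automorphism s -> field_automorphism s' -> field_automorphism (s * s')%g.
Proof.
case/andP=> /eqP s1 /forallP sA /andP[/eqP s'1 /forallP s'A].
apply/andP; split; first by rewrite permM s1 s'1.
apply/forallP => x; apply/forallP => y; rewrite !permM.
have /forallP/(_ y)/andP[/eqP-> /eqP->] := sA x.
by have /forallP/(_ (s y)) := s'A (s x).
Qed.

Lemma map_mat2 (s : {perm F}) a b c d :
  map_mx s (mat2 a b c d) = mat2 (s a) (s b) (s c) (s d).
Proof.
apply/matrixP => i j; rewrite !mxE.
by case: eqP => _; case: eqP.
Qed.

Lemma map_vec2 (s : {perm F}) a b : map_mx s (vec2 a b) = vec2 (s a) (s b).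
Proof. by apply/rowP => j; rewrite !mxE; case: eqP. Qed.

Lemma semilinear_comp f f' : semilinear f -> semilinear f' -> semilinear (f' \o f).
Proof.
case=> A dA [s ss fA] [B dB [t tt fB]].
have tD x y : t (x + y) = t x + t y.
  by case/andP: tt => _ /forallP/(_ x)/forallP/(_ y)/andP[/eqP].
have tM x y : t (x * y) = t x * t y.
  by case/andP: tt => _ /forallP/(_ x)/forallP/(_ y)/andP[_ /eqP].
have t1 : t 1 = 1 by case/andP: tt => /eqP.
have tB x y : t (x - y) = t x - t y.
  by apply: (@addIr _ (t y)); rewrite -tD !subrK.
exists (map_mx t A *m B).
  rewrite det_mulmx dB mulr1 (mat2E A) map_mat2 det_mat2 -!tM -tB.
  by rewrite -det_mat2 -mat2E dA.
exists (s * t)%g; first exact: field_automorphismM.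
move=> w; rewrite /= fA fB /by_matrix mulmxA; congr (_ *m _).
rewrite (vec2E w) (mat2E A) !map_vec2 map_mat2 !vec2_mat2 map_vec2 !tD !tM.
by rewrite !permM.
Qed.

Lemma realizes_PSigmaL2 (cj : nat -> nat) (r : seq nat) :
  (exists2 s : {perm F}, field_automorphism s & forall i, s (x_ i) = x_ (cj i)) ->
  (forall s : {perm F}, field_automorphism s ->
     (forall y, s y = y) \/ (forall i, s (x_ i) = x_ (cj i))) ->
  all (fun p => has (fun m => sl_check m && gen_check p m)
    [:: (1, u, 0, 1); (1, v, 0, 1); (1, 0, u, 1); (1, 0, v, 1)]%N ||
    (p == r)) N -> r \in N -> perm_list q.+1 r ->
  all (fun i => (cj (px i) == px (nth 0%N r i)) && (cj (py i) == py (nth 0%N r i)))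
    (iota 0 q.+1) ->
  realizes point (gen_group q.+1 N) (PSigmaL2 F).
Proof.
move=> [s0 s0a s0x] autos /allP allN rN pr /allP rx.
have moves_r (g : 'S_q.+1) (s : {perm F}) : images g = r -> field_automorphism s ->
    (forall i, s (x_ i) = x_ (cj i)) -> moves point g (fun w => map_mx s w).
  move=> eg sa sx i; rewrite /= line_frobenius // !sx.
  have := rx (val i); rewrite mem_iota add0n ltn_ord => /(_ isT).
  by rewrite -eg nth_images => /andP[/eqP -> /eqP ->].
apply: (realizes_induced point_bij PSigmaL2P _ semilinear_comp).
- exists 1%:M; first exact: det1.
  exists 1%g; last by move=> w; rewrite /by_matrix mulmx1; apply/rowP => j; rewrite mxE perm1.
  rewrite /field_automorphism perm1 eqxx; apply/forallP => x; apply/forallP => y.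
  by rewrite !perm1 !eqxx.
- move=> g /allN/orP[/hasP[m _ /andP[/sl_checkP dm gm]]|/eqP eg].
    exists (by_matrix (mat_of m)); last exact: moves_gen.
    exists (mat_of m) => //; exists 1%g; last first.
      by move=> w; congr by_matrix; apply/rowP => j; rewrite mxE perm1.
    rewrite /field_automorphism perm1 eqxx; apply/forallP => x; apply/forallP => y.
    by rewrite !perm1 !eqxx.
  exists (fun w => map_mx s0 w); last exact: moves_r.
  by exists 1%:M; [exact: det1 | exists s0 => // w; rewrite /by_matrix mulmx1].
move=> f [A dA [s sa fA]]; have rA := transvections_SL2 dA.
suff rs : reached N (fun w => map_mx s w) by apply: reached_ext (reached_comp rs rA) => w; rewrite
  fA.
case: (autos s sa) => [sid|sx].
  apply: (reached_ext _ (reached1 N)) => w; rewrite (vec2E w) /by_matrix vec2_mat2 map_vec2.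
  by rewrite !mulr0 !mulr1 addr0 add0r !sid.
have /listedP[g gN eg] := gen_group_perm_list rN pr.
by exists g => //; apply: moves_r.
Qed.

End TransvectionGenerators.
End Labelled.

Section PrimeField.
Local Open Scope ring_scope.
Variable p : nat.
Hypothesis p_pr : prime p.

Definition fp_elt (i : nat) : 'F_p := i%:R.
Definition fp_add (i j : nat) : nat := ((i + j) %% p)%N.
Definition fp_mul (i j : nat) : nat := ((i * j) %% p)%N.

Lemma fp_elt_add i j : fp_elt (fp_add i j) = fp_elt i + fp_elt j.
Proof. by rewrite /fp_elt Fp_nat_mod // natrD. Qed.

Lemma fp_elt_mul i j : fp_elt (fp_mul i j) = fp_elt i * fp_elt j.
Proof. by rewrite /fp_elt Fp_nat_mod // natrM. Qed.

Lemma fp_elt_inj i j : (i < p)%N -> (j < p)%N -> fp_elt i = fp_elt j -> i = j.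
Proof.
move=> ltip ltjp /(congr1 val); rewrite /= !(val_Fp_nat p_pr) => e.
by rewrite -(modn_small ltip) -(modn_small ltjp).
Qed.

Lemma fp_elt_surj (y : 'F_p) : exists2 i, (i < p)%N & fp_elt i = y.
Proof.
exists (val y); last by rewrite /fp_elt natr_Zp.
by have := ltn_ord y; rewrite [X in (_ < X)%N -> _](Fp_cast p_pr).
Qed.

Lemma fp_span (y : 'F_p) : exists m m', y = fp_elt 1 *+ m + fp_elt 1 *+ m'.
Proof.
have [i _ <-] := fp_elt_surj y; exists i, 0%N.
by rewrite mulr0n addr0 /fp_elt.
Qed.

End PrimeField.

(** * The field with nine elements and its automorphisms *)

Section NineElements.
Local Open Scope ring_scope.
Local Notation h9 := ('X^2 + 1 : {poly 'F_3}).

Lemma mk_monic9 : mk_monic h9 = h9.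
Proof. exact: (mk_monicE X2D1_monic_irreducible). Qed.

Definition iota9 : GF9 := in_qpoly h9 'X.

Lemma iota9_sqr : iota9 * iota9 = -1.
Proof.
suff : in_qpoly h9 'X * in_qpoly h9 'X = - 1 by [].
apply/eqP; rewrite -addr_eq0 -in_qpolyM -expr2 -(in_qpoly1 h9) -in_qpolyD.
apply/eqP/val_inj; rewrite /= mk_monic9 Pdiv.RingMonic.rmodpp //.
by case: X2D1_monic_irreducible.
Qed.

Lemma three9 : (3%:R : GF9) = 0.
Proof.
suff : 3%N \in [pchar {poly %/ h9}] by case/andP=> _ /eqP.
by rewrite pchar_qpoly pchar_Fp.
Qed.

Definition elt9 (i : nat) : GF9 := (i %% 3)%:R + (i %/ 3)%:R * iota9.
Definition code9 (a b : nat) : nat := (a %% 3 + 3 * (b %% 3))%N.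
Definition add9 (i j : nat) : nat := code9 (i %% 3 + j %% 3) (i %/ 3 + j %/ 3).
Definition mul9 (i j : nat) : nat :=
  code9 ((i %% 3) * (j %% 3) + 2 * ((i %/ 3) * (j %/ 3)))
        ((i %% 3) * (j %/ 3) + (i %/ 3) * (j %% 3)).
Definition conj9 (i : nat) : nat := code9 i (2 * (i %/ 3)).

Lemma natr_mod3 a : ((a %% 3)%:R : GF9) = a%:R.
Proof. by rewrite [in RHS](divn_eq a 3) natrD natrM three9 mulr0 add0r. Qed.

Lemma elt9_code a b : elt9 (code9 a b) = a%:R + b%:R * iota9.
Proof.
have -> : a%:R = (a %% 3)%:R :> GF9 by rewrite natr_mod3.
have -> : b%:R = (b %% 3)%:R :> GF9 by rewrite natr_mod3.
by rewrite /elt9 /code9; congr (_%:R + _%:R * _); lia.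
Qed.

Lemma elt9_add i j : elt9 (add9 i j) = elt9 i + elt9 j.
Proof. by rewrite elt9_code !natrD /elt9; ring. Qed.

Lemma elt9_mul i j : elt9 (mul9 i j) = elt9 i * elt9 j.
Proof.
(* The 2 in [mul9] stands for -1; replacing it by the square of [iota9] leaves an identity valid in
   every commutative ring. *)
have two9 : (2%:R : GF9) = iota9 * iota9.
  by rewrite iota9_sqr; apply/eqP; rewrite -subr_eq0 opprK natr1 three9.
rewrite elt9_code natrD [in X in X * iota9]natrD !natrM two9 /elt9.
ring.
Qed.

Lemma natr_F3 (c : 'F_3) : in_qpoly h9 c%:P = (val c)%:R.
Proof. by rewrite -[in LHS](natr_Zp c) polyC_natr rmorph_nat. Qed.

Lemma elt9_surj (y : GF9) : exists2 i, (i < 9)%N & elt9 i = y.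
Proof.
have sz : (size (val y : {poly 'F_3}) <= 2)%N.
  by apply: leq_trans (size_npoly y) _; rewrite mk_monic9 -polyC1 size_XnaddC.
exists (code9 (val (val y : {poly 'F_3})`_0) (val (val y : {poly 'F_3})`_1)).
  by rewrite /code9; have := ltn_pmod; lia.
pose p := val y : {poly 'F_3}; have ep : p = (p`_0)%:P + (p`_1)%:P * 'X.
  apply/polyP => -[|[|i]]; rewrite coefD coefC coefMX coefC /= ?addr0 ?add0r //.
  by rewrite nth_default // (leq_trans sz).
rewrite elt9_code -!natr_F3.
suff : in_qpoly h9 (p`_0)%:P + in_qpoly h9 (p`_1)%:P * in_qpoly h9 'X = y by [].
rewrite -in_qpolyM -in_qpolyD -ep; apply/val_inj/in_qpoly_small.
by rewrite mk_monic9 -polyC1 size_XnaddC.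
Qed.

Lemma elt9_inj i j : (i < 9)%N -> (j < 9)%N -> elt9 i = elt9 j -> i = j.
Proof.
move=> lti ltj e.
have c9 : #|GF9| = 9.
  by rewrite card_qfpoly -polyC1 size_XnaddC //= card_Fp.
have surj : codom (fun i : 'I_9 => elt9 i) =i predT.
  by move=> y; have [k ltk ek] := elt9_surj y; apply/codomP; exists (Ordinal ltk).
have /injectiveP inj : injectiveb (fun i : 'I_9 => elt9 i).
  by rewrite /injectiveb /dinjectiveb -/(codom _); apply/card_uniqP;
    rewrite (eq_card surj) c9 size_codom card_ord.
by have /(congr1 val) := inj (Ordinal lti) (Ordinal ltj) e.
Qed.

Lemma elt9_span (y : GF9) : exists m m', y = elt9 1 *+ m + elt9 3 *+ m'.
Proof.
have [i _ <-] := elt9_surj y; exists (i %% 3)%N, (i %/ 3)%N.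
by rewrite /elt9 mul0r addr0 add0r mul1r mulr_natl.
Qed.

Lemma automorphism9 (s : {perm GF9}) i : field_automorphism s ->
  s (elt9 i) = (i %% 3)%:R + (i %/ 3)%:R * s iota9.
Proof.
case/andP=> /eqP s1 /forallP sP.
have sD x y : s (x + y) = s x + s y by have /forallP/(_ y)/andP[/eqP] := sP x.
have sM x y : s (x * y) = s x * s y by have /forallP/(_ y)/andP[_ /eqP] := sP x.
have s0 : s 0 = 0 by apply: (@addIr _ (s 0)); rewrite -sD !add0r.
have sn n : s n%:R = n%:R by elim: n => // n IH; rewrite -natr1 sD IH s1 natr1.
by rewrite /elt9 sD sM !sn.
Qed.

Lemma conj9E i : elt9 (conj9 i) = (i %% 3)%:R - (i %/ 3)%:R * iota9.
Proof.
have two9 : (2%:R : GF9) = -1 by apply/eqP; rewrite -subr_eq0 opprK natr1 three9.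
by rewrite elt9_code [in X in X * _]natrM two9 mulN1r mulNr natr_mod3.
Qed.

(** The prime field is fixed, and the image of [iota9] is a square root of -1, so it is [iota9] or
    its negative. *)
Lemma automorphisms9 (s : {perm GF9}) : field_automorphism s ->
  (forall y, s y = y) \/ (forall i, s (elt9 i) = elt9 (conj9 i)).
Proof.
move=> sa; have sM x y : s (x * y) = s x * s y.
  by case/andP: sa => _ /forallP/(_ x)/forallP/(_ y)/andP[_ /eqP].
have e1 : elt9 3 = iota9 by rewrite /elt9 add0r mul1r.
have s1 : s 1 = 1 by case/andP: sa => /eqP.
have sN1 : s (-1) = -1.
  have : elt9 2 = -1 by apply/eqP; rewrite -addr_eq0 /elt9 mul0r addr0 natr1 three9.
  by move=> <-; rewrite automorphism9 // /elt9 !mul0r.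
have : (s iota9 - iota9) * (s iota9 + iota9) == 0.
  by rewrite -subr_sqr !expr2 -sM iota9_sqr sN1 subrr.
rewrite mulf_eq0 subr_eq0 addr_eq0 => /orP[]/eqP e; [left => y|right => i].
  by have [i _ <-] := elt9_surj y; rewrite automorphism9 // e.
by rewrite automorphism9 // e conj9E mulrN.
Qed.

Lemma frobenius9 : exists2 s : {perm GF9}, field_automorphism s &
  forall i, s (elt9 i) = elt9 (conj9 i).
Proof.
have ch : 3%N \in [pchar GF9] by rewrite inE three9 eqxx.
pose s := perm (fmorph_inj (pFrobenius_aut ch)).
have sa : field_automorphism s.
  rewrite /field_automorphism permE rmorph1 eqxx; apply/forallP => x; apply/forallP => y.
  by rewrite !permE rmorphD rmorphM !eqxx.
exists s => // i; rewrite automorphism9 // conj9E.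
have -> : s iota9 = iota9 ^+ 3 by rewrite permE.
by rewrite !exprS expr0 mulr1 iota9_sqr !mulrN mulr1.
Qed.

End NineElements.

Lemma realizes_PSL25 :
  realizes (point (erefl : fp_elt 5 1 = 1%R)) (gen_group 6 PSL25_list) (PSL2 'F_5).
Proof.
by apply: (realizes_PSL2 (fp_elt_add (isT : prime 5)) (fp_elt_mul (isT : prime 5)) _ _
  (fp_elt_inj (isT : prime 5)) (fp_elt_surj (isT : prime 5)) (fp_span (isT : prime 5))); vm_compute.
Qed.

(** The diagonal generator is multiplication by 3, a primitive root modulo 7. *)
Lemma realizes_PGL27 :
  realizes (point (erefl : fp_elt 7 1 = 1%R)) (gen_group 8 PGL27_list) (PGL2 'F_7).
Proof.
apply: (realizes_PGL2 (fp_elt_add (isT : prime 7)) (fp_elt_mul (isT : prime 7)) _ _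
  (fp_elt_inj (isT : prime 7)) (fp_elt_surj (isT : prime 7)) (fp_span (isT : prime 7))
  _ (d := 3) (r := [:: 0; 3; 6; 2; 5; 1; 4; 7])) => //.
move=> y y0; have : has (fun i => y == fp_elt 7 3 ^+ i)%R (iota 0 6).
  have [i ltip ei] := fp_elt_surj (isT : prime 7) y; move: y0; rewrite -ei.
  by case: i ltip {ei} => [|[|[|[|[|[|[|i]]]]]]] //.
by case/hasP => i _ /eqP; exists i.
Qed.

Lemma elt9_0 : elt9 0 = 0%R.
Proof. by rewrite /elt9 mul0r addr0. Qed.

Lemma elt9_1 : elt9 1 = 1%R.
Proof. by rewrite /elt9 mul0r addr0. Qed.

Lemma realizes_PSL29 :
  realizes (point elt9_1) (gen_group 10 PSL29_list) (PSL2 GF9).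
Proof.
by apply: (realizes_PSL2 elt9_add elt9_mul elt9_0 _ elt9_inj elt9_surj elt9_span); vm_compute.
Qed.

Lemma realizes_PSigmaL29 :
  realizes (point elt9_1) (gen_group 10 (PSigmaL29_extra :: PSL29_list)) (PSigmaL2 GF9).
Proof.
by apply: (realizes_PSigmaL2 elt9_add elt9_mul elt9_0 _ elt9_inj elt9_surj elt9_span
  _ frobenius9 automorphisms9 (r := PSigmaL29_extra)); vm_compute.
Qed.

Lemma point5_bij : bijective (@point 'F_5 5 (fp_elt 5) (erefl _)).
Proof.
exact: (point_bij (erefl : fp_elt 5 0 = 0%R)  _ (fp_elt_inj (isT : prime 5)) (fp_elt_surj (isT :
  prime 5))).
Qed.

Lemma point7_bij : bijective (@point 'F_7 7 (fp_elt 7) (erefl _)).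
Proof.
exact: (point_bij (erefl : fp_elt 7 0 = 0%R)  _ (fp_elt_inj (isT : prime 7)) (fp_elt_surj (isT :
  prime 7))).
Qed.

Lemma point9_bij : bijective (@point GF9 9 elt9 elt9_1).
Proof. exact: (point_bij elt9_0 _ elt9_inj elt9_surj). Qed.

Lemma nth_images_lt (n i : nat) (g : 'S_n) (lti : i < n) :
  nth 0 (images g) i = g (Ordinal lti).
Proof. exact: (nth_images 0 g (Ordinal lti)). Qed.

Lemma cyclic_gen_group (n : nat) :
  gen_group n [:: images (rotation n)] = cyclic_group n :> {set 'S_n}.
Proof.
congr (gval <<_>>%G); apply/setP => g; rewrite !inE.
by apply/eqP/eqP => [/images_inj|->].
Qed.

(** The reflection is composed with the rotation to match the image lists of the classification: x
    |-> n - 1 - x followed by x |-> x + 1 is x |-> -x modulo n. *)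
Lemma dihedral_gen_group (n : nat) :
  gen_group n [:: images (reflection n * rotation n)%g; images (rotation n)] =
  dihedral_group n :> {set 'S_n}.
Proof.
apply/eqP; rewrite eqEsubset; apply/andP; split; rewrite /= gen_subG; apply/subsetP => g.
  have rot : rotation n \in dihedral_group n by apply: mem_gen; rewrite !inE eqxx.
  have rev : reflection n \in dihedral_group n by apply: mem_gen; rewrite !inE eqxx orbT.
  by rewrite !inE => /orP[]/eqP/images_inj->; rewrite ?groupM.
have rot : rotation n \in gen_group n
  [:: images (reflection n * rotation n)%g; images (rotation n)].
  by apply: mem_gen; rewrite !inE eqxx orbT.
rewrite !inE => /orP[]/eqP-> //; rewrite -(groupMr _ rot).
by apply: mem_gen; rewrite !inE eqxx.
Qed.

Lemma images_rotation (n : nat) : images (rotation n) = [seq i.+1 %% n | i <- iota 0 n].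
Proof.
apply: (@eq_from_nth _ 0); rewrite size_images ?size_map ?size_iota // => i lin.
by rewrite (nth_images_lt _ lin) permE (nth_map 0) ?size_iota // nth_iota.
Qed.

Lemma images_reflection (n : nat) :
  images (reflection n * rotation n)%g = [seq (n - i) %% n | i <- iota 0 n].
Proof.
apply: (@eq_from_nth _ 0); rewrite size_images ?size_map ?size_iota // => i lin.
rewrite (nth_images_lt _ lin) permM !permE (nth_map 0) ?size_iota // nth_iota //=.
by rewrite subnSK.
Qed.

Lemma realizes_id (n : nat) (G : {group 'S_n}) (H : {set 'S_n}) : G = H :> {set _} ->
  realizes id G H.
Proof. by move=> <-; split=> g gG; exists g. Qed.

Lemma realizes_cyclic (n : nat) N : N = [:: [seq i.+1 %% n | i <- iota 0 n]] ->
  realizes id (gen_group n N) (cyclic_group n).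
Proof. by move->; apply: realizes_id; rewrite -images_rotation cyclic_gen_group. Qed.

Lemma realizes_dihedral (n : nat) N :
  N = [:: [seq (n - i) %% n | i <- iota 0 n]; [seq i.+1 %% n | i <- iota 0 n]] ->
  realizes id (gen_group n N) (dihedral_group n).
Proof.
move->; apply: realizes_id.
by rewrite -images_rotation -images_reflection dihedral_gen_group.
Qed.

Section Generators.
Variables (n : nat) (U : finType) (e : 'I_n -> U) (H : {set {perm U}}).

Definition follows (g : 'S_n) (f : U -> U) : Prop := forall i, e (g i) = f (e i).

Lemma followsM g h f f' : follows g f -> follows h f' -> follows (g * h)%g (f' \o f).
Proof. by move=> gf hf i; rewrite permM hf gf. Qed.

Lemma follows_exp g f m : follows g f -> follows (g ^+ m)%g (iter m f).
Proof.
move=> gf; elim: m => [|m IH] i; first by rewrite perm1.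
by rewrite expgSr permM gf IH.
Qed.

Hypothesis bij_e : bijective e.

Variable C : (U -> U) -> Prop.
Hypothesis HP : forall p : {perm U}, p \in H <-> exists2 f, C f & p =1 f.
Hypothesis C1 : C id.
Hypothesis CM : forall f f', C f -> C f' -> C (f' \o f).

Lemma realizes_functions N :
  (forall g, images g \in N -> exists2 f, C f & follows g f) ->
  (forall f, C f -> exists2 g, g \in gen_group n N & follows g f) ->
  realizes e (gen_group n N) H.
Proof.
move=> NC CN; split=> [g gN|p /HP[f /CN[g gN mg] pf]].
  have [f Cf mg] : exists2 f, C f & follows g f.
    apply: (gen_group_ind (K := fun g => exists2 f, C f & follows g f) _ _ NC gN).
      by exists id => // i; rewrite perm1.
    move=> g1 g2 [f1 C1' m1] [f2 C2 m2]; exists (f2 \o f1); first exact: CM.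
    exact: followsM.
  have [p ep] := transport_perm g bij_e; exists p => //; apply/HP; exists f => //.
  by case: bij_e => e' _ e'K y; rewrite -(e'K y) -ep mg.
by exists g => // x; rewrite mg pf.
Qed.

Lemma gen_follows N (q : seq nat) f : q \in N -> perm_list n q ->
  (forall g, images g = q -> follows g f) ->
  exists2 g, g \in gen_group n N & follows g f.
Proof.
move=> qN pq fq; have /listedP[g gN eg] := gen_group_perm_list qN pq.
by exists g => //; apply: fq.
Qed.

End Generators.

Section AffineLine.
Local Open Scope ring_scope.

Definition affine_map (F : finFieldType) (f : F -> F) : Prop :=
  exists2 a, a != 0 & exists b, f =1 fun x => a * x + b.

Lemma AGL1P (F : finFieldType) (p : {perm F}) :
  p \in AGL1 F <-> exists2 f, affine_map f & p =1 f.
Proof.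
rewrite inE; split=> [/existsP[a /existsP[b /andP[a0 /forallP pE]]]|[f [a a0 [b fE]] pf]].
  by exists (fun x => a * x + b); [exists a => //; exists b | move=> x; apply/eqP/pE].
apply/existsP; exists a; apply/existsP; exists b; rewrite a0; apply/forallP => x.
by rewrite pf fE.
Qed.

Lemma affine_map_comp (F : finFieldType) (f f' : F -> F) :
  affine_map f -> affine_map f' -> affine_map (f' \o f).
Proof.
move=> [a a0 [b fE]] [a' a'0 [b' f'E]]; exists (a' * a); first by rewrite mulf_neq0.
by exists (a' * b + b') => x; rewrite /= f'E fE; ring.
Qed.

Definition elt7 (i : 'I_7) : 'F_7 := fp_elt 7 i.

Lemma elt7_bij : bijective elt7.
Proof.
apply: inj_surj_bij => [i j e|y].
  by apply: val_inj; apply: (fp_elt_inj (isT : prime 7)) e.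
by have [i lti ei] := fp_elt_surj (isT : prime 7) y; exists (Ordinal lti); apply/eqP.
Qed.

Lemma follows_elt7 (g : 'S_7) (a b : nat) :
  all (fun i => nth 0%N (images g) i == (a * i + b) %% 7)%N (iota 0 7) ->
  follows elt7 g (fun x => a%:R * x + b%:R).
Proof.
move/allP=> H i; have := H (val i); rewrite mem_iota add0n ltn_ord => /(_ isT).
rewrite nth_images /elt7 => /eqP ->.
by rewrite /fp_elt Fp_nat_mod // natrD natrM.
Qed.

Lemma realizes_AGL17 : realizes elt7 (gen_group 7 AGL17_list) (AGL1 'F_7).
Proof.
apply: (realizes_functions elt7_bij (@AGL1P _)).
- by exists 1; rewrite ?oner_eq0 //; exists 0 => x; rewrite mul1r addr0.
- exact: affine_map_comp.
- move=> g; rewrite !inE => /orP[]/eqP eg.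
    exists (fun x => 1%:R * x + 1%:R); last by apply: follows_elt7; rewrite eg.
    by exists 1%:R => //; exists 1%:R.
  exists (fun x => 3%:R * x + 0%:R); last by apply: follows_elt7; rewrite eg.
  by exists 3%:R => //; exists 0%:R.
move=> f [a a0 [b fE]].
have [t tN tE] : exists2 t, t \in gen_group 7 AGL17_list & follows elt7 t (fun x => 1%:R * x +
  1%:R).
  apply: (@gen_follows _ _ _ _ [:: 1; 2; 3; 4; 5; 6; 0]%N) => // g eg.
  by apply: follows_elt7; rewrite eg.
have [m mN mE] : exists2 m, m \in gen_group 7 AGL17_list & follows elt7 m (fun x => 3%:R * x +
  0%:R).
  apply: (@gen_follows _ _ _ _ [:: 0; 3; 6; 2; 5; 1; 4]%N) => // g eg.
  by apply: follows_elt7; rewrite eg.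
have [i ei] : exists i, a = 3%:R ^+ i.
  have : has (fun i => a == 3%:R ^+ i) (iota 0 6).
    have [i ltip ei] := fp_elt_surj (isT : prime 7) a; move: a0; rewrite -ei.
    by case: i ltip {ei} => [|[|[|[|[|[|[|i]]]]]]] //.
  by case/hasP => i _ /eqP; exists i.
exists (m ^+ i * t ^+ val b)%g; first by rewrite groupM ?groupX.
move=> x; rewrite (followsM (follows_exp i mE) (follows_exp (val b) tE)) /= fE.
have -> : iter i (fun y => 3%:R * y + 0%:R) (elt7 x) = a * elt7 x.
  by rewrite ei; elim: i {ei} => [|i IH]; rewrite /= ?IH ?expr0 ?mul1r // addr0 exprS mulrA.
have -> : iter (val b) (fun y => 1%:R * y + 1%:R) (a * elt7 x) = a * elt7 x + (val b)%:R.
  by elim: (val b) => [|j IH]; rewrite /= ?IH ?addr0 // mul1r -addrA natr1.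
by rewrite natr_Zp.
Qed.

End AffineLine.

(** * The alternating and symmetric groups of degree 5 on pairs *)

Definition A5_list : seq (seq nat) := [:: [:: 3; 4; 0; 1; 2]; [:: 1; 2; 0; 3; 4]].
Definition S5_extra : seq nat := [:: 0; 1; 2; 4; 3].

(** Every permutation preserves the empty table, so [aut_group] is the whole symmetric group, and
    the check says that each permutation of 5 points is generated by [A5_list] up to a factor 1 or
    the transposition (3 4). *)
Lemma upper_A5 :
  upper_check 5 1 (@Empty bool) A5_list [:: iota 0 5; S5_extra] 3 100.
Proof. by vm_compute. Qed.

Lemma S5_in_aut (g : 'S_5) : g \in aut_group 5 1 (@Empty bool).
Proof. by apply/aut_setP. Qed.

Lemma even_odd_order (T : finType) (g : {perm T}) (m : nat) : (g ^+ m.*2.+1 = 1)%g -> ~~ odd_perm g.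
Proof.
move=> gm; have : odd_perm (g ^+ m.*2.+1)%g = odd_perm g.
  elim: m {gm} => [|m IH]; first by rewrite expg1.
  by rewrite doubleS expgS expgS !odd_permM IH; case: odd_perm.
by rewrite gm odd_perm1 => <-.
Qed.

Lemma odd_S5_extra (g : 'S_5) : images g = S5_extra -> odd_perm g.
Proof.
move=> eg; pose a : 'I_5 := Ordinal (isT : 3 < 5); pose b : 'I_5 := Ordinal (isT : 4 < 5).
suff -> : g = tperm a b by rewrite odd_tperm.
apply/permP => i; apply: val_inj; have := nth_images 0 g i; rewrite eg => /esym /= ->.
by rewrite permE; case: i => [[|[|[|[|[|i]]]]] lti].
Qed.

Lemma even_A5_list (g : 'S_5) : images g \in A5_list -> ~~ odd_perm g.
Proof.
rewrite !inE => /orP[]/eqP eg; [apply: (@even_odd_order _ _ 2) | apply: (@even_odd_order _ _ 1)];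
  apply: images_inj; rewrite images1 !expgS expg0 mulg1 -!lmul_images eg; by vm_compute.
Qed.

Lemma Alt5_gen_group : gen_group 5 A5_list = ('Alt_('I_5))%g :> {set _}.
Proof.
apply/eqP; rewrite eqEsubset; apply/andP; split.
  by rewrite gen_subG; apply/subsetP => g; rewrite inE Alt_even; apply: even_A5_list.
apply/subsetP => g; rewrite Alt_even => evg.
have [u [_ uF] [w wN e]] := upper_bound upper_A5 (S5_in_aut g).
move: uF; rewrite !inE => /orP[]/eqP es.
  by rewrite e (_ : u = 1%g) ?mul1g //; apply: images_inj; rewrite es images1.
have evw : ~~ odd_perm w.
  apply: (gen_group_ind (K := fun h => ~~ odd_perm h) _ _ even_A5_list wN).
    by rewrite odd_perm1.
  by move=> g1 g2 /negbTE e1 /negbTE e2; rewrite odd_permM e1 e2.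
by move: evg; rewrite e odd_permM (odd_S5_extra es) (negbTE evw).
Qed.

Lemma Sym5_gen_group : gen_group 5 (S5_extra :: A5_list) = ('Sym_('I_5))%g :> {set _}.
Proof.
apply/setP => g; rewrite [RHS]inE; apply/idP.
have [u [_ uF] [w wN ->]] := upper_bound upper_A5 (S5_in_aut g).
apply: groupM; last first.
  by apply: subsetP wN; apply: genS; apply/subsetP => x; rewrite !inE => ->; rewrite orbT.
move: uF; rewrite !inE => /orP[]/eqP es; last by apply: mem_gen; rewrite inE es mem_head.
by rewrite (_ : u = 1%g) ?group1 //; apply: images_inj; rewrite es images1.
Qed.

Section Pairs.

(** Listed so that x |-> x + 3 modulo 5, the first entry of [A5_list], acts as i |-> i + 1 on each
    half of the indices. *)
Definition pair_labels : seq bitseq :=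
  [seq [seq (j == x) || (j == y) | j <- iota 0 5] | '(x, y) <-
    [:: (0, 1); (3, 4); (1, 2); (4, 0); (2, 3); (2, 4); (0, 2); (3, 0); (1, 3); (4, 1)]].

Lemma pair_label_subsets (i : 'I_10) : nth [::] pair_labels i \in subsets 5 2.
Proof. by case: i => [[|[|[|[|[|[|[|[|[|[|i]]]]]]]]]] lti]. Qed.

Lemma pair_label_proof (i : 'I_10) : #|setb 5 (nth [::] pair_labels i)| == 2.
Proof. by rewrite (card_setb_subsets (pair_label_subsets i)). Qed.

Definition pair_of (i : 'I_10) : two_subsets 5 :=
  exist (fun A : {set 'I_5} => #|A| == 2) _ (pair_label_proof i).

Lemma pair_of_bij : bijective pair_of.
Proof.
apply: inj_surj_bij => [i j /(congr1 (fun A => bits (val A))) /=|[A cA]].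
  have sz (l : 'I_10) : size (nth [::] pair_labels l) = 5.
    by have := pair_label_subsets l; rewrite mem_subsets => /andP[/eqP].
  rewrite !setbK // => e; apply: val_inj; apply/eqP.
  rewrite -(nth_uniq [::] (s := pair_labels)) //; try exact: (ltn_ord _); exact/eqP.
have : bits A \in pair_labels.
  have : bits A \in subsets 5 2 by rewrite bits_subsets.
  by apply: (allP (isT : all (fun b => b \in pair_labels) (subsets 5 2))).
move/(nthP [::])=> [i lti ei]; exists (Ordinal (lti : i < 10)); apply/eqP/val_inj.
by rewrite /= ei bitsK.
Qed.

Variables (H : {group 'S_5}).

Lemma on_two_subsetsP p : p \in on_two_subsets H <->
  exists2 f, (exists2 s : 'S_5, s \in H & f =1 s) & induced_by f p.
Proof.
rewrite inE; split=> [/existsP[s /andP[sH ip]]|[f [s sH fs] /forallP ip]].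
  by exists s => //; exists s.
apply/existsP; exists s; rewrite sH; apply/forallP => A.
by rewrite (eqP (ip A)); apply/eqP/eq_imset.
Qed.

Definition pairs_check (q p : seq nat) : bool :=
  perm_list 10 q && all (fun i => nth [::] pair_labels (nth 0 q i) == push 5 p (nth [::] pair_labels
    i)) (iota 0 10).

Lemma pairs_checkP (g : 'S_10) (s : 'S_5) : pairs_check (images g) (images s) -> moves pair_of g s.
Proof.
case/andP=> _ /allP H0 i; have := H0 (val i); rewrite mem_iota add0n ltn_ord => /(_ isT).
have sz : size (nth [::] pair_labels i) = 5.
  by have := pair_label_subsets i; rewrite mem_subsets => /andP[/eqP].
by rewrite nth_images /= => /eqP ->; rewrite push_images.
Qed.

Lemma realizes_pairs N N5 : gen_group 5 N5 = H :> {set _} -> all (perm_list 5) N5 ->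
  all2 pairs_check N N5 -> realizes pair_of (gen_group 10 N) (on_two_subsets H).
Proof.
move=> eH /allP pN5; rewrite all2E => /andP[/eqP szN /allP chk].
have inN q : q \in N -> exists2 p, p \in N5 & pairs_check q p.
  case/(nthP [::])=> i lti <-; exists (nth [::] N5 i); first by rewrite mem_nth -?szN.
  by apply: (chk (nth [::] N i, nth [::] N5 i)); rewrite -nth_zip // mem_nth // size_zip -szN minnn.
have inN5 p : p \in N5 -> exists2 q, q \in N & pairs_check q p.
  case/(nthP [::])=> i lti <-; exists (nth [::] N i); first by rewrite mem_nth ?szN.
  by apply: (chk (nth [::] N i, nth [::] N5 i)); rewrite -nth_zip // mem_nth // size_zip szN minnn.
apply: (realizes_induced pair_of_bij on_two_subsetsP).
- by exists 1%g => // x; rewrite perm1.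
- move=> f f' [s sH fs] [s' s'H fs']; exists (s * s')%g; first exact: groupM.
  by move=> x; rewrite /= fs fs' permM.
- move=> g /inN[p pN chkp]; have /listedP[s sN es] := gen_group_perm_list pN (pN5 p pN).
  exists s; first by exists s => //; rewrite -eH.
  by apply: pairs_checkP; rewrite es.
move=> f [s]; rewrite -eH => sN fs.
have [g gN gs] : exists2 g, g \in gen_group 10 N & moves pair_of g s.
  apply: (gen_group_ind (K := fun s => exists2 g, g \in gen_group 10 N & moves pair_of g s) _ _ _
    sN).
  - by exists 1%g => // i; rewrite perm1 -[LHS]imset_id; apply: eq_imset => x; rewrite perm1.
  - move=> s1 s2 [g1 g1N m1] [g2 g2N m2]; exists (g1 * g2)%g; first by rewrite groupM.
    by move=> i; rewrite (movesM m1 m2); apply: eq_imset => x; rewrite permM.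
  move=> s1 /inN5[q qN chkq]; have /listedP[g gN eg] := gen_group_perm_list qN (proj1 (andP chkq)).
  by exists g => //; apply: pairs_checkP; rewrite eg.
by exists g => // i; rewrite gs; apply: eq_imset => x; rewrite fs.
Qed.

End Pairs.

Lemma realizes_A5_pairs :
  realizes pair_of (gen_group 10 A5_pairs_list) (on_two_subsets ('Alt_('I_5))%g).
Proof. by apply: realizes_pairs Alt5_gen_group _ _; vm_compute. Qed.

Lemma realizes_S5_pairs :
  realizes pair_of (gen_group 10 (S5_pairs_extra :: A5_pairs_list)) (on_two_subsets
    ('Sym_('I_5))%g).
Proof. by apply: realizes_pairs Sym5_gen_group _ _; vm_compute. Qed.

(** * Affine groups of the plane over GF(3) *)

Section AffinePlane.
Local Open Scope ring_scope.
Local Notation F3 := 'F_3.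
Local Notation GL := {'GL_2['F_3]}.
Implicit Types (k : GL) (K : {group GL}) (v : 'rV[F3]_2).

Lemma mem_F3 (x : F3) : x \in [:: 0; 1; -1].
Proof. by case: x => [[|[|[|x]]] ltx]. Qed.

Lemma mat2_inj (F : finFieldType) (a b c d a' b' c' d' : F) :
  mat2 a b c d = mat2 a' b' c' d' -> [/\ a = a', b = b', c = c' & d = d'].
Proof.
move/matrixP => e; have := e 0 0; have := e 0 1; have := e 1 0; have := e 1 1.
by rewrite !mxE.
Qed.

Definition affine_by k (b : 'rV[F3]_2) v := v *m GLval k + b.

Definition affine_over K (f : 'rV[F3]_2 -> 'rV[F3]_2) : Prop :=
  exists2 k, k \in K & exists b, f =1 affine_by k b.

Lemma affine_group2P K (p : {perm 'rV[F3]_2}) :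
  p \in affine_group2 K <-> exists2 f, affine_over K f & p =1 f.
Proof.
rewrite inE; split=> [/existsP[k /andP[kK /existsP[b /forallP pE]]]|[f [k kK [b fE]] pf]].
  by exists (affine_by k b); [exists k => //; exists b | move=> x; apply/eqP/pE].
apply/existsP; exists k; rewrite kK; apply/existsP; exists b; apply/forallP => v.
by rewrite pf fE.
Qed.

Lemma affine_over_id K : affine_over K id.
Proof.
by exists 1%g; [exact: group1 | exists 0 => v; rewrite /affine_by addr0 mulmx1].
Qed.

Lemma affine_over_comp K f f' :
  affine_over K f -> affine_over K f' -> affine_over K (f' \o f).
Proof.
move=> [k kK [b fE]] [k' k'K [b' f'E]]; exists (k * k')%g; first by rewrite groupM.
exists (b *m GLval k' + b') => v.
by rewrite /= f'E fE /affine_by mulmxDl -addrA -mulmxA.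
Qed.

Definition plane_point (i : 'I_9) : 'rV[F3]_2 := vec2 (i %% 3)%:R (i %/ 3)%:R.

Lemma plane_point_bij : bijective plane_point.
Proof.
apply: inj_surj_bij => [i j /vec2_inj[e1 e2]|v].
  apply: val_inj; rewrite /= (divn_eq i 3) (divn_eq j 3).
  have lt3 (l : 'I_9) : (l %/ 3 < 3)%N by rewrite ltn_divLR.
  rewrite (fp_elt_inj (isT : prime 3) _ _ e1) ?ltn_mod //.
  by rewrite (fp_elt_inj (isT : prime 3) _ _ e2) ?lt3.
have lt3 (x : F3) : (x < 3)%N by [].
rewrite (vec2E v); move: (v 0 0) (v 0 1) => x y; have [ltx lty] := (lt3 x, lt3 y).
have lt9 : (x + 3 * y < 9)%N by lia.
exists (Ordinal lt9); rewrite /plane_point /=.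
have -> : ((x + 3 * y) %% 3)%N = x by lia.
have -> : ((x + 3 * y) %/ 3)%N = y by lia.
by rewrite !natr_Zp.
Qed.

Definition plane_check (a b c d u w : nat) (q : seq nat) : bool :=
  perm_list 9 q && all (fun i => let j := nth 0%N q i in
     (j %% 3 == (a * (i %% 3) + c * (i %/ 3) + u) %% 3)%N &&
     (j %/ 3 == (b * (i %% 3) + d * (i %/ 3) + w) %% 3)%N) (iota 0 9).

Lemma plane_checkP (a b c d u w : nat) (g : 'S_9) : plane_check a b c d u w (images g) ->
  follows plane_point g
    (fun v => v *m mat2 a%:R b%:R c%:R d%:R + vec2 u%:R w%:R).
Proof.
case/andP=> _ /allP H i; have := H (val i); rewrite mem_iota add0n ltn_ord => /(_ isT).
rewrite /= nth_images /plane_point => /andP[/eqP -> /eqP ->].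
rewrite vec2_mat2 !Fp_nat_mod // !natrD !natrM !Fp_nat_mod //.
apply/rowP => j; rewrite !mxE; case: eqP => _; ring.
Qed.

Variables (N : seq (seq nat)) (S : {set GL}).
Local Notation K := <<S>>%G.
Hypothesis tr1 : has (plane_check 1 0 0 1 1 0) N.
Hypothesis tr2 : has (plane_check 1 0 0 1 0 1) N.
Hypothesis N_K : forall g : 'S_9, images g \in N ->
  exists2 k, k \in K & exists b, follows plane_point g (affine_by k b).
Hypothesis S_N : forall k, k \in S ->
  exists2 g : 'S_9, g \in gen_group 9 N & follows plane_point g (affine_by k 0).

Lemma listed_plane a b c d u w : has (plane_check a b c d u w) N ->
  exists2 g : 'S_9, g \in gen_group 9 N & follows plane_point g
    (fun v => v *m mat2 a%:R b%:R c%:R d%:R + vec2 u%:R w%:R).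
Proof.
case/hasP => q qN chk; have /listedP[g gN eg] := gen_group_perm_list qN (proj1 (andP chk)).
by exists g => //; apply: plane_checkP; rewrite eg.
Qed.

(** An affine map is its linear part, a product of elements of [S], followed by powers of the two
    unit translations whose exponents are the coordinates of [b]. *)
Lemma realizes_affine : realizes plane_point (gen_group 9 N) (affine_group2 K).
Proof.
apply: (realizes_functions plane_point_bij (@affine_group2P K)).
- exact: affine_over_id.
- exact: affine_over_comp.
- by move=> g /N_K[k kK [b fg]]; exists (affine_by k b) => //; exists k => //; exists b.
move=> f [k kK [b fE]].
have [g gN gk] : exists2 g : 'S_9, g \in gen_group 9 N & follows plane_point g (affine_by k 0).
  have /gen_prodgP[m [c cS ->]] := kK.
  apply: (big_ind (fun k => exists2 g : 'S_9, g \in gen_group 9 N &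
    follows plane_point g (affine_by k 0))) => [|k1 k2 [g1 g1N f1] [g2 g2N f2]|i _].
  - by exists 1%g => // i; rewrite perm1 /affine_by mulmx1 addr0.
  - exists (g1 * g2)%g; first by rewrite groupM.
    by move=> i; rewrite (followsM f1 f2) /= /affine_by !addr0 mulmxA.
  exact: S_N (cS i).
have [t1 t1N f1] := listed_plane tr1; have [t2 t2N f2] := listed_plane tr2.
have trans m v x y : iter m (fun w : 'rV[F3]_2 => w *m mat2 1%:R 0%:R 0%:R 1%:R + vec2 x y) v =
    v + vec2 (x *+ m) (y *+ m).
  elim: m => [|m IH] /=.
    by apply/rowP => j; rewrite !mxE !mulr0n if_same addr0.
  rewrite IH (vec2E v); apply/rowP => j; rewrite !mxE big_ord_recl big_ord1 !mxE /= !mulrS.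
  by case: eqP => _; ring.
exists (g * (t1 ^+ val (b 0 0)%R * t2 ^+ val (b 0 1)%R))%g; first by rewrite !groupM ?groupX.
move=> i; rewrite (followsM gk (followsM (follows_exp _ f1) (follows_exp _ f2))) /=.
rewrite !trans fE /affine_by addr0 -addrA; congr (_ + _); rewrite [RHS]vec2E.
apply/rowP => j; rewrite !mxE !mul0rn.
case: eqP => _; rewrite ?addr0 ?add0r ?natr_Zp //.
Qed.

End AffinePlane.

Lemma order4_sqr (gT : finGroupType) (x : gT) : #[x]%g = 4 ->
  (x * x != 1 /\ (x * x) * (x * x) = 1)%g.
Proof.
move=> ox; have := expg_order x; have := order_dvdn x 2.
by rewrite ox !expgS expg0 mulg1 -!mulgA => /esym/negbT.
Qed.

Lemma order4P (gT : finGroupType) (x : gT) :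
  (x * x != 1 -> (x * x) * (x * x) = 1 -> #[x] = 4)%g.
Proof.
move=> x2 x4; have d4 : (#[x]%g %| 4)%N by rewrite order_dvdn !expgS expg0 mulg1 mulgA x4.
have nd2 : ~~ (#[x]%g %| 2)%N by rewrite order_dvdn expgS expg1.
have : (#[x]%g <= 4)%N by apply: dvdn_leq.
by case: #[x]%g d4 nd2 => [|[|[|[|[|]]]]].
Qed.

Lemma order2P (gT : finGroupType) (x : gT) : (x != 1 -> x * x = 1 -> #[x] = 2)%g.
Proof. by move=> x1 x2; apply: nt_prime_order; rewrite // expgS expg1. Qed.

(** Dihedral groups are recognized by two generating involutions, here [x * y] and [y]. The order is
    8 because [y] normalises the group of [x] and lies outside it. *)
Lemma isog_dihedral8 (gT : finGroupType) (x y : gT) :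
  (#[x] = 4 -> y != 1 -> y * y = 1 -> x * y != 1 -> x * y * (x * y) = 1 ->
   x * y != y * x -> <<[set x; y]>> \isog 'D_8)%g.
Proof.
move=> ox y1 y2 xy1 xy2 nc; have oy := order2P y1 y2; have oxy := order2P xy1 xy2.
have xVy : (x ^ y = x^-1)%g.
  by apply: (mulgI y); rewrite -conjgC; apply: (mulIg (x * y)%g); rewrite xy2 -mulgA mulKg y2.
have nxy : y \in 'N(<[x]>)%g by rewrite -cycle_subG norms_cycle xVy groupV cycle_id.
have y_x : y \notin <[x]>%g.
  apply: contra nc => yx; apply/eqP; apply: (centsP (cycle_abelian x)) => //.
  exact: cycle_id.
have card8 : #|<<[set x; y]>>%g| = 8.
  have -> : <<[set x; y]>>%g = (<[x]> <*> <[y]>)%g by rewrite joing_idl joing_idr.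
  rewrite norm_joinEr ?cycle_subG // TI_cardMg -?orderE ?ox ?oy //.
  by rewrite setIC prime_TIg ?cycle_subG // -orderE oy.
have eq_gen : <<[set x; y]>>%g = <<[set (x * y)%g; y]>>%g.
  have gy z : y \in <<[set z; y]>>%g by apply: mem_gen; rewrite set22.
  have gx z : z \in <<[set z; y]>>%g by apply: mem_gen; rewrite set21.
  have sub z z' : z \in <<[set z'; y]>>%g -> <<[set z; y]>>%g \subset <<[set z'; y]>>%g.
    by move=> zz'; rewrite gen_subG; apply/subsetP => w; rewrite !inE => /orP[]/eqP->; rewrite ?gy.
  apply/eqP; rewrite eqEsubset !sub //; first by rewrite groupM ?gx ?gy.
  by rewrite -(groupMr x (gy _)).
have := involutions_gen_dihedral oxy oy; rewrite /= -eq_gen card8; apply.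
apply/eqP => e; have := oy; rewrite -e => _; move: (mulIg y x 1%g); rewrite mul1g e.
by move=> /(_ erefl) ex; move: ox; rewrite ex order1.
Qed.

Lemma dihedral8_gen (gT : finGroupType) (H : {group gT}) : H \isog 'D_8 ->
  exists x y, [/\ #[x] = 4, y * y = 1, x ^ y = x^-1 & H = <<[set x; y]>> :> {set gT}]%g.
Proof.
move=> isoH; have [[x y] [cH xH ox /setDP[yH yx]] [oy xy]] := @generators_2dihedral _ H 3 isT isoH.
exists x, y; split=> //; first by have := expg_order y; rewrite oy expgS expg1.
apply/eqP; rewrite eq_sym eqEcard gen_subG; apply/andP; split.
  by apply/subsetP => z; rewrite !inE => /orP[]/eqP->.
(* The order of the generated group is a proper multiple of 4, hence at least 8, the order of
   [H]. *)
have sub : <[x]>%g \proper <<[set x; y]>>%g.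
  apply/properP; split; first by rewrite cycle_subG mem_gen ?set21.
  by exists y; rewrite // mem_gen ?set22.
rewrite cH; have := proper_card sub; have := cardSg (proper_sub sub).
rewrite -orderE ox /=; move: #|_| => m /dvdnP[[|[|l]]] -> //=; lia.
Qed.

Lemma gen_twist (gT : finGroupType) (x y P : gT) i :
  (<<[set x ^ P; (x ^+ i * y) ^ P]>> = <<[set x; y]>> :^ P)%g.
Proof.
rewrite -genJ -[RHS]/<<_>>%g conjUg !conjg_set1.
have gy (u z : gT) : u \in <<[set z; u]>>%g by apply: mem_gen; rewrite set22.
have gx (u z : gT) : z \in <<[set z; u]>>%g by apply: mem_gen; rewrite set21.
rewrite conjMg conjXg; move: (x ^ P)%g (y ^ P)%g => {}x {}y.
apply/eqP; rewrite eqEsubset !gen_subG; apply/andP; split;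
  apply/subsetP => z; rewrite !inE => /orP[]/eqP->; rewrite ?gx ?gy //.
  by rewrite groupM ?groupX ?gx ?gy.
by rewrite -(groupMl _ (groupX i (gx _ _))) gy.
Qed.

(** * Conjugacy of the point stabilisers in GL(2,3) *)

Section ConjugateSubgroups.
Local Open Scope group_scope.
Variables (gT : finGroupType) (x y : gT).
Hypothesis conj4 : forall z : gT, #[z] = 4 -> exists u, z = x ^ u.
Hypothesis inverting : forall z : gT, z * z = 1 -> x ^ z = x^-1 -> exists i, z = x ^+ i * y.

Lemma cyclic4_conj (H : {group gT}) : cyclic H -> #|H| = 4 ->
  exists u, H = (<<[set x]>> :^ u)%G.
Proof.
case/cyclicP=> z eH cH; have [u ez] : exists u, z = x ^ u.
  by apply: conj4; rewrite /order -eH.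
by exists u; apply: val_inj; rewrite /= eH ez -cycleJ.
Qed.

(** By [conj4] the rotation of order 4 can be taken to be a conjugate of [x]; conjugating back, the
    reflection inverts [x] and so is [x ^+ i * y], which with [x] generates the same group as [y]
    does. *)
Lemma dihedral8_conj (H : {group gT}) : H \isog 'D_8 ->
  exists u, H = (<<[set x; y]>> :^ u)%G.
Proof.
case/dihedral8_gen=> x' [y' [ox y2 xy eH]]; have [P ex] := conj4 ox.
have [z ey] : exists z, y' = z ^ P by exists (y' ^ P^-1); rewrite conjgKV.
have z2 : z * z = 1 by apply: (conjg_inj P); rewrite conjMg conj1g -ey.
have Jz : x ^ z = x^-1 by apply: (conjg_inj P); rewrite conjJg -ey -ex xy ex conjVg.
have [i ez] := inverting z2 Jz; exists P; apply: val_inj; rewrite /= eH ex ey ez.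
exact: gen_twist.
Qed.

End ConjugateSubgroups.

Section PlaneGroups.
Local Open Scope ring_scope.
Local Notation F3 := 'F_3.
Local Notation GL := {'GL_2['F_3]}.
Implicit Types (k : GL).

Lemma gl_exists (a b c d : F3) : a * d - b * c != 0 -> {k : GL | GLval k = mat2 a b c d}.
Proof.
move=> det0; exists (insubd (1%g : GL) (mat2 a b c d : 'M_2.-1.+1)).
by rewrite insubdK // -topredE /= unitmxE det_mat2 unitfE.
Qed.

Lemma quarter_turn_exists : {k : GL | GLval k = mat2 0 1 (-1) 0}.
Proof. by refine (gl_exists _). Qed.

Lemma mirror_exists : {k : GL | GLval k = mat2 1 0 0 (-1)}.
Proof. by refine (gl_exists _). Qed.

Definition quarter_turn : GL := sval quarter_turn_exists.
Definition mirror : GL := sval mirror_exists.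
Local Notation J := quarter_turn.
Local Notation B := mirror.

Lemma JE : GLval J = mat2 0 1 (-1) 0. Proof. exact: (svalP quarter_turn_exists). Qed.
Lemma BE : GLval B = mat2 1 0 0 (-1). Proof. exact: (svalP mirror_exists). Qed.

Lemma GL1E : GLval (1%g : GL) = mat2 1 0 0 1.
Proof. by rewrite [LHS]mat2E !mxE. Qed.

Lemma GLval_inj k k' : GLval k = GLval k' -> k = k'.
Proof. exact: val_inj. Qed.

Lemma glVr k : GLval k *m GLval k^-1%g = 1%:M :> 'M_2.
Proof. by have := GL_MxE k k^-1%g; rewrite mulgV. Qed.

Lemma glVl k : GLval k^-1%g *m GLval k = 1%:M :> 'M_2.
Proof. by have := GL_MxE k^-1%g k; rewrite mulVg. Qed.

Definition glx := (@GL_MxE 2 F3, JE, BE, GL1E, @mul_mat2 F3, @mulr0 F3, @mul0r F3,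
  @mulr1 F3, @mul1r F3, @addr0 F3, @add0r F3, @mulrN F3, @mulNr F3, @opprK F3, @oppr0 F3).

Lemma mat2_eq (a b c d a' b' c' d' : F3) :
  [&& a == a', b == b', c == c' & d == d'] -> mat2 a b c d = mat2 a' b' c' d'.
Proof. by case/and4P=> /eqP-> /eqP-> /eqP-> /eqP->. Qed.

Lemma follows_affine k a b c d u w (g : 'S_9) :
  GLval k = mat2 a%:R b%:R c%:R d%:R -> plane_check a b c d u w (images g) ->
  follows plane_point g (affine_by k (vec2 u%:R w%:R)).
Proof. by move=> ek /plane_checkP fg i; rewrite fg /affine_by ek. Qed.

Lemma follows_J (g : 'S_9) : plane_check 0 1 2 0 0 0 (images g) ->
  follows plane_point g (affine_by J 0).
Proof.
move=> chk; have -> : 0 = vec2 0%:R 0%:R :> 'rV[F3]_2.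
  by apply/rowP => j; rewrite !mxE if_same.
by apply: follows_affine chk; rewrite JE; apply: mat2_eq.
Qed.

Lemma follows_B (g : 'S_9) : plane_check 1 0 0 2 0 0 (images g) ->
  follows plane_point g (affine_by B 0).
Proof.
move=> chk; have -> : 0 = vec2 0%:R 0%:R :> 'rV[F3]_2.
  by apply/rowP => j; rewrite !mxE if_same.
by apply: follows_affine chk; rewrite BE; apply: mat2_eq.
Qed.

Lemma C4_affine_follows (K : {group GL}) (g : 'S_9) : J \in K -> images g \in C4_affine_list ->
  exists2 k, k \in K & exists b, follows plane_point g (affine_by k b).
Proof.
move=> JK; rewrite !inE => /or3P[]/eqP eg.
- exists 1%g; [exact: group1 | exists (vec2 1%:R 0%:R)].
  by apply: (@follows_affine 1%g 1 0 0 1 1 0); rewrite ?GL1E ?eg.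
- exists 1%g; [exact: group1 | exists (vec2 0%:R 1%:R)].
  by apply: (@follows_affine 1%g 1 0 0 1 0 1); rewrite ?GL1E ?eg.
by exists J => //; exists 0; apply: follows_J; rewrite eg.
Qed.

Definition turn_group : {group GL} := <<[set J]>>%G.
Definition square_group : {group GL} := <<[set J; B]>>%G.

Lemma realizes_C4_affine :
  realizes plane_point (gen_group 9 C4_affine_list) (affine_group2 turn_group).
Proof.
apply: realizes_affine => //.
  by move=> g; apply: C4_affine_follows; apply: mem_gen; rewrite inE.
move=> k; rewrite inE => /eqP->.
have /listedP[g gN eg] := gen_group_perm_list (n := 9) (N := C4_affine_list) (q :=
  [:: 0; 3; 6; 2; 5; 8; 1; 4; 7]%N) isT isT.
by exists g => //; apply: follows_J; rewrite eg.
Qed.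

Lemma realizes_D8_affine :
  realizes plane_point (gen_group 9 (D8_affine_extra :: C4_affine_list))
    (affine_group2 square_group).
Proof.
apply: realizes_affine => //.
  move=> g; rewrite inE => /orP[/eqP eg|].
    exists B; first exact: mem_gen (set22 _ _).
    by exists 0; apply: follows_B; rewrite eg.
  exact: C4_affine_follows (mem_gen (set21 _ _)).
have list_ex q : q \in (D8_affine_extra :: C4_affine_list) -> perm_list 9 q ->
    exists2 g, g \in gen_group 9 (D8_affine_extra :: C4_affine_list) & images g = q.
  by move=> qN pq; apply/listedP/gen_group_perm_list.
move=> k; rewrite !inE => /orP[]/eqP->.
  have [g gN eg] := list_ex [:: 0; 3; 6; 2; 5; 8; 1; 4; 7]%N isT isT.
  by exists g => //; apply: follows_J; rewrite eg.
have [g gN eg] := list_ex D8_affine_extra isT isT.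
by exists g => //; apply: follows_B; rewrite eg.
Qed.

Lemma affine_over_by (K : {group GL}) k b : k \in K -> affine_over K (affine_by k b).
Proof. by move=> kK; exists k => //; exists b. Qed.

(** The change of coordinates by [P] conjugates linear parts and turns the translation by b into the
    translation by b P. *)
Lemma realizes_affine_conj (e : 'I_9 -> 'rV[F3]_2) (G : {group 'S_9}) (K : {group GL}) (P : GL) :
  realizes e G (affine_group2 K) ->
  realizes (fun i => e i *m GLval P) G (affine_group2 (K :^ P)%G).
Proof.
have PV := glVr P; have VP := glVl P.
have bijP (k : GL) b : exists p : {perm 'rV[F3]_2}, forall v, p v = v *m GLval k + b.
  have inj : injective (fun v : 'rV[F3]_2 => v *m GLval k + b).
    move=> v w /addIr/(congr1 (mulmx^~ (GLval k^-1%g))).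
    by rewrite -!mulmxA glVr !mulmx1.
  by exists (perm inj) => v; rewrite permE.
move=> [GK KG]; split=> [g gG|p].
  have [p /affine_group2P[f [k kK [b fE]] pf] ep] := GK g gG.
  have [p' p'E] := bijP (k ^ P)%g (b *m GLval P).
  exists p' => [|x].
    apply/affine_group2P; exists (affine_by (k ^ P)%g (b *m GLval P)); last exact: p'E.
    by apply: affine_over_by; rewrite memJ_conjg.
  rewrite p'E ep pf fE /affine_by mulmxDl conjgE !GL_MxE -!mulmxA; congr (_ + _).
  by rewrite !mulmxA -[_ *m GLval P *m GLval P^-1%g]mulmxA PV mulmx1.
case/affine_group2P=> f [k kK [b fE]] pf; have /imsetP[k0 k0K ek] := kK.
have [p' p'E] := bijP k0 (b *m GLval P^-1%g).
have [|g gG eg] := KG p'.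
  apply/affine_group2P; exists (affine_by k0 (b *m GLval P^-1%g)); last exact: p'E.
  exact: affine_over_by.
exists g => // x; rewrite eg p'E pf fE /affine_by mulmxDl ek conjgE !GL_MxE.
rewrite -!mulmxA VP mulmx1; congr (_ + _).
by rewrite !mulmxA -[_ *m GLval P *m GLval P^-1%g]mulmxA PV mulmx1.
Qed.

Lemma plane_point_conj_bij (P : GL) : bijective (fun i => plane_point i *m GLval P).
Proof.
apply: (bij_comp (f := mulmx^~ (GLval P))) plane_point_bij.
by exists (mulmx^~ (GLval P^-1%g)) => v; rewrite /= -mulmxA ?glVr ?glVl mulmx1.
Qed.

(* An element x of order 4 satisfies x^2 = -1, so it acts on the basis e, e x as J
   does on the standard basis. *)
Lemma order4_conj (x : GL) : #[x]%g = 4%N -> exists P : GL, x = (J ^ P)%g.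
Proof.
move=> ox; have [x2 x4] := order4_sqr ox.
have : exists a b c d, GLval x = mat2 a b c d.
  by exists (GLval x 0 0), (GLval x 0 1), (GLval x 1 0), (GLval x 1 1); apply: mat2E.
move=> [a [b [c [d ex]]]].
(* All 81 matrices are tested: if x^2 <> 1 and x^4 = 1, then b is nonzero, d = -a and a^2 + b c =
   -1. A nonzero b makes e and e x independent for e = (1, 0), and the other two equations give x^2
   = -1. *)
have chk : all (fun a => all (fun b => all (fun c => all (fun d =>
    [|| [&& a * a + b * c == 1, a * b + b * d == 0, c * a + d * c == 0 & c * b + d * d == 1],
     ~~ [&& (a * a + b * c) * (a * a + b * c) + (a * b + b * d) * (c * a + d * c) == 1,
            (a * a + b * c) * (a * b + b * d) + (a * b + b * d) * (c * b + d * d) == 0,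
            (c * a + d * c) * (a * a + b * c) + (c * b + d * d) * (c * a + d * c) == 0 &
            (c * a + d * c) * (a * b + b * d) + (c * b + d * d) * (c * b + d * d) == 1] |
     [&& b != 0, d == - a & a * a + b * c == -1]])
    [:: 0; 1; -1]) [:: 0; 1; -1]) [:: 0; 1; -1]) [:: 0; 1; -1 : F3] by vm_compute.
move/allP/(_ _ (mem_F3 a))/allP/(_ _ (mem_F3 b))/allP/(_ _ (mem_F3 c))/allP/(_ _ (mem_F3 d)): chk.
case/or3P=> [/and4P[/eqP e1 /eqP e2 /eqP e3 /eqP e4]|/negP[]|/and3P[b0 /eqP ed /eqP ec]].
- by case/negP: x2; apply/eqP/GLval_inj; rewrite GL_MxE ex mul_mat2 GL1E e1 e2 e3 e4.
- move/(congr1 (@GLval _ _)): x4; rewrite !GL_MxE ex GL1E !mul_mat2 => /mat2_inj[-> -> -> ->].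
  by rewrite !eqxx.
have [P eP] : {P : GL | GLval P = mat2 1 0 a b} by refine (gl_exists _); rewrite mul1r mul0r subr0.
exists P; apply: (mulgI P); rewrite -conjgC; apply: GLval_inj; rewrite !GL_MxE ex eP JE.
rewrite !mul_mat2 ed; congr mat2; rewrite ?mulr0 ?mul0r ?mulr1 ?mul1r ?addr0 ?add0r //.
by rewrite mulrN mulrC subrr.
Qed.

Lemma order_J : #[J]%g = 4%N.
Proof.
apply: order4P; last by apply: GLval_inj; rewrite !glx.
by apply/eqP => /(congr1 (@GLval _ _)); rewrite !glx => /mat2_inj[].
Qed.

Lemma cyclic_turn_group : cyclic turn_group /\ #|turn_group| = 4%N.
Proof. by rewrite -[#|_|]/#[J]%g order_J cycle_cyclic. Qed.

Lemma conj_turn_group (H : {group GL}) : cyclic H -> #|H| = 4%N ->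
  exists P : GL, H = (turn_group :^ P)%G.
Proof.
exact: cyclic4_conj order4_conj _.
Qed.

(** Inverting [J] means [J * y * J = y], so the rows of [y] are (a, c) and (c, -a), with a^2 + c^2 =
    1 because y^2 = 1. Over GF(3) exactly one of a and c vanishes, which leaves the four
    reflections. *)
Lemma J_sqr_B (y : GL) : (y * y = 1 -> J ^ y = J^-1 -> exists i, y = J ^+ i * B)%g.
Proof.
move=> y2 Jy.
have : exists a b c d, GLval y = mat2 a b c d.
  by exists (GLval y 0 0), (GLval y 0 1), (GLval y 1 0), (GLval y 1 1); apply: mat2E.
move=> [a [b [c [d ey]]]].
have JyJ : (J * y * J = y)%g.
  by rewrite (conjgC J y) Jy -mulgA mulVg mulg1.
move/(congr1 (@GLval _ _)): JyJ; rewrite !GL_MxE ey JE !mul_mat2.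
rewrite !(mulr0, mul0r, mulr1, mul1r, addr0, add0r, mulrN1, mulN1r).
case/mat2_inj=> ea eb _ _.
move/(congr1 (@GLval _ _)): y2; rewrite GL_MxE ey GL1E mul_mat2.
case/mat2_inj; rewrite -eb => e1 _ _ _.
have eD : d = - a by rewrite -ea opprK.
rewrite -eb eD in ey; rewrite {ea eb eD}.
have idx i : GLval (J ^+ i * B)%g = mat2 a c c (- a) -> exists i, y = (J ^+ i * B)%g.
  by move=> e; exists i; apply: GLval_inj; rewrite ey e.
have := mem_F3 a; have := mem_F3 c; rewrite !inE => /or3P[]/eqP ec /or3P[]/eqP ea;
  move: e1; rewrite ea ec ?(mulr0, mul0r, mulr1, mul1r, addr0, add0r, mulrNN) => /eqP // _.
- by apply: (idx 0%N); rewrite ea ec ?expgS expg0 !glx.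
- by apply: (idx 2%N); rewrite ea ec ?expgS expg0 !glx.
- by apply: (idx 3%N); rewrite ea ec ?expgS expg0 !glx.
by apply: (idx 1%N); rewrite ea ec ?expgS expg0 !glx.
Qed.

Lemma square_group_isog : square_group \isog 'D_8.
Proof.
apply: isog_dihedral8; first exact: order_J.
- by apply/eqP => /(congr1 (@GLval _ _)); rewrite !glx => /mat2_inj[].
- by apply: GLval_inj; rewrite !glx.
- by apply/eqP => /(congr1 (@GLval _ _)); rewrite !glx => /mat2_inj[].
- by apply: GLval_inj; rewrite !glx.
by apply/eqP => /(congr1 (@GLval _ _)); rewrite !glx => /mat2_inj[].
Qed.

Lemma conj_square_group (H : {group GL}) : H \isog 'D_8 ->
  exists P : GL, H = (square_group :^ P)%G.
Proof.
exact: dihedral8_conj order4_conj J_sqr_B _.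
Qed.

End PlaneGroups.

(** * Assembly of the classification *)

Lemma conj_to_gen_iso (n : nat) (G : {group 'S_n}) N (U : finType) (e : 'I_n -> U) H :
  bijective e -> realizes e (gen_group n N) H ->
  conj_to_gen G N <-> perm_isomorphic G H.
Proof.
move=> be rH; split; last exact: (perm_isomorphic_conj be rH).
case=> s es; apply: (realizes_perm_isomorphic be (s := s)).
case: rH => GH HG; split=> [g gG|h /HG[g gN eg]]; first by apply: GH; rewrite -es.
by exists g; rewrite //= es.
Qed.

Lemma universal_transversalS (T : finType) (k : nat) (G H : {set {perm T}}) :
  G \subset H -> universal_transversal k G -> universal_transversal k H.
Proof.
move=> /subsetP sGH ut I P cI pP cP; have [g gG tg] := ut I P cI pP cP.
by exists g; first exact: sGH.
Qed.

Lemma conj_to_gen_ut (n k : nat) (G : {group 'S_n}) N N' starts :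
  transversal_check n k N starts -> {subset N <= N'} -> conj_to_gen G N' ->
  universal_transversal k G.
Proof.
move=> /transversal_checkP ut sN [s es].
have : universal_transversal k (G :^ s)%G.
  rewrite /= es; apply: universal_transversalS ut; apply: genS.
  by apply/subsetP => g; rewrite !inE; apply: sN.
by move/(universal_transversal_conj s^-1%g); rewrite /= conjsgK.
Qed.

Lemma conj_to_gen_not_homogeneous (n k : nat) (G : {group 'S_n}) N tb : k <= n ->
  all (fixes_table n k tb) N -> mixed n k tb -> conj_to_gen G N -> ~~ homogeneous k G.
Proof.
move=> kn fixN mix [s es]; apply/negP => /(homogeneousP G kn)/(set_homogeneous_conj s).
by rewrite /= es; apply: gen_group_not_homogeneous fixN mix.
Qed.

Lemma dichotomy1 (n k : nat) (G : {group 'S_n}) N starts tb (P : Prop) : k <= n ->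
  transversal_check n k N starts -> all (fixes_table n k tb) N && mixed n k tb ->
  (universal_transversal k G -> set_homogeneous k G \/ conj_to_gen G N) ->
  (conj_to_gen G N <-> P) ->
  (universal_transversal k G -> homogeneous k G \/ P) /\
  (P -> universal_transversal k G /\ ~~ homogeneous k G).
Proof.
move=> kn chk /andP[fixN mix] main eP; split.
  by case/main => [/(homogeneousP G kn)|/eP]; [left | right].
move/eP => H; split; first exact: conj_to_gen_ut chk _ H.
exact: conj_to_gen_not_homogeneous fixN mix H.
Qed.

Lemma dichotomy2 (n k : nat) (G : {group 'S_n}) N x starts tb (P : Prop) : k <= n ->
  transversal_check n k N starts -> all (fixes_table n k tb) (x :: N) && mixed n k tb ->
  (universal_transversal k G ->
     set_homogeneous k G \/ conj_to_gen G N \/ conj_to_gen G (x :: N)) ->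
  (conj_to_gen G N \/ conj_to_gen G (x :: N) <-> P) ->
  (universal_transversal k G -> homogeneous k G \/ P) /\
  (P -> universal_transversal k G /\ ~~ homogeneous k G).
Proof.
move=> kn chk /andP[fixxN mix] main eP; split.
  by case/main => [/(homogeneousP G kn)|/eP]; [left | right].
move/eP; have /andP[_ fixN] := fixxN; case=> H; split.
- exact: conj_to_gen_ut chk _ H.
- exact: conj_to_gen_not_homogeneous fixN mix H.
- by apply: conj_to_gen_ut chk _ H => y; rewrite inE orbC => ->.
exact: conj_to_gen_not_homogeneous fixxN mix H.
Qed.

Lemma never_exceptional (n k : nat) (G : {group 'S_n}) : k <= n ->
  (universal_transversal k G -> set_homogeneous k G) ->
  (universal_transversal k G -> homogeneous k G \/ False) /\
  (False -> universal_transversal k G /\ ~~ homogeneous k G).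
Proof. by move=> kn main; split=> // /main/(homogeneousP G kn); left. Qed.

Lemma or_iff (A B C D : Prop) : (A <-> C) -> (B <-> D) -> (A \/ B <-> C \/ D).
Proof. tauto. Qed.

(** Since [H] is given only up to isomorphism, it is first conjugated to [turn_group] or
    [square_group], and the labelling of the plane is moved by the same matrix. *)
Lemma affine_iso (G : {group 'S_9}) :
  conj_to_gen G C4_affine_list \/ conj_to_gen G (D8_affine_extra :: C4_affine_list) <->
  exists2 H : {group {'GL_2['F_3]}}, cyclic H /\ #|H| = 4 \/ H \isog 'D_8 &
    perm_isomorphic G (affine_group2 H).
Proof.
split.
  case=> /conj_to_gen_iso H.
    exists turn_group; first by left; apply: cyclic_turn_group.
    exact: H plane_point_bij realizes_C4_affine.
  exists square_group; first by right; apply: square_group_isog.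
  exact: H plane_point_bij realizes_D8_affine.
case=> H [[cH oH]|isoH].
  have [P ->] := conj_turn_group cH oH; left.
  have r := realizes_affine_conj P realizes_C4_affine.
  exact/(conj_to_gen_iso _ (plane_point_conj_bij P) r).
have [P ->] := conj_square_group isoH; right.
have r := realizes_affine_conj P realizes_D8_affine.
exact/(conj_to_gen_iso _ (plane_point_conj_bij P) r).
Qed.

Lemma id_bij (T : Type) : bijective (@id T).
Proof. by exists id. Qed.

(** For numerals n and k this reduces by computation to the relevant clause or to [False]. *)
Definition exceptional_at (n k : nat) (G : {group 'S_n}) : Prop :=
  match n, k with
  | 5, 2 => perm_isomorphic G (cyclic_group 5) \/ perm_isomorphic G (dihedral_group 5)
  | 6, 3 => perm_isomorphic G (PSL2 'F_5)
  | 7, 2 => perm_isomorphic G (cyclic_group 7) \/ perm_isomorphic G (dihedral_group 7)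
  | 7, 3 => perm_isomorphic G (AGL1 'F_7)
  | 8, 4 => perm_isomorphic G (PGL2 'F_7)
  | 9, 2 => exists2 H : {group {'GL_2['F_3]}}, cyclic H /\ #|H| = 4 \/ H \isog 'D_8 &
              perm_isomorphic G (affine_group2 H)
  | 10, 2 => perm_isomorphic G (on_two_subsets ('Alt_('I_5))%g) \/
             perm_isomorphic G (on_two_subsets ('Sym_('I_5))%g)
  | 10, 3 => perm_isomorphic G (PSL2 GF9) \/ perm_isomorphic G (PSigmaL2 GF9)
  | _, _ => False
  end.

Lemma exceptionalE (n k : nat) (G : {group 'S_n}) :
  exceptional k G <-> exceptional_at k G.
Proof.
split.
  case=> [[|| []]|[|| []]] [en ek H]; subst; exact: H.
rewrite /exceptional.
case: n G => [|[|[|[|[|[|[|[|[|[|[|n]]]]]]]]]]] G //; case: k => [|[|[|[|[|k]]]]] // H.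
- by left; apply: Or31.
- by left; apply: Or32.
- by left; apply: Or33; left.
- by left; apply: Or33; right.
- by right; apply: Or31.
- by right; apply: Or32.
- by right; apply: Or33; left.
- by right; apply: Or33; right.
Qed.

Theorem theorem1p3 (n k : nat) (G : {group 'S_n}) :
  n < 11 -> 2 <= k <= n./2 ->
  (universal_transversal k G -> homogeneous k G \/ exceptional k G) /\
  (exceptional k G -> universal_transversal k G /\ ~~ homogeneous k G).
Proof.
move=> ltn11 lek; suff : (universal_transversal k G -> homogeneous k G \/ exceptional_at k G) /\
  (exceptional_at k G -> universal_transversal k G /\ ~~ homogeneous k G).
  case=> H1 H2; split=> [/H1|/exceptionalE/H2 //].
  by case=> [|/exceptionalE]; [left | right].
(* Sixteen pairs (n, k) satisfy the bounds; eight of them have exceptions. *)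
move: n G ltn11 lek => [|[|[|[|[|[|[|[|[|[|[|n]]]]]]]]]]] G //= _;
  case: k => [|[|[|[|[|[|k]]]]]] //= _.
- exact: never_exceptional (@case_4_2 G).
- apply: (dichotomy2 (isT : 2 <= 5) transversal_C5 fixes_C5 (@case_5_2 G)).
  by apply: or_iff; apply: conj_to_gen_iso (id_bij _) _;
    [apply: realizes_cyclic | apply: realizes_dihedral].
- exact: never_exceptional (@case_6_2 G).
- apply: (dichotomy1 (isT : 3 <= 6) transversal_PSL25 fixes_PSL25 (@case_6_3 G)).
  exact: conj_to_gen_iso point5_bij realizes_PSL25.
- apply: (dichotomy2 (isT : 2 <= 7) transversal_C7 fixes_C7 (@case_7_2 G)).
  by apply: or_iff; apply: conj_to_gen_iso (id_bij _) _;
    [apply: realizes_cyclic | apply: realizes_dihedral].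
- apply: (dichotomy1 (isT : 3 <= 7) transversal_AGL17 fixes_AGL17 (@case_7_3 G)).
  exact: conj_to_gen_iso elt7_bij realizes_AGL17.
- exact: never_exceptional (@case_8_2 G).
- exact: never_exceptional (@case_8_3 G).
- apply: (dichotomy1 (isT : 4 <= 8) transversal_PGL27 fixes_PGL27 (@case_8_4 G)).
  exact: conj_to_gen_iso point7_bij realizes_PGL27.
- apply: (dichotomy2 (isT : 2 <= 9) transversal_C4_affine fixes_C4_affine (@case_9_2 G)).
  exact: affine_iso.
- exact: never_exceptional (@case_9_3 G).
- exact: never_exceptional (@case_9_4 G).
- apply: (dichotomy2 (isT : 2 <= 10) transversal_A5_pairs fixes_A5_pairs (@case_10_2 G)).
  apply: or_iff; first exact: conj_to_gen_iso pair_of_bij realizes_A5_pairs.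
  exact: conj_to_gen_iso pair_of_bij realizes_S5_pairs.
- apply: (dichotomy2 (isT : 3 <= 10) transversal_PSL29 fixes_PSL29 (@case_10_3 G)).
  apply: or_iff; first exact: conj_to_gen_iso point9_bij realizes_PSL29.
  exact: conj_to_gen_iso point9_bij realizes_PSigmaL29.
- exact: never_exceptional (@case_10_4 G).
- exact: never_exceptional (@case_10_5 G).
Qed.
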